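(* Suppose there exists a constant $C>0$ such that for all sufficiently large $X$, \[ \widetilde E(X)\ \le\ \tfrac{5}{6}\,\widetilde E(X^{3/4})\;+\;C\,X^{1/2}\log X . \] Then every nontrivial zero of the Riemann zeta function $\zeta(s)$ lies on the critical line $\Re(s)=\tfrac12$.
   Context: Let $\pi(m)$ be the number of primes $\le m$, $\psi$ the Chebyshev function $\psi(x)=\sum_{n\le x}\Lambda(n)$, and $E_\psi(y):=\psi(y)-y$. Let $\mathbb{N}_{\mathrm{comp}}$ denote the set of composite positive integers. The integer map $\mathcal{M}$ is defined by: for composite $m$, $\mathcal{M}(m)=m+\pi(m)$ (composites advance by $\pi(m)$); for a prime $p\ge 3$, $\mathcal{M}(p)=p-(p-p^-)=p^-$, where $p^-$ is the largest prime less than $p$ (primes step backward by their preceding prime gap). The trajectory of $y$ is the sequence $y_0=y$, $y_{j+1}=\mathcal{M}(y_j)$. For $X\ge 2$ put $W_X=[X,(1+0.1/\log X)X]$ and $\widetilde W_X=[X,(1+2/\log X)X]$, and let $\mathcal{T}(y;\widetilde W_X)$ denote the segment of the trajectory of $y$ lying inside $\widetilde W_X$. For large $X$ define \[ \widetilde E(X):=\sup_{y\in \widetilde W_X\cap\mathbb{N}_{\mathrm{comp}}}\Bigl|\sum_{\substack{m\in\mathcal{T}(y;\widetilde W_X)\\ m\in\mathbb{N}_{\mathrm{comp}}}} E_\psi(m)\Bigr| . \] *)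

(* Defs.v *)
From Stdlib Require Import Reals ZArith Znumtheory List Arith.
From Coquelicot Require Import Coquelicot.
Open Scope R_scope.

Definition isprime (n : nat) : bool :=
  if prime_dec (Z.of_nat n) then true else false.

Definition composite (n : nat) : Prop := (2 <= n)%nat /\ isprime n = false.

Definition sumR (f : nat -> R) (l : list nat) : R :=
  fold_right (fun n acc => f n + acc) 0 l.

Definition prime_pi (m : nat) : nat := length (filter isprime (seq 0 (S m))).

(* von Mangoldt: Lambda(n) = log p if n = p^k (p prime, k >= 1), else 0.
   At most one pair (p,k) with 2 <= p <= n, 1 <= k <= n satisfies p^k = n. *)
Definition vonMangoldt (n : nat) : R :=
  sumR (fun p => sumR (fun k =>
          if (isprime p && Nat.eqb (p ^ k) n)%bool then ln (INR p) else 0)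
        (seq 1 n)) (seq 2 n).

Definition psi (m : nat) : R := sumR vonMangoldt (seq 1 m).

Definition Epsi (m : nat) : R := psi m - INR m.

(* largest prime < n (0 if none) *)
Fixpoint prevprime (n : nat) : nat :=
  match n with
  | O => O
  | S m => if isprime m then m else prevprime m
  end.

(* the map M; on 0, 1, 2 (where the paper leaves M undefined) we set M m = m *)
Definition Mmap (m : nat) : nat :=
  if isprime m then (if Nat.leb 3 m then prevprime m else m)
  else if Nat.leb 2 m then (m + prime_pi m)%nat else m.

Definition traj (y : nat) (j : nat) : nat := Nat.iter j Mmap y.

Definition inWt (X : R) (m : nat) : Prop :=
  X <= INR m <= (1 + 2 / ln X) * X.

(* J is the exit index: y_0..y_{J-1} lie in the window, y_J does not;
   the segment T(y; W~_X) is y_0, ..., y_{J-1}. *)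
Definition exit_index (X : R) (y J : nat) : Prop :=
  (forall j, (j < J)%nat -> inWt X (traj y j)) /\ ~ inWt X (traj y J).

Definition seg_sum (y J : nat) : R :=
  sumR (fun j => if isprime (traj y j) then 0
                 else if Nat.leb 2 (traj y j) then Epsi (traj y j) else 0)
       (seq 0 J).

Definition Etilde (X : R) : Rbar :=
  Lub_Rbar (fun r => exists y : nat, composite y /\ inWt X y /\
             exists J : nat, exit_index X y J /\ r = Rabs (seg_sum y J)).

(* complex powers with positive real base: x^s = exp(s log x) *)
Definition cpow (x : R) (s : C) : C :=
  (exp (Re s * ln x) * cos (Im s * ln x), exp (Re s * ln x) * sin (Im s * ln x)).

(* zeta on Re s > 0, s <> 1, via the Dirichlet eta series:
   zeta(s) = eta(s) / (1 - 2^(1-s)),  eta(s) = sum_{n>=1} (-1)^(n-1) n^(-s).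
   is_zeta s z : z is the value zeta(s). *)
Definition is_zeta (s z : C) : Prop :=
  0 < Re s /\ s <> RtoC 1 /\
  exists eta : C,
    is_series (K := C_AbsRing) (V := C_NormedModule)
      (fun n : nat => Cmult (RtoC ((-1) ^ n)) (cpow (INR (S n)) (Copp s))) eta /\
    z = Cdiv eta (Cminus (RtoC 1) (cpow 2 (Cminus (RtoC 1) s))).

Definition nontrivial_zeta_zero (s : C) : Prop :=
  0 < Re s < 1 /\ is_zeta s (RtoC 0).

(* Main.v *)
Require Import Defs.
From Stdlib Require Import Reals ZArith Znumtheory List Arith Lra Lia Psatz.
From Coquelicot Require Import Coquelicot.
Open Scope R_scope.

(** For composite [y] the window with right end [y] contains only one point of the trajectory
    of [y], so [|Epsi y|] is at most some [Etilde X] with [X <= y]; iterating the recursion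
    gives [Etilde X = O(sqrt X * ln X)], hence [psi(n) - n = O(n^theta)] for every
    [theta > 1/2].

    Zeros to the right of the critical line.  Along the horizontal line [s = s0 - t], the
    functions [xi(s) = (s - 1) zeta(s)] and
    [D(s) = sum_n (psi(n) - n) (n^(-s) - (n+1)^(-s))] are power series in [t] which converge as
    long as [Re s > theta].  The identity [zeta' / zeta = - (D + zeta)], valid near [t = 0],
    becomes a linear differential equation for [xi]; by uniqueness of power series it holds up
    to [Re s > theta], and by Gronwall's inequality a zero of [xi] there would propagate back
    to the half-plane of absolute convergence.

    Zeros to the left.  With [w = 1 - s] and [U(x)] the integral of the fractional part over
    [[0, x]], [zeta(w)] is a multiple of the integral of [U(x) x^(-w-2)] over the half-line.
    The Fourier expansion [U(x) = x/2 - sum_n (sin (pi n x) / (pi n))^2] turns that integral into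
    a regularised multiple of [sum_n n^(-s)], so [zeta(s) = 0] implies [zeta(1 - s) = 0].  This
    needs neither the Gamma function nor an explicit functional equation. *)

(** * Finite sums and the von Mangoldt function *)

Fixpoint rsum (f : nat -> R) (N : nat) : R :=
  match N with O => 0 | S n => rsum f n + f (S n) end.

Lemma rsum_ext f g N : (forall n, (1 <= n <= N)%nat -> f n = g n) -> rsum f N = rsum g N.
Proof.
  induction N as [|N IH]; intros H; simpl; [easy|].
  rewrite IH, H; [easy|lia|]. intros; apply H; lia.
Qed.

Lemma rsum_le f g N : (forall n, (1 <= n <= N)%nat -> f n <= g n) -> rsum f N <= rsum g N.
Proof.
  induction N as [|N IH]; intros H; simpl; [lra|].
  apply Rplus_le_compat; [apply IH; intros; apply H; lia|apply H; lia].
Qed.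

Lemma rsum_zero f N : (forall n, (1 <= n <= N)%nat -> f n = 0) -> rsum f N = 0.
Proof.
  induction N as [|N IH]; intros H; simpl; [easy|].
  rewrite IH, H; [lra|lia|]. intros; apply H; lia.
Qed.

Lemma rsum_ge0 f N : (forall n, (1 <= n <= N)%nat -> 0 <= f n) -> 0 <= rsum f N.
Proof. intros H. rewrite <- (rsum_zero (fun _ => 0) N) by easy. now apply rsum_le. Qed.

Lemma rsum_plus f g N : rsum (fun n => f n + g n) N = rsum f N + rsum g N.
Proof. induction N as [|N IH]; simpl; [lra|rewrite IH; lra]. Qed.

Lemma rsum_scal c f N : rsum (fun n => c * f n) N = c * rsum f N.
Proof. induction N as [|N IH]; simpl; [lra|rewrite IH; lra]. Qed.

Lemma rsum_swap (f : nat -> nat -> R) N M :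
  rsum (fun n => rsum (f n) M) N = rsum (fun m => rsum (fun n => f n m) N) M.
Proof.
  induction N as [|N IH]; simpl.
  - symmetry; apply rsum_zero; easy.
  - rewrite IH, <- rsum_plus. easy.
Qed.

Lemma rsum_extend f N M : (N <= M)%nat -> (forall n, (N < n <= M)%nat -> f n = 0) ->
  rsum f M = rsum f N.
Proof.
  intros HNM; induction HNM as [|M HM IH]; intros H; [easy|].
  simpl; rewrite IH, H; [lra|lia|]. intros; apply H; lia.
Qed.

Lemma rsum_single f N a : (1 <= a <= N)%nat ->
  (forall n, (1 <= n <= N)%nat -> n <> a -> f n = 0) -> rsum f N = f a.
Proof.
  intros Ha H. rewrite (rsum_extend f a N) by (lia || (intros; apply H; lia)).
  destruct a as [|a]; [lia|]. simpl.
  rewrite rsum_zero by (intros; apply H; lia). apply Rplus_0_l.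
Qed.

Lemma rsum_shift f N : rsum f (S N) = f 1%nat + rsum (fun n => f (S n)) N.
Proof. induction N as [|N IH]; [simpl; lra|]. simpl in *. rewrite IH. lra. Qed.

Lemma rsum_term_le f N a : (1 <= a <= N)%nat ->
  (forall n, (1 <= n <= N)%nat -> 0 <= f n) -> f a <= rsum f N.
Proof.
  intros Ha H. set (g := fun n => if Nat.eqb n a then f a else 0).
  replace (f a) with (rsum g N).
  - apply rsum_le. intros n Hn. unfold g. destruct (Nat.eqb_spec n a) as [->|]; [lra|now apply H].
  - rewrite (rsum_single g N a Ha); unfold g; [now rewrite Nat.eqb_refl|].
    intros n _ Hn. apply Nat.eqb_neq in Hn. now rewrite Hn.
Qed.

Lemma sumR_app f l l' : sumR f (l ++ l') = sumR f l + sumR f l'.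
Proof. induction l as [|a l IH]; simpl; [lra|]. unfold sumR in *; simpl. rewrite IH; lra. Qed.

Lemma sumR_seq_S f a N : sumR f (seq a (S N)) = sumR f (seq a N) + f (a + N)%nat.
Proof. rewrite seq_S, sumR_app. unfold sumR; simpl. lra. Qed.

Lemma sumR_seq_rsum f a N : sumR f (seq (S a) N) = rsum (fun n => f (a + n)%nat) N.
Proof.
  induction N as [|N IH]; [easy|].
  rewrite sumR_seq_S, IH. simpl. do 2 f_equal. lia.
Qed.

Lemma isprime_prime n : isprime n = true <-> prime (Z.of_nat n).
Proof. unfold isprime; destruct (prime_dec (Z.of_nat n)); split; easy. Qed.

Lemma isprime_ge2 n : isprime n = true -> (2 <= n)%nat.
Proof. intros H%isprime_prime. apply prime_ge_2 in H. lia. Qed.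

Lemma isprime_divide_mul p a b : isprime p = true ->
  Nat.divide p (a * b) -> Nat.divide p a \/ Nat.divide p b.
Proof.
  intros Hp%isprime_prime [c Hc].
  destruct (prime_mult _ Hp (Z.of_nat a) (Z.of_nat b)) as [[x Hx]|[x Hx]].
  - exists (Z.of_nat c). lia.
  - left. exists (Z.to_nat x). pose proof (prime_ge_2 _ Hp). nia.
  - right. exists (Z.to_nat x). pose proof (prime_ge_2 _ Hp). nia.
Qed.

Lemma isprime_divide_prime p q : isprime p = true -> isprime q = true ->
  Nat.divide p q -> p = q.
Proof.
  intros Hp%isprime_prime Hq%isprime_prime [c Hc].
  assert (H : (Z.of_nat p | Z.of_nat q)%Z) by (exists (Z.of_nat c); lia).
  apply prime_div_prime in H; [lia|easy..].
Qed.

Lemma exists_prime_divisor n : (2 <= n)%nat -> exists q m, isprime q = true /\ n = (q * m)%nat.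
Proof.
  induction n as [n IH] using (well_founded_induction lt_wf). intros Hn.
  destruct (isprime n) eqn:Hp; [exists n, 1%nat; split; [easy|lia]|].
  assert (Hnp : ~ prime (Z.of_nat n)) by (rewrite <- isprime_prime, Hp; easy).
  apply not_prime_divide in Hnp; [|lia].
  destruct Hnp as (d & Hd & [e He]).
  destruct (IH (Z.to_nat d)) as (q & m & Hq & Hm); [lia|lia|].
  exists q, (m * Z.to_nat e)%nat. split; [easy|].
  assert (0 < e)%Z by nia. nia.
Qed.

Lemma prime_pow_divide_mul p q k m : isprime p = true -> isprime q = true -> p <> q ->
  Nat.divide (p ^ k) (q * m) -> Nat.divide (p ^ k) m.
Proof.
  intros Hp Hq Hne. revert m.
  induction k as [|k IH]; intros m H; [exists m; simpl; lia|].
  assert (Hd : Nat.divide p (q * m)).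
  { eapply Nat.divide_trans; [|exact H]. exists (p ^ k)%nat. simpl; lia. }
  apply isprime_divide_mul in Hd; [|easy].
  destruct Hd as [Hd|[c Hc]].
  - exfalso. apply Hne. apply isprime_divide_prime; easy.
  - subst m. destruct H as [e He].
    destruct (IH c) as [f Hf].
    + exists e. simpl in He. apply isprime_ge2 in Hp. nia.
    + exists f. subst c. simpl. lia.
Qed.

Lemma pow_ge_base p k : (2 <= p)%nat -> (1 <= k)%nat -> (p <= p ^ k)%nat.
Proof.
  intros Hp Hk. rewrite <- (Nat.pow_1_r p) at 1. apply Nat.pow_le_mono_r; lia.
Qed.

Definition dividesb (d n : nat) : bool := Nat.eqb (n mod d) 0.

Lemma dividesb_divide d n : dividesb d n = true <-> Nat.divide d n.
Proof. unfold dividesb. rewrite Nat.eqb_eq. apply Nat.Lcm0.mod_divide. Qed.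

Lemma dividesb_gt d n : (1 <= n < d)%nat -> dividesb d n = false.
Proof.
  intros H. apply Bool.not_true_is_false. rewrite dividesb_divide.
  intros Hd. apply Nat.divide_pos_le in Hd; lia.
Qed.

Lemma dividesb_ext d n d' n' :
  (Nat.divide d n <-> Nat.divide d' n') -> dividesb d n = dividesb d' n'.
Proof. intros H. apply Bool.eq_true_iff_eq. now rewrite !dividesb_divide. Qed.

Definition prime_weight (p : nat) (b : bool) : R :=
  if (isprime p && b)%bool then ln (INR p) else 0.

Lemma prime_weight_false p : prime_weight p false = 0.
Proof. unfold prime_weight. now rewrite Bool.andb_false_r. Qed.

Lemma prime_weight_ge0 p b : 0 <= prime_weight p b.
Proof.
  unfold prime_weight. destruct (isprime p) eqn:Hp; [destruct b|]; simpl; try lra.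
  apply isprime_ge2, le_INR in Hp. simpl in Hp. rewrite <- ln_1. apply ln_le; lra.
Qed.

Lemma prime_weight_ext p b b' : ((2 <= p)%nat -> b = b') -> prime_weight p b = prime_weight p b'.
Proof.
  intros H. unfold prime_weight. destruct (isprime p) eqn:Hp; [|easy].
  rewrite H; [easy|]. now apply isprime_ge2.
Qed.

Lemma vonMangoldt_rsum B n : (1 <= n < B)%nat ->
  vonMangoldt n = rsum (fun p => rsum (fun k => prime_weight p (Nat.eqb (p ^ k) n)) B) B.
Proof.
  intros Hn.
  assert (Hbig : forall p k, (1 <= k)%nat -> (n < p \/ n <= k)%nat ->
    prime_weight p (Nat.eqb (p ^ k) n) = 0).
  { intros p k Hk H. rewrite <- (prime_weight_false p). apply prime_weight_ext. intros Hp.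
    pose proof (Nat.pow_gt_lin_r p k ltac:(lia)). pose proof (pow_ge_base p k Hp Hk).
    apply Nat.eqb_neq. lia. }
  transitivity (rsum (fun p => rsum (fun k => prime_weight p (Nat.eqb (p ^ k) n)) n) (S n)).
  - unfold vonMangoldt. rewrite sumR_seq_rsum, rsum_shift, (rsum_zero (fun k => prime_weight 1 _)),
      Rplus_0_l.
    + apply rsum_ext. intros p _. now rewrite sumR_seq_rsum.
    + intros k _. rewrite <- (prime_weight_false 1). apply prime_weight_ext. lia.
  - rewrite <- (rsum_extend _ (S n) B).
    + apply rsum_ext. intros p _. symmetry. apply rsum_extend; [lia|].
      intros k Hk. apply Hbig; lia.
    + lia.
    + intros p Hp. apply rsum_zero. intros k Hk. apply Hbig; lia.
Qed.

(* The factorization [n = prod_p p^(v_p n)] after taking logarithms: each prime [p] contributes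
   [v_p n] terms [ln p].  The cutoff [B] only has to exceed [n]. *)
Definition ln_prime_powers (B n : nat) : R :=
  rsum (fun p => rsum (fun k => prime_weight p (dividesb (p ^ k) n)) B) B.

Lemma rsum_prime_powers_mul_same B q m : isprime q = true -> (1 <= m)%nat -> (q * m < B)%nat ->
  rsum (fun k => prime_weight q (dividesb (q ^ k) (q * m))) B =
  ln (INR q) + rsum (fun k => prime_weight q (dividesb (q ^ k) m)) B.
Proof.
  intros Hq Hm HB. pose proof (isprime_ge2 _ Hq) as Hq2.
  destruct B as [|B]; [lia|]. rewrite rsum_shift. f_equal.
  - replace (dividesb (q ^ 1) (q * m)) with true.
    + unfold prime_weight. now rewrite Hq.
    + symmetry. apply dividesb_divide. exists m. simpl. lia.
  - simpl (rsum _ (S B)).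
    pose proof (Nat.pow_gt_lin_r q (S B) ltac:(lia)) as Hpow.
    rewrite (dividesb_gt (q * q ^ B)), prime_weight_false, Rplus_0_r by (simpl in Hpow; nia).
    apply rsum_ext. intros k _. f_equal. apply dividesb_ext.
    simpl. apply Nat.mul_divide_cancel_l. lia.
Qed.

Lemma rsum_prime_powers_mul_other B p q m : isprime q = true -> p <> q ->
  rsum (fun k => prime_weight p (dividesb (p ^ k) (q * m))) B =
  rsum (fun k => prime_weight p (dividesb (p ^ k) m)) B.
Proof.
  intros Hq Hne. apply rsum_ext. intros k _. unfold prime_weight.
  destruct (isprime p) eqn:Hp; [|easy].
  rewrite (dividesb_ext _ (q * m) (p ^ k) m); [easy|].
  split; [now apply prime_pow_divide_mul|]. apply Nat.divide_mul_r.
Qed.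

Lemma ln_prime_powers_mul B q m : isprime q = true -> (1 <= m)%nat -> (q * m < B)%nat ->
  ln_prime_powers B (q * m) = ln (INR q) + ln_prime_powers B m.
Proof.
  intros Hq Hm HB. pose proof (isprime_ge2 _ Hq).
  set (at_q := fun p => if Nat.eqb p q then ln (INR q) else 0).
  replace (ln (INR q)) with (rsum at_q B).
  - unfold ln_prime_powers. rewrite <- rsum_plus.
    apply rsum_ext. intros p _. unfold at_q.
    destruct (Nat.eqb_spec p q) as [->|Hne].
    + now apply rsum_prime_powers_mul_same.
    + rewrite Rplus_0_l. now apply rsum_prime_powers_mul_other.
  - rewrite (rsum_single at_q B q); unfold at_q; [now rewrite Nat.eqb_refl|nia|].
    intros p _ Hne. apply Nat.eqb_neq in Hne. now rewrite Hne.
Qed.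

Lemma ln_prime_powers_eq B n : (1 <= n < B)%nat -> ln_prime_powers B n = ln (INR n).
Proof.
  induction n as [n IH] using (well_founded_induction lt_wf). intros Hn.
  destruct (Nat.eq_dec n 1) as [->|Hn1].
  - simpl INR. rewrite ln_1. apply rsum_zero. intros p _. apply rsum_zero. intros k Hk.
    rewrite <- (prime_weight_false p). apply prime_weight_ext. intros Hp.
    apply dividesb_gt. pose proof (pow_ge_base p k Hp). lia.
  - destruct (exists_prime_divisor n) as (q & m & Hq & ->); [lia|].
    pose proof (isprime_ge2 _ Hq). assert (1 <= m)%nat by nia.
    rewrite ln_prime_powers_mul, IH, mult_INR, ln_mult by (easy || nia || (apply lt_0_INR; lia)).
    easy.
Qed.

Lemma sum_divisors_vonMangoldt N n : (1 <= n <= N)%nat ->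
  rsum (fun d => if dividesb d n then vonMangoldt d else 0) N = ln (INR n).
Proof.
  intros Hn. rewrite <- (ln_prime_powers_eq (S N) n) by lia.
  transitivity (rsum (fun d => rsum (fun p => rsum (fun k =>
    prime_weight p (Nat.eqb (p ^ k) d && dividesb d n)) (S N)) (S N)) N).
  { apply rsum_ext. intros d Hd. rewrite (vonMangoldt_rsum (S N) d) by lia.
    destruct (dividesb d n).
    - do 2 (apply rsum_ext; intros). now rewrite Bool.andb_true_r.
    - symmetry. do 2 (apply rsum_zero; intros). now rewrite Bool.andb_false_r, prime_weight_false. }
  rewrite rsum_swap. apply rsum_ext. intros p Hp.
  rewrite rsum_swap. apply rsum_ext. intros k Hk.
  assert (Hne : forall d, d <> (p ^ k)%nat -> prime_weight p (Nat.eqb (p ^ k) d && dividesb d n) = 0).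
  { intros d Hd. apply not_eq_sym, Nat.eqb_neq in Hd. rewrite Hd. apply prime_weight_false. }
  destruct (Nat.le_gt_cases (p ^ k) N) as [Hle|Hgt].
  - rewrite (rsum_single _ N (p ^ k)).
    + now rewrite Nat.eqb_refl.
    + split; [|easy]. apply Nat.neq_0_lt_0, Nat.pow_nonzero. lia.
    + intros d _. apply Hne.
  - rewrite dividesb_gt, prime_weight_false by lia.
    apply rsum_zero. intros d Hd. apply Hne. lia.
Qed.

Lemma vonMangoldt_ge0 n : 0 <= vonMangoldt n.
Proof.
  unfold vonMangoldt. rewrite sumR_seq_rsum. apply rsum_ge0. intros p _.
  rewrite sumR_seq_rsum. apply rsum_ge0. intros k _. apply prime_weight_ge0.
Qed.

Lemma vonMangoldt_le_ln n : (1 <= n)%nat -> vonMangoldt n <= ln (INR n).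
Proof.
  intros Hn. rewrite <- (sum_divisors_vonMangoldt n n) by lia.
  set (f := fun d => if dividesb d n then vonMangoldt d else 0).
  replace (vonMangoldt n) with (f n).
  - apply rsum_term_le; [lia|]. intros d _. unfold f.
    destruct (dividesb d n); [apply vonMangoldt_ge0|lra].
  - unfold f. replace (dividesb n n) with true; [easy|].
    symmetry. apply dividesb_divide, Nat.divide_refl.
Qed.

Lemma Epsi_rsum n : Epsi n = rsum (fun m => vonMangoldt m - 1) n.
Proof.
  unfold Epsi, psi. rewrite sumR_seq_rsum. induction n as [|n IH]; [simpl; ring|].
  cbn [rsum]. rewrite <- IH, S_INR. simpl. ring.
Qed.

(** * From the recursion to a bound on psi(n) - n *)

Lemma exp_le_compat x y : x <= y -> exp x <= exp y.
Proof. intros [H| ->]; [left; now apply exp_increasing|lra]. Qed.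

Lemma ln_ge0 x : 1 <= x -> 0 <= ln x.
Proof. intros H. rewrite <- ln_1. apply ln_le; lra. Qed.

Lemma ln_Rpower x a : ln (Rpower x a) = a * ln x.
Proof. apply ln_exp. Qed.

Lemma ln_le_Rpower e x : 0 < e -> ln x <= / e * Rpower x e.
Proof.
  intros He. unfold Rpower. pose proof (exp_ineq1_le (e * ln x)).
  apply Rmult_le_reg_l with e; [easy|]. rewrite <- Rmult_assoc, Rinv_r, Rmult_1_l by lra. lra.
Qed.

Lemma INR_ge1 n : (1 <= n)%nat -> 1 <= INR n.
Proof. exact (le_INR 1 n). Qed.

Lemma sqrt_mul_ln_le x y : 1 <= x <= y -> sqrt x * ln x <= sqrt y * ln y.
Proof.
  intros H. apply Rmult_le_compat; [apply sqrt_pos|apply ln_ge0; lra| |apply ln_le; lra].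
  apply sqrt_le_1_alt. lra.
Qed.

Lemma sqrt_mul_ln_ge1 x : exp 1 <= x -> 1 <= sqrt x * ln x.
Proof.
  intros H. pose proof (exp_ineq1_le 1).
  rewrite <- (Rmult_1_l 1). apply Rmult_le_compat; try lra.
  - rewrite <- sqrt_1. apply sqrt_le_1_alt. lra.
  - rewrite <- (ln_exp 1). apply ln_le; lra.
Qed.

Lemma Rbar_le_affine (e e' : Rbar) (q b c : R) : 0 < q -> Rbar_le e' b ->
  Rbar_le e (Rbar_plus (Rbar_mult q e') c) -> Rbar_le e (q * b + c).
Proof.
  intros Hq Hb He. eapply Rbar_le_trans; [exact He|].
  destruct e' as [r| |]; simpl in Hb; [|easy|].
  - simpl. apply Rplus_le_compat_r, Rmult_le_compat_l; lra.
  - unfold Rbar_mult, Rbar_mult'. destruct (Rle_dec 0 q) as [h|h]; [|lra].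
    now destruct (Rle_lt_or_eq_dec 0 q h); [|lra].
Qed.

Section Recursion.

Variables (E : R -> Rbar) (q alpha C A : R).
Hypotheses (Hq : 0 < q) (Halpha : 0 < alpha < 1) (Hqalpha : q * alpha < 1) (HC : 0 <= C).
Hypothesis (HA : exp 1 <= A).
Hypothesis (E_bounded : forall B, exists M : R, forall X, A <= X <= B -> Rbar_le (E X) M).
Hypothesis (E_recursion : forall X, A <= X ->
  Rbar_le (E X) (Rbar_plus (Rbar_mult q (E (Rpower X alpha))) (C * sqrt X * ln X))).

Lemma recursion_step (K X : R) : C <= (1 - q * alpha) * K -> A <= X ->
  Rbar_le (E (Rpower X alpha)) (K * (sqrt (Rpower X alpha) * ln (Rpower X alpha))) ->
  Rbar_le (E X) (K * (sqrt X * ln X)).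
Proof.
  intros HK HX HE. pose proof (exp_ineq1_le 1).
  assert (Hln : 0 <= ln X) by (apply ln_ge0; lra).
  assert (Hsqrt : sqrt (Rpower X alpha) <= sqrt X).
  { apply sqrt_le_1_alt. rewrite <- (Rpower_1 X) at 2 by lra. apply Rle_Rpower; lra. }
  eapply Rbar_le_trans; [exact (Rbar_le_affine _ _ q _ _ Hq HE (E_recursion X HX))|].
  rewrite ln_Rpower. simpl.
  assert (HK0 : 0 <= K) by nra.
  assert (0 <= sqrt X * ln X) by (apply Rmult_le_pos; [apply sqrt_pos|easy]).
  assert (Hcontract : K * (q * alpha) * (sqrt (Rpower X alpha) * ln X) <=
    K * (q * alpha) * (sqrt X * ln X)).
  { apply Rmult_le_compat_l; [repeat apply Rmult_le_pos; lra|]. now apply Rmult_le_compat_r. }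
  nra.
Qed.

Lemma recursion_growth : exists K, 0 < K /\ forall X, A <= X -> Rbar_le (E X) (K * (sqrt X * ln X)).
Proof.
  pose proof (exp_ineq1_le 1).
  assert (HlnA : 1 <= ln A) by (rewrite <- (ln_exp 1); apply ln_le; lra).
  destruct (E_bounded (Rpower A (/ alpha))) as [M HM].
  set (K := Rabs M + C / (1 - q * alpha) + 1).
  assert (HCq : 0 <= C / (1 - q * alpha)) by (apply Rdiv_le_0_compat; lra).
  pose proof (Rabs_pos M). pose proof (Rle_abs M).
  assert (HCK : C <= (1 - q * alpha) * K).
  { rewrite Rmult_comm. apply Rle_div_l; [lra|]. unfold K. lra. }
  exists K. split; [unfold K; lra|].
  assert (Hiter : forall k X, A <= X -> ln X <= (/ alpha) ^ k * ln A ->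
    Rbar_le (E X) (K * (sqrt X * ln X))).
  { induction k as [|k IH]; intros X HX Hk;
      (destruct (Rle_dec X (Rpower A (/ alpha))) as [Hs|Hs];
       [eapply Rbar_le_trans; [now apply HM|]; simpl;
        pose proof (sqrt_mul_ln_ge1 X ltac:(lra)); unfold K; nra|]).
    - exfalso. apply Hs. rewrite <- (exp_ln X) by lra. unfold Rpower. apply exp_le_compat.
      simpl in Hk. pose proof (Rinv_le_contravar alpha 1 ltac:(lra) ltac:(lra)).
      rewrite Rinv_1 in *. nra.
    - apply recursion_step; [easy..|]. apply IH.
      + replace A with (Rpower (Rpower A (/ alpha)) alpha).
        * apply Rle_Rpower_l; [lra|]. split; [apply exp_pos|lra].
        * rewrite Rpower_mult, Rinv_l, Rpower_1 by lra. easy.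
      + rewrite ln_Rpower. replace ((/ alpha) ^ k * ln A) with (alpha * ((/ alpha) ^ S k * ln A))
          by (simpl; field; lra).
        apply Rmult_le_compat_l; lra. }
  intros X HX.
  destruct (Pow_x_infinity (/ alpha)) with (b := ln X) as [k Hk].
  { rewrite Rabs_pos_eq by (left; apply Rinv_0_lt_compat; lra).
    rewrite <- Rinv_1. apply Rinv_lt_contravar; lra. }
  specialize (Hk k ltac:(lia)).
  assert (0 < (/ alpha) ^ k) by (apply pow_lt, Rinv_0_lt_compat; lra).
  rewrite Rabs_pos_eq in Hk by lra.
  apply (Hiter k); [easy|]. nra.
Qed.

End Recursion.

Lemma isprime_2 : isprime 2 = true.
Proof. apply isprime_prime. exact prime_2. Qed.

Lemma even_not_isprime n : (2 < n)%nat -> Nat.even n = true -> isprime n = false.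
Proof.
  intros Hn He. destruct (isprime n) eqn:Hp; [|easy].
  apply Nat.even_spec in He. destruct He as [m Hm].
  assert (2%nat = n) by (apply isprime_divide_prime; [apply isprime_2|easy|exists m; lia]). lia.
Qed.

Lemma composite_pred_prime n : (4 <= n)%nat -> isprime (S n) = true -> composite n.
Proof.
  intros Hn Hp. split; [lia|]. apply even_not_isprime; [lia|].
  destruct (Nat.even n) eqn:Ev; [easy|].
  rewrite even_not_isprime in Hp; [easy|lia|].
  now rewrite Nat.even_succ, <- Nat.negb_even, Ev.
Qed.

Lemma prime_pi_pos m : (2 <= m)%nat -> (1 <= prime_pi m)%nat.
Proof.
  intros Hm. unfold prime_pi.
  assert (H : In 2%nat (filter isprime (seq 0 (S m)))).
  { apply filter_In. split; [apply in_seq; lia|exact isprime_2]. }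
  destruct (filter isprime (seq 0 (S m))); [easy|simpl; lia].
Qed.

Lemma prevprime_prime n : (3 <= n)%nat -> isprime (prevprime n) = true.
Proof.
  induction n as [|n IH]; intros Hn; [lia|]. simpl.
  destruct (isprime n) eqn:Hp; [easy|].
  apply IH. destruct (Nat.eq_dec n 2) as [->|]; [|lia].
  rewrite isprime_2 in Hp; easy.
Qed.

Lemma Mmap_composite m : composite m -> Mmap m = (m + prime_pi m)%nat.
Proof.
  intros [Hm Hp]. unfold Mmap. rewrite Hp. now rewrite (proj2 (Nat.leb_le 2 m) Hm).
Qed.

Lemma Mmap_prime p : isprime p = true -> isprime (Mmap p) = true.
Proof.
  intros Hp. unfold Mmap. rewrite Hp.
  destruct (Nat.leb_spec 3 p); [now apply prevprime_prime|easy].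
Qed.

(* Once a trajectory reaches a prime it never leaves the primes, and before that it
   strictly increases. *)
Lemma traj_prime_or_large y j : (2 <= y)%nat ->
  isprime (traj y j) = true \/ (j + 2 <= traj y j)%nat.
Proof.
  intros Hy. induction j as [|j IH]; [right; simpl; lia|].
  change (traj y (S j)) with (Mmap (traj y j)).
  destruct (isprime (traj y j)) eqn:Hp; [left; now apply Mmap_prime|].
  right. destruct IH as [IH|IH]; [easy|].
  rewrite Mmap_composite by (split; [lia|easy]).
  pose proof (prime_pi_pos (traj y j) ltac:(lia)). lia.
Qed.

Definition composite_Epsi (m : nat) : R :=
  if isprime m then 0 else if Nat.leb 2 m then Epsi m else 0.

Lemma composite_Epsi_composite m : composite m -> composite_Epsi m = Epsi m.
Proof.
  intros [Hm Hp]. unfold composite_Epsi. rewrite Hp. now rewrite (proj2 (Nat.leb_le 2 m) Hm).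
Qed.

Definition total_Epsi (M : nat) : R := rsum (fun n => Rabs (Epsi n)) M.

Lemma total_Epsi_ge0 M : 0 <= total_Epsi M.
Proof. apply rsum_ge0. intros; apply Rabs_pos. Qed.

Lemma Epsi_le_total M n : (1 <= n <= M)%nat -> Rabs (Epsi n) <= total_Epsi M.
Proof.
  intros Hn. apply (rsum_term_le (fun n => Rabs (Epsi n))); [easy|].
  intros; apply Rabs_pos.
Qed.

Lemma sumR_seq_Rabs_le (f : nat -> R) J M E : 0 <= E ->
  (forall j, (j < J)%nat -> Rabs (f j) <= if Nat.ltb j M then E else 0) ->
  Rabs (sumR f (seq 0 J)) <= INR M * E.
Proof.
  intros HE. revert M. induction J as [|J IH]; intros M Hf.
  - simpl. rewrite Rabs_R0. apply Rmult_le_pos; [apply pos_INR|easy].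
  - rewrite sumR_seq_S. eapply Rle_trans; [apply Rabs_triang|].
    pose proof (Hf J ltac:(lia)) as HJ. simpl.
    destruct (Nat.ltb_spec J M) as [HJM|HJM].
    + destruct M as [|M]; [lia|].
      assert (Rabs (sumR f (seq 0 J)) <= INR M * E); [|rewrite S_INR; lra].
      apply IH. intros j Hj.
      replace (Nat.ltb j M) with (Nat.ltb j (S M)); [apply Hf; lia|].
      rewrite (proj2 (Nat.ltb_lt j (S M))), (proj2 (Nat.ltb_lt j M)) by lia. easy.
    + assert (Rabs (sumR f (seq 0 J)) <= INR M * E); [|lra].
      apply IH. intros j Hj. apply Hf. lia.
Qed.

Lemma seg_sum_bound X y J M : (2 <= y)%nat -> exit_index X y J ->
  (1 + 2 / ln X) * X <= INR M -> Rabs (seg_sum y J) <= INR M * total_Epsi M.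
Proof.
  intros Hy [HJ _] HM.
  apply (sumR_seq_Rabs_le (fun j => composite_Epsi (traj y j))); [apply total_Epsi_ge0|].
  intros j Hj. destruct (HJ j Hj) as [_ HjX].
  assert (HjM : (traj y j <= M)%nat) by (apply INR_le; lra).
  destruct (isprime (traj y j)) eqn:Hp.
  - unfold composite_Epsi. rewrite Hp, Rabs_R0.
    destruct (Nat.ltb j M); [apply total_Epsi_ge0|lra].
  - destruct (traj_prime_or_large y j Hy) as [H|H]; [congruence|].
    rewrite composite_Epsi_composite by (split; [lia|easy]).
    rewrite (proj2 (Nat.ltb_lt j M)) by lia. apply Epsi_le_total. lia.
Qed.

Lemma Etilde_upper X (b : R) :
  (forall y J, composite y -> exit_index X y J -> Rabs (seg_sum y J) <= b) -> Rbar_le (Etilde X) b.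
Proof.
  intros H. apply Lub_Rbar_correct. intros r (y & Hy & _ & J & HJ & ->). now apply H.
Qed.

Lemma Etilde_ge X y J : composite y -> inWt X y -> exit_index X y J ->
  Rbar_le (Rabs (seg_sum y J)) (Etilde X).
Proof.
  intros Hy HX HJ.
  apply (proj1 (Lub_Rbar_correct (fun r => exists y : nat, composite y /\ inWt X y /\
    exists J : nat, exit_index X y J /\ r = Rabs (seg_sum y J)))).
  exists y. split; [easy|]. split; [easy|]. now exists J.
Qed.

Lemma Etilde_bounded B : exists M : R, forall X, exp 2 <= X <= B -> Rbar_le (Etilde X) M.
Proof.
  pose proof (exp_pos 2).
  destruct (nfloor_ex (2 * Rmax 0 B)) as [N [_ HN]]; [pose proof (Rmax_l 0 B); lra|].
  exists (INR (S N) * total_Epsi (S N)). intros X HX.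
  apply Etilde_upper. intros y J Hy HJ. apply (seg_sum_bound X); [apply Hy|easy|].
  assert (Hln : 2 <= ln X) by (rewrite <- (ln_exp 2); apply ln_le; lra).
  assert (2 / ln X <= 1) by (apply Rle_div_l; lra).
  pose proof (Rmax_r 0 B). rewrite S_INR. nra.
Qed.

Lemma window_with_right_end (y : R) : 16 <= ln y -> 0 < y ->
  exists X, y / 2 <= X <= y /\ 1 < X /\ (1 + 2 / ln X) * X = y.
Proof.
  intros Hln Hy.
  assert (Hln_low : forall x, y / 2 <= x -> 15 <= ln x).
  { intros x Hx. apply Rle_trans with (ln (y / 2)); [|apply ln_le; lra].
    unfold Rdiv. rewrite ln_mult, ln_Rinv by lra.
    assert (ln 2 < 1); [|lra].
    rewrite <- (ln_exp 1). apply ln_increasing; [lra|]. pose proof (exp_ineq1 1 ltac:(lra)). lra. }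
  destruct (Ranalysis5.f_interv_is_interv (fun x => (1 + 2 / ln x) * x) (y / 2) y y)
    as (X & HX & HXe); [lra| | |].
  - pose proof (Hln_low (y / 2) ltac:(lra)). split.
    + assert (2 / ln (y / 2) <= 1) by (apply Rle_div_l; lra). nra.
    + assert (0 <= 2 / ln y) by (apply Rdiv_le_0_compat; lra). nra.
  - intros x Hx. pose proof (Hln_low x ltac:(lra)).
    apply continuity_pt_filterlim, (ex_derive_continuous (fun x => (1 + 2 / ln x) * x)).
    auto_derive. split; [lra|split; [lra|easy]].
  - exists X. pose proof (Hln_low X ltac:(lra)). split; [lra|]. split; [|easy].
    apply ln_lt_inv; [lra..|]. rewrite ln_1. lra.
Qed.

(* The window whose right end is exactly [y] is left by [y] after one step. *)
Lemma Epsi_le_Etilde y : composite y -> 16 <= ln (INR y) ->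
  exists X, INR y / 2 <= X <= INR y /\ Rbar_le (Rabs (Epsi y)) (Etilde X).
Proof.
  intros Hy Hln. pose proof (proj1 Hy) as Hy2. apply le_INR in Hy2. simpl in Hy2.
  destruct (window_with_right_end (INR y) Hln ltac:(lra)) as (X & HX & HX1 & Hend).
  exists X. split; [lra|].
  replace (Rabs (Epsi y)) with (Rabs (seg_sum y 1)).
  - assert (Hin : inWt X y) by (unfold inWt; lra).
    apply Etilde_ge; [easy|easy|]. split.
    + intros j Hj. now replace j with 0%nat by lia.
    + unfold inWt. change (traj y 1) with (Mmap y).
      rewrite Mmap_composite, plus_INR by easy.
      pose proof (INR_ge1 _ (prime_pi_pos y (proj1 Hy))). lra.
  - change (seg_sum y 1) with (composite_Epsi y + 0).
    now rewrite composite_Epsi_composite, Rplus_0_r.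
Qed.

Lemma Epsi_S_le n : Rabs (Epsi (S n)) <= Rabs (Epsi n) + ln (INR (S n)) + 1.
Proof.
  rewrite !Epsi_rsum. cbn [rsum].
  eapply Rle_trans; [apply Rabs_triang|].
  pose proof (vonMangoldt_ge0 (S n)). pose proof (vonMangoldt_le_ln (S n) ltac:(lia)).
  assert (Rabs (vonMangoldt (S n) - 1) <= ln (INR (S n)) + 1) by (apply Rabs_le; lra). lra.
Qed.

Definition Etilde_recursion (C X0 : R) : Prop :=
  forall X : R, X0 <= X ->
     Rbar_le (Etilde X)
       (Rbar_plus (Rbar_mult (Finite (5 / 6)) (Etilde (Rpower X (3 / 4))))
                  (Finite (C * sqrt X * ln X))).

Lemma Epsi_composite_growth (C X0 : R) : 0 < C -> Etilde_recursion C X0 ->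
  exists K Y, 0 < K /\ forall y, composite y -> Y <= INR y ->
    Rabs (Epsi y) <= K * (sqrt (INR y) * ln (INR y)).
Proof.
  intros HC Hrec.
  set (A := Rmax X0 (exp 2)).
  assert (HA0 : X0 <= A) by apply Rmax_l.
  assert (HA2 : exp 2 <= A) by apply Rmax_r.
  pose proof (exp_ineq1_le 1). pose proof (exp_le_compat 1 2 ltac:(lra)).
  destruct (recursion_growth Etilde (5 / 6) (3 / 4) C A) as (K & HK & HKA); try lra.
  - intros B. destruct (Etilde_bounded B) as [M HM]. exists M. intros X HX. apply HM. lra.
  - intros X HX. apply Hrec. lra.
  - exists K, (2 * A + exp 16). split; [easy|]. intros y Hy HyY.
    pose proof (exp_pos 16).
    assert (Hln : 16 <= ln (INR y)) by (rewrite <- (ln_exp 16); apply ln_le; lra).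
    destruct (Epsi_le_Etilde y Hy Hln) as (X & HX & HE).
    pose proof (Rbar_le_trans _ _ _ HE (HKA X ltac:(lra))) as Hb. simpl in Hb.
    eapply Rle_trans; [exact Hb|]. apply Rmult_le_compat_l; [lra|].
    apply sqrt_mul_ln_le. lra.
Qed.

Lemma Epsi_growth (C X0 : R) : 0 < C -> Etilde_recursion C X0 ->
  exists K Y, 0 < K /\ forall n, Y <= INR n -> Rabs (Epsi n) <= K * (sqrt (INR n) * ln (INR n)).
Proof.
  intros HC Hrec. destruct (Epsi_composite_growth C X0 HC Hrec) as (K & Y & HK & HKY).
  pose proof (exp_ineq1_le 1).
  exists (K + 2), (Rmax (Y + 1) (exp 1 + 5)). split; [lra|]. intros n Hn.
  pose proof (Rmax_l (Y + 1) (exp 1 + 5)). pose proof (Rmax_r (Y + 1) (exp 1 + 5)).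
  assert (Hn5 : (5 <= n)%nat) by (apply INR_le; simpl; lra).
  pose proof (sqrt_mul_ln_ge1 (INR n) ltac:(lra)).
  destruct (isprime n) eqn:Hp.
  - destruct n as [|n]; [lia|].
    assert (Hpred : INR (S n) = INR n + 1) by apply S_INR.
    pose proof (HKY n (composite_pred_prime n ltac:(lia) Hp) ltac:(lra)).
    pose proof (sqrt_mul_ln_le (INR n) (INR (S n)) ltac:(lra)).
    assert (ln (INR (S n)) <= sqrt (INR (S n)) * ln (INR (S n))).
    { rewrite <- (Rmult_1_l (ln _)) at 1. apply Rmult_le_compat_r; [apply ln_ge0; lra|].
      rewrite <- sqrt_1. apply sqrt_le_1_alt. lra. }
    pose proof (Epsi_S_le n). nra.
  - pose proof (HKY n ltac:(split; [lia|easy]) ltac:(lra)). nra.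
Qed.

Definition power_bounded (F : nat -> R) (theta : R) : Prop :=
  exists K, 0 < K /\ forall n, (1 <= n)%nat -> Rabs (F n) <= K * Rpower (INR n) theta.

Lemma power_bounded_of_eventually (F : nat -> R) (theta K Y : R) : 0 <= theta -> 0 < K ->
  (forall n, Y <= INR n -> Rabs (F n) <= K * Rpower (INR n) theta) -> power_bounded F theta.
Proof.
  intros Hth HK HF.
  destruct (nfloor_ex (Rmax 0 Y)) as [N [_ HN]]; [apply Rmax_l|].
  pose proof (Rmax_r 0 Y).
  set (M := rsum (fun n => Rabs (F n)) N).
  assert (HM : 0 <= M) by (apply rsum_ge0; intros; apply Rabs_pos).
  exists (K + M). split; [lra|]. intros n Hn.
  assert (Hpow : 1 <= Rpower (INR n) theta).
  { pose proof (INR_ge1 n Hn). rewrite <- (Rpower_O (INR n)) by lra. apply Rle_Rpower; lra. }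
  destruct (Nat.le_gt_cases n N) as [HnN|HnN].
  - assert (Rabs (F n) <= M); [|nra].
    apply (rsum_term_le (fun n => Rabs (F n))); [lia|]. intros; apply Rabs_pos.
  - apply Rle_trans with (K * Rpower (INR n) theta); [|nra].
    apply HF. apply (le_INR (S N)) in HnN. rewrite S_INR in HnN. lra.
Qed.

Lemma Epsi_power_bounded (C X0 theta : R) : 0 < C -> Etilde_recursion C X0 ->
  1 / 2 < theta -> power_bounded Epsi theta.
Proof.
  intros HC Hrec Hth. destruct (Epsi_growth C X0 HC Hrec) as (K & Y & HK & HKY).
  set (e := theta - 1 / 2). assert (He : 0 < e) by (unfold e; lra).
  apply (power_bounded_of_eventually Epsi theta (K * / e) (Rmax Y 1)); [lra| |].
  - apply Rmult_lt_0_compat; [easy|]. now apply Rinv_0_lt_compat.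
  - intros n Hn. pose proof (Rmax_l Y 1). pose proof (Rmax_r Y 1).
    eapply Rle_trans; [apply HKY; lra|].
    rewrite Rmult_assoc. apply Rmult_le_compat_l; [lra|].
    replace theta with (/ 2 + e) by (unfold e; field).
    rewrite Rpower_plus, Rpower_sqrt by lra.
    replace (/ e * (sqrt (INR n) * Rpower (INR n) e))
      with (sqrt (INR n) * (/ e * Rpower (INR n) e)) by ring.
    apply Rmult_le_compat_l; [apply sqrt_pos|now apply ln_le_Rpower].
Qed.

(** * Real powers and their sums *)

Lemma Rpower_pos x e : 0 < Rpower x e.
Proof. apply exp_pos. Qed.

Lemma Rpower_base_1 a : Rpower 1 a = 1.
Proof. unfold Rpower. rewrite ln_1, Rmult_0_r. apply exp_0. Qed.

Lemma Rpower_inv_base x a : 0 < x -> Rpower (/ x) a = Rpower x (- a).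
Proof. intros Hx. unfold Rpower. rewrite ln_Rinv by easy. f_equal. ring. Qed.

Lemma Rpower_le_anti_l x y e : 0 < x <= y -> e <= 0 -> Rpower y e <= Rpower x e.
Proof.
  intros H He. unfold Rpower. apply exp_le_compat.
  assert (ln x <= ln y) by (apply ln_le; lra). nra.
Qed.

Lemma Rpower_le_anti_r x e f : 0 < x <= 1 -> e <= f -> Rpower x f <= Rpower x e.
Proof.
  intros Hx He. unfold Rpower. apply exp_le_compat.
  assert (ln x <= 0) by (rewrite <- ln_1; apply ln_le; lra). nra.
Qed.

Lemma is_derive_Rpower x a : 0 < x -> is_derive (fun y => Rpower y a) x (a * Rpower x (a - 1)).
Proof.
  intros Hx. unfold Rpower. auto_derive; [lra|].
  replace ((a - 1) * ln x) with (a * ln x + - ln x) by ring.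
  rewrite exp_plus, exp_Ropp, exp_ln by easy. field. lra.
Qed.

Lemma INR_S_pos n : 0 < INR (S n).
Proof. apply lt_0_INR; lia. Qed.

Lemma INR_S_ge1 n : 1 <= INR (S n).
Proof. apply INR_ge1. lia. Qed.

Lemma Rpower_step x d : 0 < x -> 0 < d ->
  Rpower (x + 1) (- d - 1) <= / d * (Rpower x (- d) - Rpower (x + 1) (- d)).
Proof.
  intros Hx Hd.
  destruct (MVT_cor2 (fun y => Rpower y (- d)) (fun y => - d * Rpower y (- d - 1)) x (x + 1))
    as (c & Hc & Hcx); [lra| |].
  - intros y Hy. apply is_derive_Reals, is_derive_Rpower. lra.
  - pose proof (Rpower_le_anti_l c (x + 1) (- d - 1) ltac:(lra) ltac:(lra)).
    apply Rmult_le_reg_l with d; [easy|]. rewrite <- Rmult_assoc, Rinv_r, Rmult_1_l by lra. nra.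
Qed.

Lemma rsum_Rpower_diff_le d N M : 0 < d -> (1 <= N <= M)%nat ->
  rsum (fun n => Rpower (INR n) (- d - 1)) M - rsum (fun n => Rpower (INR n) (- d - 1)) N
    <= / d * Rpower (INR N) (- d).
Proof.
  intros Hd [HN HM].
  enough (rsum (fun n => Rpower (INR n) (- d - 1)) M - rsum (fun n => Rpower (INR n) (- d - 1)) N
    <= / d * (Rpower (INR N) (- d) - Rpower (INR M) (- d))).
  { pose proof (Rpower_pos (INR M) (- d)). pose proof (Rinv_0_lt_compat d Hd). nra. }
  induction HM as [|M HM IH]; [lra|].
  cbn [rsum]. pose proof (Rpower_step (INR M) d ltac:(apply lt_0_INR; lia) Hd) as Hs.
  rewrite <- S_INR in Hs. rewrite Rmult_minus_distr_l in *. lra.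
Qed.

Lemma rsum_Rpower_le d N : 0 < d -> rsum (fun n => Rpower (INR n) (- d - 1)) N <= 1 + / d.
Proof.
  intros Hd. pose proof (Rinv_0_lt_compat d Hd).
  destruct N as [|N]; [simpl; lra|].
  pose proof (rsum_Rpower_diff_le d 1 (S N) Hd ltac:(lia)) as HN.
  rewrite (rsum_shift _ 0) in HN. change (INR 1) with 1 in HN. rewrite !Rpower_base_1 in HN.
  simpl (rsum _ 0) in HN. lra.
Qed.

Lemma is_lim_seq_scal_0 c u : is_lim_seq u 0 -> is_lim_seq (fun n => c * u n) 0.
Proof.
  intros H. replace (Finite 0) with (Rbar_mult c 0) by (simpl; f_equal; ring).
  now apply is_lim_seq_scal_l.
Qed.

Lemma is_lim_seq_inv_INR c : is_lim_seq (fun n => c * / INR n) 0.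
Proof.
  apply is_lim_seq_scal_0. apply (is_lim_seq_inv _ p_infty); [apply is_lim_seq_INR|easy].
Qed.

Lemma is_lim_seq_Rpower_neg e : 0 < e -> is_lim_seq (fun n => Rpower (INR n) (- e)) 0.
Proof.
  intros He.
  apply (is_lim_seq_le_le_loc (fun _ => 0) _ (fun n => / e * / ln (INR n)));
    [|apply is_lim_seq_const|].
  - exists 3%nat. intros n Hn. split; [left; apply Rpower_pos|].
    apply (le_INR 3) in Hn. simpl in Hn.
    assert (0 < ln (INR n)) by (rewrite <- ln_1; apply ln_increasing; lra).
    rewrite Rpower_Ropp, <- Rinv_mult. apply Rinv_le_contravar; [nra|].
    pose proof (ln_le_Rpower e (INR n) He).
    apply Rmult_le_reg_l with (/ e); [now apply Rinv_0_lt_compat|].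
    rewrite <- Rmult_assoc, Rinv_l, Rmult_1_l by lra. easy.
  - apply is_lim_seq_scal_0. apply (is_lim_seq_inv _ p_infty); [|easy].
    apply (is_lim_comp_seq ln INR p_infty p_infty);
      [exact is_lim_ln_p|now exists 0%nat|apply is_lim_seq_INR].
Qed.

Lemma is_lim_seq_Rpower_neg_S e : 0 < e -> is_lim_seq (fun n => Rpower (INR (S n)) (- e)) 0.
Proof.
  intros He. apply (is_lim_seq_incr_1 (fun n => Rpower (INR n) (- e))). now apply is_lim_seq_Rpower_neg.
Qed.

Lemma le_0_of_Rpower_bound (x K delta a0 : R) : 0 < delta -> 0 < a0 ->
  (forall a, 0 < a <= a0 -> x <= K * Rpower a delta) -> x <= 0.
Proof.
  intros Hd Ha0 H.
  apply (is_lim_seq_le_loc (fun _ => x) (fun n => K * Rpower (INR n) (- delta)) x 0);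
    [|apply is_lim_seq_const|now apply is_lim_seq_scal_0, is_lim_seq_Rpower_neg].
  destruct (nfloor_ex (/ a0)) as [N [_ HN]]; [left; now apply Rinv_0_lt_compat|].
  exists (S N). intros n Hn.
  assert (Hna : / a0 <= INR n) by (apply le_INR in Hn; rewrite S_INR in Hn; lra).
  pose proof (Rinv_0_lt_compat a0 Ha0).
  rewrite <- Rpower_inv_base by lra. apply H. split; [apply Rinv_0_lt_compat; lra|].
  rewrite <- (Rinv_inv a0). now apply Rinv_le_contravar.
Qed.

Lemma sum_n_rsum (f : nat -> R) N : sum_n (fun n => f (S n)) N = rsum f (S N).
Proof.
  induction N as [|N IH]; [rewrite sum_O; simpl; ring|].
  rewrite sum_Sn, IH. reflexivity.
Qed.

Lemma is_series_rsum (f : nat -> R) (l : R) :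
  is_series (fun n => f (S n)) l <-> is_lim_seq (rsum f) l.
Proof.
  rewrite is_lim_seq_incr_1. split; intros H.
  - apply (is_lim_seq_ext (sum_n (fun n => f (S n)))); [intros; apply sum_n_rsum|exact H].
  - change (is_lim_seq (sum_n (fun n => f (S n))) l).
    apply (is_lim_seq_ext (fun n => rsum f (S n))); [intros; symmetry; apply sum_n_rsum|exact H].
Qed.

Lemma ex_series_Rpower e : e < -1 -> ex_series (fun n => Rpower (INR (S n)) e).
Proof.
  intros He. set (d := - e - 1). replace e with (- d - 1) by (unfold d; ring).
  destruct (ex_finite_lim_seq_incr (rsum (fun n => Rpower (INR n) (- d - 1))) (1 + / d)) as [l Hl].
  - intros n. cbn [rsum]. pose proof (Rpower_pos (INR (S n)) (- d - 1)). lra.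
  - intros N. apply rsum_Rpower_le. unfold d. lra.
  - exists l. now apply (is_series_rsum (fun n => Rpower (INR n) (- d - 1))).
Qed.

(** * Complex-valued functions of a real variable *)

Lemma im_le_Cmod (z : C) : Rabs (Im z) <= Cmod z.
Proof. eapply Rle_trans; [apply Rmax_r|apply Rmax_Cmod]. Qed.

Lemma Cmod_le_Re_Im (z : C) : Cmod z <= Rabs (Re z) + Rabs (Im z).
Proof.
  replace z with (RtoC (Re z) + RtoC (Im z) * Ci)%C at 1.
  - eapply Rle_trans; [apply Cmod_triangle|]. rewrite Cmod_mult, Cmod_Ci, !Cmod_R. lra.
  - destruct z as [x y]. unfold RtoC, Ci, Cplus, Cmult; simpl. f_equal; ring.
Qed.

Lemma Cmod_minus_sym (x y : C) : Cmod (x - y) = Cmod (y - x).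
Proof. rewrite <- Cmod_opp. f_equal. ring. Qed.

Lemma Cmod_plus_le (x y : C) (a b : R) : Cmod x <= a -> Cmod y <= b -> Cmod (x + y) <= a + b.
Proof. intros Hx Hy. eapply Rle_trans; [apply Cmod_triangle|]. lra. Qed.

Lemma Cmod_minus_le (x y : C) (a b : R) : Cmod x <= a -> Cmod y <= b -> Cmod (x - y) <= a + b.
Proof. intros Hx Hy. apply Cmod_plus_le; [easy|]. now rewrite Cmod_opp. Qed.

Lemma Cmod_mult_le (x y : C) (a b : R) : Cmod x <= a -> Cmod y <= b -> Cmod (x * y) <= a * b.
Proof. intros Hx Hy. rewrite Cmod_mult. apply Rmult_le_compat; auto using Cmod_ge_0. Qed.

Lemma re_minus (z1 z2 : C) : Re (z1 - z2) = Re z1 - Re z2.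
Proof. unfold Cminus. now rewrite re_plus, re_opp. Qed.

Lemma im_minus (z1 z2 : C) : Im (z1 - z2) = Im z1 - Im z2.
Proof. unfold Cminus. now rewrite im_plus, im_opp. Qed.

Lemma Re_neq0 (z : C) : Re z <> 0 -> z <> 0%C.
Proof. intros H E. apply H. rewrite E. reflexivity. Qed.

(* [ring] and [field] over [C] do not evaluate [RtoC 2]. *)
Lemma RtoC_2 : RtoC 2 = (1 + 1)%C.
Proof. now rewrite <- RtoC_plus. Qed.

Definition cderiv (f : R -> C) (x : R) (l : C) : Prop :=
  is_derive (fun t => Re (f t)) x (Re l) /\ is_derive (fun t => Im (f t)) x (Im l).

Lemma cderiv_unique f x l m : cderiv f x l -> cderiv f x m -> l = m.
Proof.
  intros [Hfre Hfim] [Hgre Hgim]. rewrite (surjective_pairing l), (surjective_pairing m).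
  apply is_derive_unique in Hfre, Hfim, Hgre, Hgim.
  f_equal; [change (Re l = Re m)|change (Im l = Im m)]; congruence.
Qed.

Lemma cderiv_ext_loc f g x l : locally x (fun t => f t = g t) -> cderiv f x l -> cderiv g x l.
Proof.
  intros H [Hfre Hfim]. split; (eapply is_derive_ext_loc; [|eassumption]);
    (eapply filter_imp; [|exact H]); intros t Ht; simpl in Ht; now rewrite Ht.
Qed.

Lemma cderiv_const (c : C) x : cderiv (fun _ => c) x 0%C.
Proof. split; exact (is_derive_const (K := R_AbsRing) (V := R_NormedModule) _ x). Qed.

Lemma cderiv_RtoC f x l : is_derive f x l -> cderiv (fun t => RtoC (f t)) x (RtoC l).
Proof.
  intros H. split; [exact H|]. exact (is_derive_const (K := R_AbsRing) (V := R_NormedModule) 0 x).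
Qed.

Lemma cderiv_plus f g x l m : cderiv f x l -> cderiv g x m -> cderiv (fun t => f t + g t)%C x (l + m)%C.
Proof.
  intros [Hfre Hfim] [Hgre Hgim].
  split; [exact (is_derive_plus _ _ _ _ _ Hfre Hgre)|exact (is_derive_plus _ _ _ _ _ Hfim Hgim)].
Qed.

Lemma cderiv_minus f g x l m : cderiv f x l -> cderiv g x m ->
  cderiv (fun t => f t - g t)%C x (l - m)%C.
Proof.
  intros [Hfre Hfim] [Hgre Hgim].
  split; [exact (is_derive_minus _ _ _ _ _ Hfre Hgre)|exact (is_derive_minus _ _ _ _ _ Hfim Hgim)].
Qed.

Lemma cderiv_mult f g x l m : cderiv f x l -> cderiv g x m ->
  cderiv (fun t => f t * g t)%C x (l * g x + f x * m)%C.
Proof.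
  intros [Hfre Hfim] [Hgre Hgim].
  pose proof (fun u v lu lv Hu Hv => is_derive_mult u v x lu lv Hu Hv Rmult_comm) as Hmult.
  split.
  - replace (Re (l * g x + f x * m)%C) with
      (minus (plus (mult (Re l) (Re (g x))) (mult (Re (f x)) (Re m)))
             (plus (mult (Im l) (Im (g x))) (mult (Im (f x)) (Im m)))).
    + exact (is_derive_minus _ _ _ _ _ (Hmult _ _ _ _ Hfre Hgre) (Hmult _ _ _ _ Hfim Hgim)).
    + rewrite re_plus, !re_mult. unfold minus, plus, opp, mult; simpl. ring.
  - replace (Im (l * g x + f x * m)%C) with
      (plus (plus (mult (Re l) (Im (g x))) (mult (Re (f x)) (Im m)))
            (plus (mult (Im l) (Re (g x))) (mult (Im (f x)) (Re m)))).
    + exact (is_derive_plus _ _ _ _ _ (Hmult _ _ _ _ Hfre Hgim) (Hmult _ _ _ _ Hfim Hgre)).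
    + rewrite im_plus, !im_mult. unfold plus, mult; simpl. ring.
Qed.

Lemma cderiv_scal (c : C) f x l : cderiv f x l -> cderiv (fun t => c * f t)%C x (c * l)%C.
Proof.
  intros H. replace (c * l)%C with (0 * f x + c * l)%C by ring.
  apply (cderiv_mult (fun _ => c) f); [apply cderiv_const|easy].
Qed.

Lemma cderiv_comp f h x l dh : cderiv f (h x) l -> is_derive h x dh ->
  cderiv (fun t => f (h t)) x (RtoC dh * l)%C.
Proof.
  intros [Hfre Hfim] Hh. split; rewrite ?re_scal_l, ?im_scal_l.
  - exact (is_derive_comp (fun t => Re (f t)) h x _ _ Hfre Hh).
  - exact (is_derive_comp (fun t => Im (f t)) h x _ _ Hfim Hh).
Qed.

Lemma derive_ge0_le (f df : R -> R) (a b : R) : a <= b ->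
  (forall t, a <= t <= b -> is_derive f t (df t) /\ 0 <= df t) -> f a <= f b.
Proof.
  intros [Hab| ->] H; [|lra].
  destruct (MVT_cor2 f df a b Hab) as (c & Hc & Hcab).
  - intros t Ht. now apply is_derive_Reals, H.
  - destruct (H c ltac:(lra)). nra.
Qed.

Lemma cderiv_compare (f df : R -> C) (g dg : R -> R) (a b : R) : a <= b ->
  (forall t, a <= t <= b -> cderiv f t (df t) /\ is_derive g t (dg t) /\ Cmod (df t) <= dg t) ->
  Cmod (f b - f a) <= g b - g a.
Proof.
  intros Hab H. set (z := (f b - f a)%C).
  assert (Hmono : forall c : C, Re (c * f b)%C - Re (c * f a)%C <= Cmod c * (g b - g a)).
  { intros c. enough (Cmod c * g a - Re (c * f a)%C <= Cmod c * g b - Re (c * f b)%C) by lra.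
    apply (derive_ge0_le (fun t => Cmod c * g t - Re (c * f t)%C)
      (fun t => Cmod c * dg t - Re (c * df t)%C)); [easy|].
    intros t Ht. destruct (H t Ht) as (Hf & Hg & Hle). split.
    - apply (is_derive_minus (fun t => Cmod c * g t) (fun t => Re (c * f t)%C)).
      + now apply (is_derive_scal g).
      + exact (proj1 (cderiv_scal c f t _ Hf)).
    - pose proof (Rle_trans _ _ _ (Rle_abs _) (re_le_Cmod (c * df t))) as Hre.
      rewrite Cmod_mult in Hre. pose proof (Rmult_le_compat_l _ _ _ (Cmod_ge_0 c) Hle). lra. }
  pose proof (Hmono (Cconj z)) as Hz.
  rewrite Cmod_conj, <- re_minus in Hz.
  replace (Cconj z * f b - Cconj z * f a)%C with (RtoC (Cmod z ^ 2)) in Hz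
    by (rewrite Cmod2_conj; unfold z; ring).
  rewrite re_RtoC in Hz. destruct (Req_dec (Cmod z) 0) as [E|E].
  - enough (g a <= g b) by lra. apply derive_ge0_le with dg; [easy|].
    intros t Ht. destruct (H t Ht) as (_ & Hg & Hle). pose proof (Cmod_ge_0 (df t)).
    split; [easy|lra].
  - pose proof (Cmod_ge_0 z). apply Rmult_le_reg_l with (Cmod z); [lra|].
    replace (Cmod z * Cmod z) with (Cmod z ^ 2) by ring. easy.
Qed.

Lemma cderiv_bound (f df : R -> C) (D a b : R) : a <= b ->
  (forall t, a <= t <= b -> cderiv f t (df t) /\ Cmod (df t) <= D) ->
  Cmod (f b - f a) <= D * (b - a).
Proof.
  intros Hab H. rewrite Rmult_minus_distr_l.
  apply (cderiv_compare f df (fun t => D * t) (fun _ => D)); [easy|].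
  intros t Ht. destruct (H t Ht). split; [easy|]. split; [|easy].
  auto_derive; [easy|ring].
Qed.

Lemma cderiv_taylor_bound (f df ddf : R -> C) (B a b : R) : a <= b ->
  (forall t, a <= t <= b -> cderiv f t (df t) /\ cderiv df t (ddf t) /\ Cmod (ddf t) <= B) ->
  Cmod (f b - f a - df a * RtoC (b - a)) <= B * (b - a) ^ 2.
Proof.
  intros Hab H. set (g := fun t => (f t - df a * RtoC (t - a))%C).
  replace (f b - f a - df a * RtoC (b - a))%C with (g b - g a)%C
    by (unfold g; rewrite Rminus_diag; ring).
  replace (B * (b - a) ^ 2) with (B * (b - a) * (b - a)) by ring.
  apply (cderiv_bound g (fun t => df t - df a)%C); [easy|].
  intros t Ht. split.
  - apply cderiv_minus; [now apply H|].
    assert (Hlin : cderiv (fun t => df a * RtoC (t - a))%C t (df a * RtoC 1)%C).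
    { apply cderiv_scal, cderiv_RtoC. auto_derive; [easy|ring]. }
    now rewrite Cmult_1_r in Hlin.
  - apply Rle_trans with (B * (t - a)).
    + apply (cderiv_bound df ddf); [lra|]. intros u Hu. apply H. lra.
    + apply Rmult_le_compat_l; [|lra].
      eapply Rle_trans; [apply Cmod_ge_0|]. apply (H t). lra.
Qed.

Lemma cderiv_gronwall (f df : R -> C) (K a b : R) : a <= b ->
  (forall t, a <= t <= b -> cderiv f t (df t) /\ Cmod (df t) <= K * Cmod (f t)) ->
  f b = 0%C -> f a = 0%C.
Proof.
  intros Hab H Hb.
  set (u := fun t => Re (f t)). set (v := fun t => Im (f t)).
  set (N := fun t => u t * u t + v t * v t).
  assert (HN : forall t, N t = Cmod (f t) ^ 2) by (intros t; rewrite Cmod2_alt; unfold N, u, v; ring).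
  assert (Hle : N a * exp (2 * K * a) <= N b * exp (2 * K * b)).
  { apply (derive_ge0_le (fun t => N t * exp (2 * K * t)) (fun t =>
      (2 * (u t * Re (df t) + v t * Im (df t)) + 2 * K * N t) * exp (2 * K * t))); [easy|].
    intros t Ht. destruct (H t Ht) as [[Hu Hv] Hdf].
    change (is_derive u t (Re (df t))) in Hu. change (is_derive v t (Im (df t))) in Hv. split.
    - unfold N. auto_derive; [repeat split; eexists; eassumption|].
      change (fun x : R => u x) with u. change (fun x : R => v x) with v.
      rewrite (is_derive_unique _ _ _ Hu), (is_derive_unique _ _ _ Hv).
      ring.
    - apply Rmult_le_pos; [|left; apply exp_pos].
      assert (Habs : Rabs (Re (Cconj (f t) * df t)) <= K * N t).
      { eapply Rle_trans; [apply re_le_Cmod|]. rewrite Cmod_mult, Cmod_conj, HN.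
        pose proof (Rmult_le_compat_l _ _ _ (Cmod_ge_0 (f t)) Hdf). lra. }
      rewrite re_mult, re_conj, im_conj in Habs. apply Rabs_le_between in Habs.
      unfold u, v. lra. }
  rewrite !HN, Hb, Cmod_0 in Hle.
  assert (Hsq : Cmod (f a) ^ 2 <= 0).
  { apply Rmult_le_reg_r with (exp (2 * K * a)); [apply exp_pos|]. lra. }
  apply Cmod_eq_0. pose proof (Cmod_ge_0 (f a)). nra.
Qed.

(** * Complex powers of positive reals *)

Lemma cpow_mult_base x y z : 0 < x -> 0 < y -> cpow (x * y) z = (cpow x z * cpow y z)%C.
Proof.
  intros Hx Hy. unfold cpow, Cmult; simpl. rewrite ln_mult by easy.
  rewrite !Rmult_plus_distr_l, exp_plus, cos_plus, sin_plus. f_equal; ring.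
Qed.

Lemma cpow_plus x (z1 z2 : C) : cpow x (z1 + z2)%C = (cpow x z1 * cpow x z2)%C.
Proof.
  destruct z1 as [a1 b1], z2 as [a2 b2]. unfold cpow, Cmult, Cplus, Re, Im; simpl.
  rewrite !Rmult_plus_distr_r, exp_plus, cos_plus, sin_plus. f_equal; ring.
Qed.

Lemma cpow_Cmod x z : Cmod (cpow x z) = Rpower x (Re z).
Proof.
  unfold cpow, Cmod, Rpower. cbn [fst snd].
  set (a := exp (Re z * ln x)). set (t := Im z * ln x).
  replace ((a * cos t) ^ 2 + (a * sin t) ^ 2)
    with (a * a * (Rsqr (sin t) + Rsqr (cos t))) by (unfold Rsqr; ring).
  rewrite sin2_cos2, Rmult_1_r. apply sqrt_square. left; apply exp_pos.
Qed.

Lemma cpow_RtoC x a : cpow x (RtoC a) = RtoC (Rpower x a).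
Proof. unfold cpow, RtoC, Rpower; simpl. rewrite Rmult_0_l, cos_0, sin_0. f_equal; ring. Qed.

Lemma cpow_0 x : cpow x 0 = 1%C.
Proof. rewrite cpow_RtoC. unfold Rpower. rewrite Rmult_0_l, exp_0. easy. Qed.

Lemma cpow_1 x : 0 < x -> cpow x 1 = RtoC x.
Proof. intros H. rewrite cpow_RtoC, Rpower_1; easy. Qed.

Lemma cpow_base_1 z : cpow 1 z = 1%C.
Proof. unfold cpow. rewrite ln_1, !Rmult_0_r, exp_0, cos_0, sin_0. unfold RtoC; f_equal; ring. Qed.

Lemma cpow_neq0 x z : cpow x z <> 0%C.
Proof. apply Cmod_gt_0. rewrite cpow_Cmod. apply exp_pos. Qed.

Lemma cpow_opp x (z : C) : cpow x (- z)%C = (/ cpow x z)%C.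
Proof.
  assert (H : (cpow x (- z)%C * cpow x z = 1)%C).
  { rewrite <- cpow_plus. replace (- z + z)%C with (RtoC 0) by ring. apply cpow_0. }
  replace (cpow x (- z)%C) with (cpow x (- z)%C * cpow x z * / cpow x z)%C
    by (field; apply cpow_neq0).
  rewrite H. ring.
Qed.

Lemma cpow_succ x (z : C) : 0 < x -> cpow x (z + 1)%C = (cpow x z * RtoC x)%C.
Proof. intros Hx. now rewrite cpow_plus, cpow_1. Qed.

Lemma cderiv_cpow z x : 0 < x -> cderiv (fun t => cpow t z) x (z * cpow x (z - 1)%C)%C.
Proof.
  intros Hx.
  assert (E : (z * cpow x (z - 1)%C = RtoC (/ x) * (z * cpow x z))%C).
  { unfold Cminus. rewrite cpow_plus, cpow_opp, cpow_1 by easy. rewrite RtoC_inv by lra. ring. }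
  rewrite E. destruct z as [a b]. unfold cpow. split; simpl.
  - auto_derive; [lra|]. field. lra.
  - auto_derive; [lra|]. field. lra.
Qed.

Lemma cpow_diff_bound z x y : 0 < x <= y -> Re z <= 1 ->
  Cmod (cpow y z - cpow x z) <= Cmod z * Rpower x (Re z - 1) * (y - x).
Proof.
  intros H Hz.
  apply (cderiv_bound (fun t => cpow t z) (fun t => z * cpow t (z - 1)%C)%C); [lra|].
  intros t Ht. split; [apply cderiv_cpow; lra|].
  rewrite Cmod_mult, cpow_Cmod, re_minus, re_RtoC. apply Rmult_le_compat_l; [apply Cmod_ge_0|].
  apply Rpower_le_anti_l; lra.
Qed.

(** * Complex sums, limits and series *)

Fixpoint csum (f : nat -> C) (N : nat) : C :=
  match N with O => 0%C | S n => (csum f n + f (S n))%C end.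

Lemma csum_ext f g N : (forall n, (1 <= n <= N)%nat -> f n = g n) -> csum f N = csum g N.
Proof.
  induction N as [|N IH]; intros H; cbn [csum]; [easy|].
  rewrite IH, H; [easy|lia|]. intros; apply H; lia.
Qed.

Lemma csum_plus f g N : csum (fun n => f n + g n)%C N = (csum f N + csum g N)%C.
Proof. induction N as [|N IH]; cbn [csum]; [ring|]. rewrite IH. ring. Qed.

Lemma csum_minus f g N : csum (fun n => f n - g n)%C N = (csum f N - csum g N)%C.
Proof. induction N as [|N IH]; cbn [csum]; [ring|]. rewrite IH. ring. Qed.

Lemma csum_scal c f N : csum (fun n => c * f n)%C N = (c * csum f N)%C.
Proof. induction N as [|N IH]; cbn [csum]; [ring|]. rewrite IH. ring. Qed.

Lemma csum_zero N : csum (fun _ => 0%C) N = 0%C.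
Proof. induction N as [|N IH]; cbn [csum]; [easy|]. rewrite IH. ring. Qed.

Lemma csum_swap (f : nat -> nat -> C) N M :
  csum (fun n => csum (f n) M) N = csum (fun m => csum (fun n => f n m) N) M.
Proof.
  induction N as [|N IH]; cbn [csum]; [now rewrite csum_zero|].
  now rewrite IH, <- csum_plus.
Qed.

Lemma csum_abel f w N :
  csum (fun n => f n * w n)%C N =
  (csum f N * w (S N) + csum (fun n => csum f n * (w n - w (S n))) N)%C.
Proof. induction N as [|N IH]; cbn [csum]; [ring|]. rewrite IH. ring. Qed.

Lemma csum_telescope w N : csum (fun n => w n - w (S n))%C N = (w 1%nat - w (S N))%C.
Proof. induction N as [|N IH]; cbn [csum]; [ring|]. rewrite IH. ring. Qed.

Lemma csum_Re f N : Re (csum f N) = rsum (fun n => Re (f n)) N.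
Proof. induction N as [|N IH]; cbn [csum rsum]; [easy|]. rewrite <- IH. easy. Qed.

Lemma csum_Im f N : Im (csum f N) = rsum (fun n => Im (f n)) N.
Proof. induction N as [|N IH]; cbn [csum rsum]; [easy|]. rewrite <- IH. easy. Qed.

Lemma csum_RtoC f N : csum (fun n => RtoC (f n)) N = RtoC (rsum f N).
Proof. induction N as [|N IH]; cbn [csum rsum]; [easy|]. now rewrite IH, RtoC_plus. Qed.

Lemma csum_diff_le f g N M : (N <= M)%nat -> (forall n, (N < n <= M)%nat -> Cmod (f n) <= g n) ->
  Cmod (csum f M - csum f N) <= rsum g M - rsum g N.
Proof.
  intros H. induction H as [|M HM IH]; intros Hf.
  - replace (csum f N - csum f N)%C with (RtoC 0) by ring. rewrite Cmod_0. lra.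
  - cbn [rsum csum].
    replace (csum f M + f (S M) - csum f N)%C with ((csum f M - csum f N) + f (S M))%C by ring.
    apply Rle_trans with ((rsum g M - rsum g N) + g (S M)); [|lra].
    apply Cmod_plus_le; [apply IH; intros; apply Hf; lia|apply Hf; lia].
Qed.

Lemma csum_le f g N : (forall n, (1 <= n <= N)%nat -> Cmod (f n) <= g n) -> Cmod (csum f N) <= rsum g N.
Proof.
  intros H. pose proof (csum_diff_le f g 0 N ltac:(lia) H) as Hd.
  simpl in Hd. replace (csum f N) with (csum f N - 0)%C by ring. lra.
Qed.

Lemma cderiv_csum (f df : nat -> R -> C) N x :
  (forall n, (1 <= n <= N)%nat -> cderiv (f n) x (df n x)) ->
  cderiv (fun x => csum (fun n => f n x) N) x (csum (fun n => df n x) N).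
Proof.
  induction N as [|N IH]; intros H; cbn [csum]; [apply cderiv_const|].
  apply (cderiv_plus (fun x => csum (fun n => f n x) N) (f (S N))).
  - apply IH. intros; apply H; lia.
  - apply H. lia.
Qed.

Definition clim (u : nat -> C) (l : C) : Prop :=
  filterlim u eventually (locally (T := C_NormedModule) l).

Lemma clim_Cmod_minus u l : clim u l <-> is_lim_seq (fun n => Cmod (u n - l)) 0.
Proof.
  unfold clim. rewrite (filterlim_locally_ball_norm (U := C_NormedModule)), <- is_lim_seq_spec.
  split; intros H eps; specialize (H eps); (eapply filter_imp; [|exact H]); intros n Hn;
    unfold ball_norm in *; simpl in *;
    (rewrite Rminus_0_r, Rabs_pos_eq in * by apply Cmod_ge_0); exact Hn.
Qed.

Lemma clim_squeeze u l (b : nat -> R) : is_lim_seq b 0 ->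
  (forall n, (1 <= n)%nat -> Cmod (u n - l) <= b n) -> clim u l.
Proof.
  intros Hb H. apply clim_Cmod_minus.
  apply (is_lim_seq_le_le_loc (fun _ => 0) _ b); [|apply is_lim_seq_const|easy].
  exists 1%nat. intros n Hn. split; [apply Cmod_ge_0|now apply H].
Qed.

Lemma clim_squeeze_0 u (b : nat -> R) : is_lim_seq b 0 ->
  (forall n, (1 <= n)%nat -> Cmod (u n) <= b n) -> clim u 0%C.
Proof.
  intros Hb H. apply (clim_squeeze _ _ b); [easy|]. intros n Hn.
  replace (u n - 0)%C with (u n) by ring. now apply H.
Qed.

Lemma clim_const l : clim (fun _ => l) l.
Proof. apply filterlim_const. Qed.

Lemma clim_ext u v l : (forall n, (1 <= n)%nat -> u n = v n) -> clim u l -> clim v l.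
Proof. intros H. apply filterlim_ext_loc. now exists 1%nat. Qed.

Lemma clim_plus u v l m : clim u l -> clim v m -> clim (fun n => u n + v n)%C (l + m)%C.
Proof.
  intros Hu Hv. eapply filterlim_comp_2; [exact Hu|exact Hv|].
  exact (filterlim_plus (V := C_NormedModule) l m).
Qed.

Lemma clim_scal c u l : clim u l -> clim (fun n => c * u n)%C (c * l)%C.
Proof.
  intros Hu. exact (filterlim_comp _ _ _ _ _ _ _ _ Hu (filterlim_scal_r (V := C_NormedModule) c l)).
Qed.

Lemma clim_minus u v l m : clim u l -> clim v m -> clim (fun n => u n - v n)%C (l - m)%C.
Proof.
  intros Hu Hv. replace (l - m)%C with (l + (-(1)) * m)%C by ring.
  apply (clim_ext (fun n => u n + (-(1)) * v n)%C); [intros; ring|].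
  now apply clim_plus; [|apply clim_scal].
Qed.

Lemma clim_unique u l m : clim u l -> clim u m -> l = m.
Proof. apply (filterlim_locally_unique (V := C_NormedModule)). Qed.

Lemma clim_subseq u l (phi : nat -> nat) : (forall n, (phi n < phi (S n))%nat) ->
  clim u l -> clim (fun n => u (phi n)) l.
Proof. intros Hphi. apply filterlim_comp. now apply eventually_subseq. Qed.

Lemma clim_Cmod u l : clim u l -> is_lim_seq (fun n => Cmod (u n)) (Cmod l).
Proof.
  intros Hu. exact (filterlim_comp _ _ _ _ _ _ _ _ Hu (filterlim_norm (V := C_NormedModule) l)).
Qed.

Lemma clim_Cmod_le u l (B : R) : clim u l -> eventually (fun n => Cmod (u n) <= B) -> Cmod l <= B.
Proof.
  intros Hu HB.
  exact (is_lim_seq_le_loc _ (fun _ => B) _ B HB (clim_Cmod _ _ Hu) (is_lim_seq_const B)).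
Qed.

Lemma clim_Re_Im u l : clim u l <->
  is_lim_seq (fun n => Re (u n)) (Re l) /\ is_lim_seq (fun n => Im (u n)) (Im l).
Proof.
  split.
  - intros Hu. destruct l as [a b]. split.
    + exact (filterlim_comp _ _ _ _ _ _ _ _ Hu (continuous_fst a b)).
    + exact (filterlim_comp _ _ _ _ _ _ _ _ Hu (continuous_snd a b)).
  - intros [Hre Him].
    apply (clim_squeeze _ _ (fun n => Rabs (Re (u n) - Re l) + Rabs (Im (u n) - Im l))).
    + replace (Finite 0) with (Finite (Rabs (Re l - Re l) + Rabs (Im l - Im l)))
        by (rewrite !Rminus_diag, Rabs_R0; f_equal; ring).
      apply is_lim_seq_plus'; apply (is_lim_seq_abs _ (Finite _));
        now apply is_lim_seq_minus'; [|apply is_lim_seq_const].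
    + intros n _. rewrite <- re_minus, <- im_minus. apply Cmod_le_Re_Im.
Qed.

Lemma clim_of_cauchy_rate u (b : nat -> R) : is_lim_seq b 0 ->
  (forall n m, (n <= m)%nat -> Cmod (u m - u n) <= b n) -> exists l, clim u l.
Proof.
  intros Hb H.
  assert (Hcauchy : forall v : nat -> R,
    (forall n m, (n <= m)%nat -> Rabs (v m - v n) <= b n) -> exists l : R, is_lim_seq v l).
  { intros v Hv. apply ex_lim_seq_cauchy_corr. intros eps.
    apply is_lim_seq_spec in Hb. destruct (Hb eps) as [N HN]. exists N.
    assert (Hord : forall n m, (N <= n <= m)%nat -> Rabs (v m - v n) < eps).
    { intros n m Hnm. eapply Rle_lt_trans; [now apply Hv|].
      specialize (HN n ltac:(lia)). rewrite Rminus_0_r in HN. apply Rabs_def2 in HN. lra. }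
    intros n m Hn Hm. destruct (Nat.le_ge_cases n m).
    - rewrite Rabs_minus_sym. now apply Hord.
    - now apply Hord. }
  destruct (Hcauchy (fun n => Re (u n))) as [a Ha].
  { intros n m Hnm. rewrite <- re_minus. eapply Rle_trans; [apply re_le_Cmod|now apply H]. }
  destruct (Hcauchy (fun n => Im (u n))) as [c Hc].
  { intros n m Hnm. rewrite <- im_minus. eapply Rle_trans; [apply im_le_Cmod|now apply H]. }
  exists (a, c). now apply clim_Re_Im.
Qed.

Lemma clim_abel f w l : clim (csum (fun n => f n * w n)%C) l ->
  clim (fun N => csum f N * w (S N))%C 0%C ->
  clim (csum (fun n => csum f n * (w n - w (S n)))%C) l.
Proof.
  intros Hfw H0. replace l with (l - 0)%C by ring.
  eapply clim_ext; [|exact (clim_minus _ _ _ _ Hfw H0)].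
  intros N _. cbv beta. rewrite csum_abel. ring.
Qed.

Definition cseries (f : nat -> C) : C :=
  (Series (fun n => Re (f (S n))), Series (fun n => Im (f (S n)))).

Lemma cseries_unique f l : clim (csum f) l -> cseries f = l.
Proof.
  intros [Hre Him]%clim_Re_Im. rewrite (surjective_pairing l). unfold cseries. f_equal.
  - apply is_series_unique, (is_series_rsum (fun n => Re (f n))).
    eapply is_lim_seq_ext; [|exact Hre]. intros N. apply csum_Re.
  - apply is_series_unique, (is_series_rsum (fun n => Im (f n))).
    eapply is_lim_seq_ext; [|exact Him]. intros N. apply csum_Im.
Qed.

Lemma cseries_ext f g : (forall n, (1 <= n)%nat -> f n = g n) -> cseries f = cseries g.
Proof.
  intros H. unfold cseries. f_equal; apply Series_ext; intros n; rewrite H by lia; easy.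
Qed.

Section DominatedSeries.

Variables (f : nat -> C) (B d : R).
Hypothesis Hd : 0 < d.
Hypothesis Hf : forall n, (1 <= n)%nat -> Cmod (f n) <= B * Rpower (INR n) (- d - 1).

Lemma dominating_constant_ge0 : 0 <= B.
Proof.
  pose proof (Hf 1 ltac:(lia)) as Hfirst. change (INR 1) with 1 in Hfirst.
  rewrite Rpower_base_1 in Hfirst. pose proof (Cmod_ge_0 (f 1%nat)). lra.
Qed.

Lemma clim_cseries : clim (csum f) (cseries f).
Proof.
  assert (Hex : ex_series (fun n => B * Rpower (INR (S n)) (- d - 1))).
  { apply (ex_series_scal_l B (fun n => Rpower (INR (S n)) (- d - 1))), ex_series_Rpower. lra. }
  apply clim_Re_Im. split.
  - apply (is_lim_seq_ext (rsum (fun n => Re (f n)))); [intros; symmetry; apply csum_Re|].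
    apply is_series_rsum, Series_correct.
    apply (ex_series_le (V := R_CompleteNormedModule) _ _) with (2 := Hex).
    intros n. eapply Rle_trans; [apply re_le_Cmod|]. apply Hf. lia.
  - apply (is_lim_seq_ext (rsum (fun n => Im (f n)))); [intros; symmetry; apply csum_Im|].
    apply is_series_rsum, Series_correct.
    apply (ex_series_le (V := R_CompleteNormedModule) _ _) with (2 := Hex).
    intros n. eapply Rle_trans; [apply im_le_Cmod|]. apply Hf. lia.
Qed.

Lemma cseries_tail N : (1 <= N)%nat -> Cmod (cseries f - csum f N) <= B * (/ d * Rpower (INR N) (- d)).
Proof.
  intros HN.
  apply (clim_Cmod_le (fun M => csum f M - csum f N)%C).
  - apply clim_minus; [apply clim_cseries|apply clim_const].
  - exists N. intros M HM.
    eapply Rle_trans; [apply csum_diff_le; [easy|]; intros; apply Hf; lia|].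
    rewrite !rsum_scal, <- Rmult_minus_distr_l.
    apply Rmult_le_compat_l; [exact dominating_constant_ge0|]. now apply rsum_Rpower_diff_le.
Qed.

Lemma cseries_bound : Cmod (cseries f) <= B * (1 + / d).
Proof.
  apply (clim_Cmod_le (csum f)); [apply clim_cseries|].
  exists 0%nat. intros N _.
  eapply Rle_trans; [apply csum_le; intros; apply Hf; lia|].
  rewrite rsum_scal. apply Rmult_le_compat_l; [exact dominating_constant_ge0|].
  now apply rsum_Rpower_le.
Qed.

End DominatedSeries.

Lemma cseries_RtoC f : cseries (fun n => RtoC (f n)) = RtoC (Series (fun n => f (S n))).
Proof.
  unfold cseries, RtoC. f_equal.
  apply (is_series_unique (fun _ => 0)), (is_series_rsum (fun _ => 0)).
  apply (is_lim_seq_ext (fun _ => 0)); [intros N; symmetry; now apply rsum_zero|apply is_lim_seq_const].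
Qed.

Section DominatedRealSeries.

Variables (f : nat -> R) (B d : R).
Hypothesis Hd : 0 < d.
Hypothesis Hf : forall n, (1 <= n)%nat -> Rabs (f n) <= B * Rpower (INR n) (- d - 1).

Lemma is_lim_seq_rsum_Series : is_lim_seq (rsum f) (Series (fun n => f (S n))).
Proof.
  apply is_lim_seq_ext with (fun N => Re (csum (fun n => RtoC (f n)) N)).
  - intros N. now rewrite csum_RtoC.
  - rewrite <- (re_RtoC (Series _)), <- cseries_RtoC.
    refine (proj1 (proj1 (clim_Re_Im _ _) (clim_cseries _ B d Hd _))).
    intros n Hn. rewrite Cmod_R. now apply Hf.
Qed.

Lemma Series_rsum_tail N : (1 <= N)%nat ->
  Rabs (Series (fun n => f (S n)) - rsum f N) <= B * (/ d * Rpower (INR N) (- d)).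
Proof.
  intros HN. rewrite <- Cmod_R, RtoC_minus, <- cseries_RtoC, <- csum_RtoC.
  apply (cseries_tail _ B d Hd); [|easy]. intros n Hn. rewrite Cmod_R. now apply Hf.
Qed.

Lemma Series_Rabs_bound : Rabs (Series (fun n => f (S n))) <= B * (1 + / d).
Proof.
  rewrite <- Cmod_R, <- cseries_RtoC.
  apply (cseries_bound _ B d Hd). intros n Hn. rewrite Cmod_R. now apply Hf.
Qed.

End DominatedRealSeries.

(** * Power series in a real variable *)

Lemma locally_Rabs_lt (r t : R) (P : R -> Prop) : Rabs t < r ->
  (forall y, Rabs y < r -> P y) -> locally t P.
Proof.
  intros Ht H. assert (Hp : 0 < r - Rabs t) by lra.
  exists (mkposreal _ Hp). intros y Hy. change R in y. apply H.
  assert (Hyt : Rabs (y - t) < r - Rabs t) by exact Hy.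
  pose proof (Rabs_triang (y - t) t) as Htr. replace (y - t + t) with y in Htr by ring. lra.
Qed.

Lemma CV_radius_ge_ex_pseries (a : nat -> R) (r : R) :
  (forall x, Rabs x < r -> ex_pseries a x) -> Rbar_le r (CV_radius a).
Proof.
  intros H. destruct (Rbar_le_dec r (CV_radius a)) as [h|h]; [easy|exfalso].
  apply Rbar_not_le_lt in h. pose proof (CV_radius_ge_0 a) as H0.
  destruct (CV_radius a) as [c| |] eqn:Hc; simpl in h, H0; try easy.
  assert (Hx : Rabs ((c + r) / 2) = (c + r) / 2) by (apply Rabs_pos_eq; lra).
  apply (CV_disk_outside a ((c + r) / 2)).
  - rewrite Hc, Hx. simpl. lra.
  - apply ex_series_lim_0. apply (proj1 (ex_pseries_R a _)). apply H. lra.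
Qed.

Lemma is_pseries_CV_radius (a : nat -> R) (f : R -> R) (r t : R) :
  (forall t, Rabs t < r -> is_pseries a t (f t)) -> Rabs t < r -> Rbar_lt (Rabs t) (CV_radius a).
Proof.
  intros H Ht. apply Rbar_lt_le_trans with r; [exact Ht|].
  apply CV_radius_ge_ex_pseries. intros x Hx. exists (f x). now apply H.
Qed.

Lemma is_derive_is_pseries (a : nat -> R) (f : R -> R) (r t : R) :
  (forall t, Rabs t < r -> is_pseries a t (f t)) -> Rabs t < r ->
  is_derive f t (PSeries (PS_derive a) t) /\ is_pseries (PS_derive a) t (PSeries (PS_derive a) t).
Proof.
  intros H Ht. pose proof (is_pseries_CV_radius a f r t H Ht) as HCV. split.
  - apply (is_derive_ext_loc (PSeries a)); [|now apply is_derive_PSeries].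
    apply (locally_Rabs_lt r); [easy|]. intros y Hy. now apply is_pseries_unique, H.
  - apply PSeries_correct, CV_radius_inside. now rewrite CV_radius_derive.
Qed.

Definition analytic_on (r : R) (f : R -> R) : Prop :=
  exists a, forall t, Rabs t < r -> is_pseries a t (f t).

Lemma analytic_ext r f g : (forall t, Rabs t < r -> f t = g t) -> analytic_on r f -> analytic_on r g.
Proof. intros H [a Ha]. exists a. intros t Ht. rewrite <- H by easy. now apply Ha. Qed.

Lemma analytic_le r r' f : r' <= r -> analytic_on r f -> analytic_on r' f.
Proof. intros Hr [a Ha]. exists a. intros t Ht. apply Ha. lra. Qed.

Lemma analytic_const r c : analytic_on r (fun _ => c).
Proof.
  exists (fun n => match n with O => c | _ => 0 end). intros t _. apply is_pseries_R.
  apply is_series_decr_1.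
  match goal with |- is_series _ ?l => replace l with 0 by (unfold plus, opp; simpl; ring) end.
  apply is_series_ext with (fun _ => 0); [intros n; change (0 = 0 * t ^ S n); ring|].
  apply filterlim_ext with (fun _ => 0); [|apply filterlim_const].
  intros n. rewrite sum_n_const. ring.
Qed.

Lemma analytic_id r : analytic_on r (fun t => t).
Proof.
  destruct (analytic_const r 1) as [a Ha]. exists (PS_incr_1 a). intros t Ht.
  rewrite <- (Rmult_1_r t) at 2. exact (is_pseries_incr_1 a t 1 (Ha t Ht)).
Qed.

Lemma analytic_plus r f g : analytic_on r f -> analytic_on r g -> analytic_on r (fun t => f t + g t).
Proof.
  intros [a Ha] [b Hb]. exists (PS_plus a b). intros t Ht.
  exact (is_pseries_plus _ _ _ _ _ (Ha t Ht) (Hb t Ht)).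
Qed.

Lemma analytic_mult r f g : analytic_on r f -> analytic_on r g -> analytic_on r (fun t => f t * g t).
Proof.
  intros [a Ha] [b Hb]. exists (PS_mult a b). intros t Ht.
  apply is_pseries_mult; auto;
    [now apply (is_pseries_CV_radius a f r)|now apply (is_pseries_CV_radius b g r)].
Qed.

Lemma analytic_opp r f : analytic_on r f -> analytic_on r (fun t => - f t).
Proof.
  intros H. apply (analytic_ext r (fun t => -1 * f t)); [intros; ring|].
  apply (analytic_mult r (fun _ => -1)); [apply analytic_const|easy].
Qed.

Lemma analytic_is_derive r f : analytic_on r f ->
  exists df, analytic_on r df /\ forall t, Rabs t < r -> is_derive f t (df t).
Proof.
  intros [a Ha]. exists (PSeries (PS_derive a)). split.
  - exists (PS_derive a). intros t Ht. now apply (is_derive_is_pseries a f r).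
  - intros t Ht. now apply (is_derive_is_pseries a f r).
Qed.

Lemma analytic_identity r d f g : analytic_on r f -> analytic_on r g -> 0 < d <= r ->
  (forall t, Rabs t < d -> f t = g t) -> forall t, Rabs t < r -> f t = g t.
Proof.
  intros [a Ha] [b Hb] Hd H t Ht.
  assert (Hf : forall t, Rabs t < r -> PSeries a t = f t) by (intros; now apply is_pseries_unique, Ha).
  assert (Hg : forall t, Rabs t < r -> PSeries b t = g t) by (intros; now apply is_pseries_unique, Hb).
  assert (H0 : Rabs 0 < r) by (rewrite Rabs_R0; lra).
  rewrite <- Hf, <- Hg by easy. apply PSeries_ext. intros n.
  apply PSeries_ext_recip.
  - rewrite <- Rabs_R0. now apply (is_pseries_CV_radius a f r).
  - rewrite <- Rabs_R0. now apply (is_pseries_CV_radius b g r).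
  - apply (locally_Rabs_lt d); [rewrite Rabs_R0; lra|]. intros y Hy.
    rewrite Hf, Hg by lra. auto.
Qed.

Lemma PSeries_geom_bound (c : nat -> R) (B rho t : R) : Rabs t < rho ->
  (forall k, Rabs (c k) * rho ^ k <= B) ->
  ex_pseries c t /\ Rabs (PSeries c t) <= B * / (1 - Rabs t / rho).
Proof.
  intros Ht Hc. pose proof (Rabs_pos t) as Ht0.
  assert (Hrho : 0 < rho) by lra.
  assert (Hq : Rabs (Rabs t / rho) < 1).
  { rewrite Rabs_pos_eq; [apply Rlt_div_l; lra|apply Rdiv_le_0_compat; lra]. }
  assert (Hterm : forall k, Rabs (c k * t ^ k) <= B * (Rabs t / rho) ^ k).
  { intros k. rewrite Rabs_mult, <- RPow_abs. unfold Rdiv. rewrite Rpow_mult_distr, pow_inv.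
    replace (Rabs (c k) * Rabs t ^ k) with ((Rabs (c k) * rho ^ k) * (Rabs t ^ k * / rho ^ k)).
    - apply Rmult_le_compat_r; [|apply Hc].
      apply Rmult_le_pos; [apply pow_le; lra|]. left. apply Rinv_0_lt_compat, pow_lt; lra.
    - field. apply pow_nonzero; lra. }
  assert (Hg : is_series (fun k => B * (Rabs t / rho) ^ k) (B * / (1 - Rabs t / rho)))
    by exact (is_series_scal_l B _ _ (is_series_geom _ Hq)).
  assert (Hex : ex_series (fun k => Rabs (c k * t ^ k))).
  { apply (ex_series_le (V := R_CompleteNormedModule) _ (fun k => B * (Rabs t / rho) ^ k));
      [|now eexists; exact Hg].
    intros k. unfold norm; simpl; unfold abs; simpl. rewrite Rabs_Rabsolu. apply Hterm. }
  split.
  - apply ex_pseries_R. apply ex_series_Rabs. exact Hex.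
  - unfold PSeries. eapply Rle_trans; [apply Series_Rabs; exact Hex|].
    rewrite <- (is_series_unique _ _ Hg). apply Series_le.
    + intros k. split; [apply Rabs_pos|apply Hterm].
    + eexists. exact Hg.
Qed.

Lemma PSeries_sum_n (b : nat -> nat -> R) (t : R) N : (forall n, ex_pseries (b n) t) ->
  ex_pseries (fun k => sum_n (fun n => b n k) N) t /\
  PSeries (fun k => sum_n (fun n => b n k) N) t = sum_n (fun n => PSeries (b n) t) N.
Proof.
  intros Hb. induction N as [|N [IHex IHeq]].
  - split.
    + apply ex_pseries_ext with (b 0%nat); [intros; now rewrite sum_O|apply Hb].
    + rewrite sum_O. apply PSeries_ext. intros; now rewrite sum_O.
  - split.
    + apply ex_pseries_ext with (PS_plus (fun k => sum_n (fun n => b n k) N) (b (S N))).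
      * intros; rewrite sum_Sn; reflexivity.
      * apply ex_pseries_plus; auto.
    + rewrite sum_Sn, <- IHeq. unfold plus; simpl. rewrite <- PSeries_plus by auto.
      apply PSeries_ext. intros; rewrite sum_Sn; reflexivity.
Qed.

Lemma ex_series_Rabs_le (u M : nat -> R) : ex_series M -> (forall n, Rabs (u n) <= M n) ->
  ex_series (fun n => Rabs (u n)).
Proof.
  intros HM Hu. apply (ex_series_le (V := R_CompleteNormedModule) _ M); [|easy].
  intros n. unfold norm; simpl; unfold abs; simpl. rewrite Rabs_Rabsolu. apply Hu.
Qed.

Lemma Series_Rabs_le (u M : nat -> R) : ex_series M -> (forall n, Rabs (u n) <= M n) ->
  Rabs (Series u) <= Series M.
Proof.
  intros HM Hu. eapply Rle_trans; [apply Series_Rabs; now apply (ex_series_Rabs_le u M)|].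
  apply Series_le; [|easy]. intros n. split; [apply Rabs_pos|apply Hu].
Qed.

Lemma Series_tail_le (u M : nat -> R) N : ex_series M -> (forall n, Rabs (u n) <= M n) ->
  Rabs (Series u - sum_n u N) <= Series M - sum_n M N.
Proof.
  intros HM Hu.
  pose proof (ex_series_Rabs _ (ex_series_Rabs_le u M HM Hu)) as Hus.
  rewrite !sum_n_Reals, (Series_incr_n u (S N)), (Series_incr_n M (S N)) by (easy || lia). simpl.
  match goal with |- Rabs ?x <= ?y =>
    replace x with (Series (fun k => u (S (N + k)))) by ring;
    replace y with (Series (fun k => M (S (N + k)))) by ring end.
  apply Series_Rabs_le; [now apply (ex_series_incr_n M (S N))|]. intros; apply Hu.
Qed.

Lemma Rabs_mult_pow x rho k : 0 <= rho -> Rabs x * rho ^ k = Rabs (x * rho ^ k).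
Proof. intros Hr. rewrite Rabs_mult, (Rabs_pos_eq (rho ^ k)); [easy|now apply pow_le]. Qed.

Section SummableRows.

Variables (b : nat -> nat -> R) (M : nat -> R) (rho t : R).
Hypotheses (HM : ex_series M) (Hb : forall n k, Rabs (b n k) * rho ^ k <= M n) (Ht : Rabs t < rho).

Lemma scaled_entry_le n k : Rabs (b n k * rho ^ k) <= M n.
Proof. pose proof (Rabs_pos t). rewrite <- Rabs_mult_pow by lra. apply Hb. Qed.

Lemma ex_pseries_row n : ex_pseries (b n) t.
Proof. apply (PSeries_geom_bound (b n) (M n) rho t); [easy|apply Hb]. Qed.

Lemma ex_pseries_column_sums : ex_pseries (fun k => Series (fun n => b n k)) t.
Proof.
  apply (PSeries_geom_bound _ (Series M) rho t); [easy|]. intros k.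
  pose proof (Rabs_pos t). rewrite Rabs_mult_pow, <- Series_scal_r by lra.
  apply Series_Rabs_le; [easy|]. intros; apply scaled_entry_le.
Qed.

Lemma PSeries_column_sums_tail N :
  Rabs (PSeries (fun k => Series (fun n => b n k)) t - sum_n (fun n => PSeries (b n) t) N)
    <= (Series M - sum_n M N) * / (1 - Rabs t / rho).
Proof.
  destruct (PSeries_sum_n b t N ex_pseries_row) as [Hex Heq].
  rewrite <- Heq, <- PSeries_minus by (easy || exact ex_pseries_column_sums).
  apply PSeries_geom_bound; [easy|]. intros k.
  eapply Rle_trans; [|exact (Series_tail_le _ M N HM (fun n => scaled_entry_le n k))].
  pose proof (Rabs_pos t). rewrite Rabs_mult_pow by lra. right. f_equal. rewrite Series_scal_r.
  replace (sum_n (fun n => b n k * rho ^ k) N) with (sum_n (fun n => b n k) N * rho ^ k)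
    by (symmetry; exact (sum_n_mult_r (K := R_Ring) (rho ^ k) (fun n => b n k) N)).
  unfold PS_minus, PS_plus, PS_opp, plus, opp; simpl. ring.
Qed.

Lemma is_series_rows : is_series (fun n => PSeries (b n) t)
  (PSeries (fun k => Series (fun n => b n k)) t).
Proof.
  set (l := PSeries (fun k => Series (fun n => b n k)) t).
  change (is_lim_seq (sum_n (fun n => PSeries (b n) t)) l).
  apply (is_lim_seq_ext (fun N => l - (l - sum_n (fun n => PSeries (b n) t) N))); [intros; ring|].
  replace (Finite l) with (Finite (l - 0)) by (f_equal; ring).
  apply is_lim_seq_minus'; [apply is_lim_seq_const|]. apply is_lim_seq_abs_0.
  apply is_lim_seq_le_le with (fun _ => 0) (fun N => (Series M - sum_n M N) * / (1 - Rabs t / rho)).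
  - intros N; split; [apply Rabs_pos|apply PSeries_column_sums_tail].
  - apply is_lim_seq_const.
  - replace (Finite 0) with (Finite ((Series M - Series M) * / (1 - Rabs t / rho))) by (f_equal; ring).
    apply is_lim_seq_mult'; [|apply is_lim_seq_const].
    apply is_lim_seq_minus'; [apply is_lim_seq_const|]. now apply (Series_correct M).
Qed.

End SummableRows.

Definition dominated (r : R) (b : nat -> nat -> R) : Prop :=
  forall rho, 0 < rho < r -> exists M : nat -> R, ex_series M /\
    forall n k, Rabs (b n k) * rho ^ k <= M n.

Lemma dominated_is_series (r : R) (b : nat -> nat -> R) (t : R) : dominated r b -> Rabs t < r ->
  is_series (fun n => PSeries (b n) t) (PSeries (fun k => Series (fun n => b n k)) t) /\
  is_pseries (fun k => Series (fun n => b n k)) t (Series (fun n => PSeries (b n) t)).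
Proof.
  intros H Ht. pose proof (Rabs_pos t).
  destruct (H ((Rabs t + r) / 2) ltac:(lra)) as (M & HM & Hb).
  pose proof (is_series_rows b M _ t HM Hb ltac:(lra)) as Hrows.
  split; [easy|]. rewrite (is_series_unique _ _ Hrows).
  apply PSeries_correct. apply (ex_pseries_column_sums b M ((Rabs t + r) / 2) t); (easy || lra).
Qed.

Lemma INR_S_mult_pow_le q k : 0 <= q < 1 -> INR (S k) * q ^ k <= / (1 - q).
Proof.
  intros Hq. apply Rmult_le_reg_r with (1 - q); [lra|]. rewrite Rinv_l by lra.
  enough (INR (S k) * q ^ k * (1 - q) <= 1 - q ^ S k) by (pose proof (pow_le q (S k) ltac:(lra)); lra).
  induction k as [|k IH]; [simpl; lra|].
  rewrite S_INR. pose proof (pow_le q (S k) ltac:(lra)).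
  assert (q ^ S k <= 1) by (rewrite <- (pow1 (S k)); apply pow_incr; lra).
  change (q ^ S (S k)) with (q * q ^ S k). change (q ^ S k) with (q * q ^ k) in *. nra.
Qed.

Lemma dominated_PS_derive (r : R) (b : nat -> nat -> R) :
  dominated r b -> dominated r (fun n => PS_derive (b n)).
Proof.
  intros H rho Hrho. set (rho' := (rho + r) / 2).
  assert (Hrho' : rho < rho' < r) by (unfold rho'; lra).
  destruct (H rho' ltac:(lra)) as (M & HM & Hb).
  assert (Hq : 0 <= rho / rho' < 1).
  { split; [apply Rdiv_le_0_compat; lra|apply Rlt_div_l; lra]. }
  set (c := / (1 - rho / rho') * / rho').
  exists (fun n => c * M n). split; [now apply (ex_series_scal_l c M)|].
  intros n k. pose proof (INR_S_mult_pow_le _ k Hq) as Hpow. pose proof (Hb n (S k)) as Hbk.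
  assert (Hpos : 0 < rho' ^ S k) by (apply pow_lt; lra).
  assert (0 <= Rabs (b n (S k)) * rho' ^ S k) by (apply Rmult_le_pos; [apply Rabs_pos|lra]).
  unfold PS_derive. rewrite Rabs_mult, (Rabs_pos_eq (INR (S k))) by apply pos_INR.
  replace (INR (S k) * Rabs (b n (S k)) * rho ^ k) with
    ((INR (S k) * (rho / rho') ^ k * / rho') * (Rabs (b n (S k)) * rho' ^ S k)).
  - unfold c. apply Rmult_le_compat; [|easy| |easy].
    + apply Rmult_le_pos; [|left; apply Rinv_0_lt_compat; lra].
      apply Rmult_le_pos; [apply pos_INR|apply pow_le; lra].
    + apply Rmult_le_compat_r; [left; apply Rinv_0_lt_compat; lra|easy].
  - unfold Rdiv. rewrite Rpow_mult_distr, pow_inv. simpl. field.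
    split; [|apply pow_nonzero]; lra.
Qed.

Lemma is_derive_dominated_series (r : R) (b : nat -> nat -> R) (f : nat -> R -> R)
  (df : nat -> R) (t : R) :
  dominated r b -> (forall n t, Rabs t < r -> is_pseries (b n) t (f n t)) ->
  Rabs t < r -> (forall n, is_derive (f n) t (df n)) ->
  is_derive (fun t => Series (fun n => f n t)) t (Series df).
Proof.
  intros Hb Hf Ht Hdf.
  set (a := fun k => Series (fun n => b n k)).
  assert (Ha : forall u, Rabs u < r -> is_pseries a u (Series (fun n => f n u))).
  { intros u Hu. rewrite (Series_ext _ (fun n => PSeries (b n) u)).
    - exact (proj2 (dominated_is_series r b u Hb Hu)).
    - intros n. symmetry. now apply is_pseries_unique, Hf. }
  replace (Series df) with (PSeries (PS_derive a) t).
  - exact (proj1 (is_derive_is_pseries a _ r t Ha Ht)).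
  - destruct (dominated_is_series r _ t (dominated_PS_derive r b Hb) Ht) as [Hder _].
    apply is_series_unique in Hder.
    transitivity (Series (fun n => PSeries (PS_derive (b n)) t)).
    + rewrite Hder. apply PSeries_ext. intros k. unfold PS_derive, a. now rewrite Series_scal_l.
    + apply Series_ext. intros n. rewrite <- (is_derive_unique _ _ _ (Hdf n)). symmetry.
      apply is_derive_unique. exact (proj1 (is_derive_is_pseries (b n) (f n) r t (Hf n) Ht)).
Qed.

(** * Complex-valued power series in a real variable *)

Definition canalytic_on (r : R) (f : R -> C) : Prop :=
  analytic_on r (fun t => Re (f t)) /\ analytic_on r (fun t => Im (f t)).

Lemma canalytic_le r r' f : r' <= r -> canalytic_on r f -> canalytic_on r' f.
Proof.
  intros Hr [Hfre Hfim].
  split; [exact (analytic_le _ _ _ Hr Hfre)|exact (analytic_le _ _ _ Hr Hfim)].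
Qed.

Lemma canalytic_const r c : canalytic_on r (fun _ => c).
Proof. split; apply analytic_const. Qed.

Lemma canalytic_RtoC r f : analytic_on r f -> canalytic_on r (fun t => RtoC (f t)).
Proof. intros H. split; [exact H|exact (analytic_const r 0)]. Qed.

Lemma canalytic_plus r f g : canalytic_on r f -> canalytic_on r g ->
  canalytic_on r (fun t => f t + g t)%C.
Proof.
  intros [Hfre Hfim] [Hgre Hgim].
  split; [exact (analytic_plus _ _ _ Hfre Hgre)|exact (analytic_plus _ _ _ Hfim Hgim)].
Qed.

Lemma canalytic_mult r f g : canalytic_on r f -> canalytic_on r g ->
  canalytic_on r (fun t => f t * g t)%C.
Proof.
  intros [Hfre Hfim] [Hgre Hgim]. split.
  - apply (analytic_plus r (fun t => Re (f t) * Re (g t)) (fun t => - (Im (f t) * Im (g t)))).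
    + now apply analytic_mult.
    + now apply analytic_opp, analytic_mult.
  - apply (analytic_plus r (fun t => Re (f t) * Im (g t)) (fun t => Im (f t) * Re (g t)));
      now apply analytic_mult.
Qed.

Lemma canalytic_minus r f g : canalytic_on r f -> canalytic_on r g ->
  canalytic_on r (fun t => f t - g t)%C.
Proof.
  intros Hf [Hfre Hfim]. apply (canalytic_plus r f (fun t => - g t)%C); [easy|].
  split; [exact (analytic_opp _ _ Hfre)|exact (analytic_opp _ _ Hfim)].
Qed.

Lemma canalytic_cderiv r f : canalytic_on r f ->
  exists df, canalytic_on r df /\ forall t, Rabs t < r -> cderiv f t (df t).
Proof.
  intros [Hfre Hfim].
  destruct (analytic_is_derive _ _ Hfre) as (dre & Hdre & Hre).
  destruct (analytic_is_derive _ _ Hfim) as (dim & Hdim & Him).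
  exists (fun t => (dre t, dim t)). split; [now split|]. intros t Ht.
  split; [now apply Hre|now apply Him].
Qed.

Lemma canalytic_identity r d f g : canalytic_on r f -> canalytic_on r g -> 0 < d <= r ->
  (forall t, Rabs t < d -> f t = g t) -> forall t, Rabs t < r -> f t = g t.
Proof.
  intros [Hfre Hfim] [Hgre Hgim] Hd H t Ht.
  rewrite (surjective_pairing (f t)), (surjective_pairing (g t)). f_equal.
  - apply (analytic_identity r d _ _ Hfre Hgre Hd); [|easy]. intros u Hu. now rewrite H.
  - apply (analytic_identity r d _ _ Hfim Hgim Hd); [|easy]. intros u Hu. now rewrite H.
Qed.

Lemma canalytic_bounded r f a b : canalytic_on r f -> -r < a -> b < r ->
  exists B, forall t, a <= t <= b -> Cmod (f t) <= B.
Proof.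
  intros Hf Ha Hb. destruct (canalytic_cderiv r f Hf) as (df & _ & Hdf).
  destruct (bounded_continuity (fun t => Re (f t)) a b) as [Bre HBre].
  { intros t Ht. apply (ex_derive_continuous (fun t => Re (f t))). eexists.
    exact (proj1 (Hdf t (Rabs_def1 t r ltac:(lra) ltac:(lra)))). }
  destruct (bounded_continuity (fun t => Im (f t)) a b) as [Bim HBim].
  { intros t Ht. apply (ex_derive_continuous (fun t => Im (f t))). eexists.
    exact (proj2 (Hdf t (Rabs_def1 t r ltac:(lra) ltac:(lra)))). }
  exists (Bre + Bim). intros t Ht. eapply Rle_trans; [apply Cmod_le_Re_Im|].
  apply Rplus_le_compat; left; [exact (HBre t Ht)|exact (HBim t Ht)].
Qed.

Definition is_cpseries (a : nat -> C) (t : R) (l : C) : Prop :=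
  is_pseries (fun k => Re (a k)) t (Re l) /\ is_pseries (fun k => Im (a k)) t (Im l).

Lemma is_cpseries_scal (c : C) a t l : is_cpseries a t l ->
  is_cpseries (fun k => c * a k)%C t (c * l)%C.
Proof.
  intros [Hfre Hfim].
  assert (Hscal : forall x u m, is_pseries u t m -> is_pseries (fun k => x * u k) t (x * m)).
  { intros x u m H. exact (is_pseries_scal x u t m (Rmult_comm t x) H). }
  destruct c as [x y]. split.
  - exact (is_pseries_minus _ _ _ _ _ (Hscal x _ _ Hfre) (Hscal y _ _ Hfim)).
  - exact (is_pseries_plus _ _ _ _ _ (Hscal x _ _ Hfim) (Hscal y _ _ Hfre)).
Qed.

Lemma is_cpseries_minus a b t l m : is_cpseries a t l -> is_cpseries b t m ->
  is_cpseries (fun k => a k - b k)%C t (l - m)%C.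
Proof.
  intros [Hfre Hfim] [Hgre Hgim].
  split; [exact (is_pseries_minus _ _ _ _ _ Hfre Hgre)|exact (is_pseries_minus _ _ _ _ _ Hfim Hgim)].
Qed.

Definition shift_coef (a : nat -> C) (k : nat) : C := match k with O => 0%C | S j => a j end.

Lemma is_cpseries_shift_coef a t l : is_cpseries a t l -> is_cpseries (shift_coef a) t (RtoC t * l)%C.
Proof.
  intros [Hfre Hfim]. split; rewrite ?re_scal_l, ?im_scal_l.
  - apply (is_pseries_ext (PS_incr_1 (fun k => Re (a k)))); [now intros [|k]|].
    exact (is_pseries_incr_1 _ _ _ Hfre).
  - apply (is_pseries_ext (PS_incr_1 (fun k => Im (a k)))); [now intros [|k]|].
    exact (is_pseries_incr_1 _ _ _ Hfim).
Qed.

Definition cdominated (r : R) (b : nat -> nat -> C) : Prop :=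
  forall rho, 0 < rho < r -> exists M : nat -> R, ex_series (fun n => M (S n)) /\
    forall n k, (1 <= n)%nat -> Cmod (b n k) * rho ^ k <= M n.

Lemma cdominated_dominated r b : cdominated r b ->
  dominated r (fun n k => Re (b (S n) k)) /\ dominated r (fun n k => Im (b (S n) k)).
Proof.
  intros H. split; intros rho Hrho; destruct (H rho Hrho) as (M & HM & Hb);
    exists (fun n => M (S n)); (split; [easy|]); intros n k;
    (eapply Rle_trans; [apply Rmult_le_compat_r; [apply pow_le; lra|]|apply (Hb (S n) k); lia]);
    [apply re_le_Cmod|apply im_le_Cmod].
Qed.

Section DominatedComplexSeries.

Variables (r : R) (b : nat -> nat -> C) (f : nat -> R -> C).
Hypothesis Hb : cdominated r b.
Hypothesis Hf : forall n t, (1 <= n)%nat -> Rabs t < r -> is_cpseries (b n) t (f n t).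

Lemma canalytic_cseries : canalytic_on r (fun t => cseries (fun n => f n t)).
Proof.
  destruct (cdominated_dominated r b Hb) as [Hre Him]. split.
  - exists (fun k => Series (fun n => Re (b (S n) k))). intros t Ht.
    change (Re (cseries _)) with (Series (fun n => Re (f (S n) t))).
    rewrite <- (Series_ext (fun n => PSeries (fun k => Re (b (S n) k)) t)).
    + exact (proj2 (dominated_is_series r _ t Hre Ht)).
    + intros n. apply is_pseries_unique. exact (proj1 (Hf (S n) t ltac:(lia) Ht)).
  - exists (fun k => Series (fun n => Im (b (S n) k))). intros t Ht.
    change (Im (cseries _)) with (Series (fun n => Im (f (S n) t))).
    rewrite <- (Series_ext (fun n => PSeries (fun k => Im (b (S n) k)) t)).
    + exact (proj2 (dominated_is_series r _ t Him Ht)).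
    + intros n. apply is_pseries_unique. exact (proj2 (Hf (S n) t ltac:(lia) Ht)).
Qed.

Lemma cderiv_cseries (df : nat -> C) t : Rabs t < r ->
  (forall n, (1 <= n)%nat -> cderiv (f n) t (df n)) ->
  cderiv (fun t => cseries (fun n => f n t)) t (cseries df).
Proof.
  intros Ht Hdf. destruct (cdominated_dominated r b Hb) as [Hre Him]. split.
  - apply (is_derive_dominated_series r _ (fun n t => Re (f (S n) t)) (fun n => Re (df (S n))) t Hre).
    + intros n u Hu. exact (proj1 (Hf (S n) u ltac:(lia) Hu)).
    + easy.
    + intros n. exact (proj1 (Hdf (S n) ltac:(lia))).
  - apply (is_derive_dominated_series r _ (fun n t => Im (f (S n) t)) (fun n => Im (df (S n))) t Him).
    + intros n u Hu. exact (proj2 (Hf (S n) u ltac:(lia) Hu)).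
    + easy.
    + intros n. exact (proj2 (Hdf (S n) ltac:(lia))).
Qed.

End DominatedComplexSeries.

(** * Taylor coefficients of complex powers *)

Lemma pow_fact_le_exp x k : 0 <= x -> x ^ k * / INR (fact k) <= exp x.
Proof.
  intros Hx. pose proof (is_exp_Reals x) as H. apply is_pseries_R in H.
  assert (Hpos : forall n, 0 <= / INR (fact n) * x ^ n).
  { intros n. apply Rmult_le_pos; [left; apply Rinv_0_lt_compat, INR_fact_lt_0|now apply pow_le]. }
  apply Rle_trans with (sum_n (fun n => / INR (fact n) * x ^ n) k).
  - rewrite Rmult_comm. destruct k as [|k]; [rewrite sum_O; lra|].
    rewrite sum_Sn, sum_n_Reals. pose proof (cond_pos_sum _ k Hpos). unfold plus; cbn. lra.
  - apply (is_lim_seq_incr_compare _ _ H).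
    intros n. rewrite sum_Sn. pose proof (Hpos (S n)). unfold plus; cbn in *. lra.
Qed.

Lemma is_cpseries_RtoC a t l : is_pseries a t l -> is_cpseries (fun k => RtoC (a k)) t (RtoC l).
Proof.
  intros H. split; [exact H|].
  rewrite im_RtoC, <- (Rmult_0_l l).
  apply (is_pseries_ext (PS_scal 0 a)); [intros k; exact (Rmult_0_l (a k))|].
  exact (is_pseries_scal 0 a t l (Rmult_comm t 0) H).
Qed.

Lemma is_pseries_exp v t : is_pseries (fun k => v ^ k * / INR (fact k)) t (exp (t * v)).
Proof.
  pose proof (is_exp_Reals (t * v)) as H. apply is_pseries_R in H.
  apply is_pseries_R. apply is_series_ext with (2 := H). intros n.
  change (/ INR (fact n) * (t * v) ^ n = v ^ n * / INR (fact n) * t ^ n).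
  rewrite Rpow_mult_distr. ring.
Qed.

(* Coefficient of [t^k] in the expansion of [x^(t - s)]. *)
Definition cpow_coef (s : C) (k : nat) (x : R) : C :=
  (cpow x (- s) * RtoC (ln x ^ k * / INR (fact k)))%C.

Lemma is_cpseries_cpow_coef s x t : is_cpseries (fun k => cpow_coef s k x) t (cpow x (RtoC t - s)%C).
Proof.
  replace (cpow x (RtoC t - s)%C) with (cpow x (- s)%C * RtoC (exp (t * ln x)))%C.
  - apply is_cpseries_scal, is_cpseries_RtoC, is_pseries_exp.
  - unfold Cminus. rewrite cpow_plus, cpow_RtoC. unfold Rpower. ring.
Qed.

Lemma cpow_coef_bound s k x rho : 1 <= x -> 0 < rho ->
  Cmod (cpow_coef s k x) * rho ^ k <= Rpower x (rho - Re s).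
Proof.
  intros Hx Hr. pose proof (ln_ge0 x Hx).
  unfold cpow_coef. rewrite Cmod_mult, cpow_Cmod, Cmod_R, re_opp.
  rewrite Rabs_pos_eq by
    (apply Rmult_le_pos; [now apply pow_le|left; apply Rinv_0_lt_compat, INR_fact_lt_0]).
  replace (rho - Re s) with (- Re s + rho) by ring.
  rewrite Rpower_plus, Rmult_assoc. apply Rmult_le_compat_l; [left; apply Rpower_pos|].
  pose proof (pow_fact_le_exp (rho * ln x) k ltac:(nra)) as Hexp.
  rewrite Rpow_mult_distr in Hexp. unfold Rpower. lra.
Qed.

(* Since [d/dx x^(t - s) = (t - s) x^(t - (s + 1))], this operator sends the Taylor coefficients
   of a function of [x] to those of its derivative. *)
Definition coef_derive (p : C -> nat -> R -> C) (s : C) (k : nat) (x : R) : C :=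
  (shift_coef (fun j => p (s + 1)%C j x) k - s * p (s + 1)%C k x)%C.

Lemma is_cpseries_coef_derive p s x t l : is_cpseries (fun k => p (s + 1)%C k x) t l ->
  is_cpseries (fun k => coef_derive p s k x) t ((RtoC t - s) * l)%C.
Proof.
  intros H. replace ((RtoC t - s) * l)%C with (RtoC t * l - s * l)%C by ring.
  apply is_cpseries_minus; [now apply is_cpseries_shift_coef|now apply is_cpseries_scal].
Qed.

Lemma coef_derive_bound p (A : C -> R) s k x rho : 0 < rho ->
  (forall s k, Cmod (p s k x) * rho ^ k <= A s) ->
  Cmod (coef_derive p s k x) * rho ^ k <= (rho + Cmod s) * A (s + 1)%C.
Proof.
  intros Hr Hp. assert (Hpow : 0 < rho ^ k) by now apply pow_lt.
  assert (Hshift : Cmod (shift_coef (fun j => p (s + 1)%C j x) k) * rho ^ k <= rho * A (s + 1)%C).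
  { destruct k as [|k]; simpl.
    - rewrite Cmod_0, Rmult_0_l. pose proof (Hp (s + 1)%C 0%nat) as H0.
      pose proof (Cmod_ge_0 (p (s + 1)%C 0%nat x)). simpl in H0. apply Rmult_le_pos; lra.
    - pose proof (Hp (s + 1)%C k). nra. }
  unfold coef_derive, Cminus.
  eapply Rle_trans; [apply Rmult_le_compat_r; [lra|apply Cmod_triangle]|].
  rewrite Cmod_opp, Cmod_mult.
  pose proof (Rmult_le_compat_l _ _ _ (Cmod_ge_0 s) (Hp (s + 1)%C k)). lra.
Qed.

Lemma cderiv_coef_derive p q s k x : (forall j, cderiv (p (s + 1)%C j) x (q (s + 1)%C j x)) ->
  cderiv (coef_derive p s k) x (coef_derive q s k x).
Proof.
  intros H. apply cderiv_minus; [|now apply cderiv_scal].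
  destruct k as [|k]; [exact (cderiv_const 0%C x)|exact (H k)].
Qed.

Lemma cderiv_cpow_coef s k x : 0 < x -> cderiv (cpow_coef s k) x (coef_derive cpow_coef s k x).
Proof.
  intros Hx.
  assert (Hln : is_derive (fun x => ln x ^ k * / INR (fact k)) x
    match k with O => 0 | S j => / x * (ln x ^ j * / INR (fact j)) end).
  { destruct k as [|j].
    - simpl. auto_derive; [easy|ring].
    - auto_derive; [easy|]. change (fact j + j * fact j)%nat with (S j * fact j)%nat.
      rewrite mult_INR. change (match j with O => 1 | S _ => INR j + 1 end) with (INR (S j)). field.
      repeat split; first [apply INR_fact_neq_0|apply not_0_INR; lia|lra]. }
  assert (Hsucc : cpow x (- s)%C = (cpow x (- (s + 1))%C * RtoC x)%C).
  { rewrite <- cpow_succ by easy. f_equal. ring. }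
  replace (coef_derive cpow_coef s k x) with
    (- s * cpow x (- s - 1)%C * RtoC (ln x ^ k * / INR (fact k)) +
     cpow x (- s)%C * RtoC match k with O => 0 | S j => / x * (ln x ^ j * / INR (fact j)) end)%C.
  - apply (cderiv_mult (fun x => cpow x (- s)%C) (fun x => RtoC (ln x ^ k * / INR (fact k))));
      [now apply cderiv_cpow|exact (cderiv_RtoC _ _ _ Hln)].
  - unfold coef_derive, cpow_coef. replace (- s - 1)%C with (- (s + 1))%C by ring.
    rewrite Hsucc. destruct k as [|j]; unfold shift_coef; [ring|].
    rewrite (RtoC_mult (/ x)), RtoC_inv by lra. field. intros E. apply RtoC_inj in E. lra.
Qed.

(** * The function (s - 1) zeta(s) *)

Definition zeta_increment (s : C) (n : nat) : C :=
  (cpow (INR (S n)) (1 - s) - cpow (INR n) (1 - s) - (1 - s) * cpow (INR n) (- s))%C.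

(* [xi s = (s - 1) zeta(s)]: on [Re s > 1] the first two terms of [zeta_increment] telescope,
   and on [Re s > 0] the series still converges. *)
Definition xi (s : C) : C := (1 + cseries (zeta_increment s))%C.

Definition zeta_partial (s : C) (N : nat) : C :=
  ((s - 1) * csum (fun n => cpow (INR n) (- s)%C) N + cpow (INR (S N)) (1 - s)%C)%C.

Lemma zeta_partial_increment s N : zeta_partial s N = (1 + csum (zeta_increment s) N)%C.
Proof.
  unfold zeta_partial. induction N as [|N IH]; cbn [csum].
  - change (INR 1) with 1. rewrite cpow_base_1. ring.
  - replace (1 + (csum (zeta_increment s) N + zeta_increment s (S N)))%C
      with ((1 + csum (zeta_increment s) N) + zeta_increment s (S N))%C by ring.
    rewrite <- IH. unfold zeta_increment. ring.
Qed.

Lemma zeta_increment_bound s n : 0 <= Re s -> (1 <= n)%nat ->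
  Cmod (zeta_increment s n) <= Cmod (1 - s)%C * Cmod s * Rpower (INR n) (- Re s - 1).
Proof.
  intros Hs Hn. assert (Hp : 0 < INR n) by (apply lt_0_INR; lia).
  pose proof (cderiv_taylor_bound (fun x => cpow x (1 - s)%C) (fun x => (1 - s) * cpow x (- s)%C)%C
    (fun x => (1 - s) * (- s * cpow x (- s - 1)%C))%C
    (Cmod (1 - s)%C * Cmod s * Rpower (INR n) (- Re s - 1)) (INR n) (INR n + 1) ltac:(lra)) as Htaylor.
  replace (INR n + 1 - INR n) with 1 in Htaylor by ring.
  rewrite pow1, Rmult_1_r, Cmult_1_r, <- S_INR in Htaylor. apply Htaylor.
  rewrite S_INR. intros x Hx. split; [|split].
  - replace (- s)%C with (1 - s - 1)%C by ring. apply cderiv_cpow. lra.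
  - apply (cderiv_scal (1 - s)%C (fun x => cpow x (- s)%C)), cderiv_cpow. lra.
  - rewrite !Cmod_mult, Cmod_opp, cpow_Cmod, re_minus, re_opp, re_RtoC, Rmult_assoc.
    do 2 (apply Rmult_le_compat_l; [apply Cmod_ge_0|]). apply Rpower_le_anti_l; lra.
Qed.

Lemma clim_zeta_partial s : 0 < Re s -> clim (zeta_partial s) (xi s).
Proof.
  intros Hs. apply (clim_ext (fun N => 1 + csum (zeta_increment s) N)%C).
  - intros. now rewrite zeta_partial_increment.
  - apply clim_plus; [apply clim_const|].
    apply (clim_cseries _ (Cmod (1 - s)%C * Cmod s) (Re s)); [easy|].
    intros. apply zeta_increment_bound; [lra|easy].
Qed.

Lemma zeta_partial_tail s N : 0 < Re s -> (1 <= N)%nat ->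
  Cmod (xi s - zeta_partial s N) <= Cmod (1 - s)%C * Cmod s * (/ Re s * Rpower (INR N) (- Re s)).
Proof.
  intros Hs HN. rewrite zeta_partial_increment. unfold xi.
  replace (1 + cseries (zeta_increment s) - (1 + csum (zeta_increment s) N))%C
    with (cseries (zeta_increment s) - csum (zeta_increment s) N)%C by ring.
  apply cseries_tail; [easy| |easy]. intros. apply zeta_increment_bound; [lra|easy].
Qed.

Definition zeta_increment_coef (s : C) (n k : nat) : C :=
  (cpow_coef (s - 1)%C k (INR (S n)) - cpow_coef (s - 1)%C k (INR n)
   - coef_derive cpow_coef (s - 1)%C k (INR n))%C.

Lemma is_cpseries_zeta_increment s n t :
  is_cpseries (zeta_increment_coef s n) t (zeta_increment (s - RtoC t)%C n).
Proof.
  unfold zeta_increment.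
  replace (1 - (s - RtoC t))%C with (RtoC t - (s - 1))%C by ring.
  apply is_cpseries_minus; [apply is_cpseries_minus; apply is_cpseries_cpow_coef|].
  apply is_cpseries_coef_derive.
  replace (- (s - RtoC t))%C with (RtoC t - (s - 1 + 1))%C by ring. apply is_cpseries_cpow_coef.
Qed.

Lemma zeta_increment_coef_bound s n k rho : (1 <= n)%nat -> 0 < rho < Re s + 1 ->
  Cmod (zeta_increment_coef s n k) * rho ^ k <=
  (rho + Cmod (s - 1)%C) * (rho + Cmod s) * Rpower (INR n) (rho - Re s - 1).
Proof.
  intros Hn Hr. pose proof (INR_ge1 n Hn). assert (Hpow : 0 < rho ^ k) by (apply pow_lt; lra).
  set (B := (rho + Cmod (s - 1)%C) * (rho + Cmod s) * Rpower (INR n) (rho - Re s - 1)).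
  apply Rle_div_r; [easy|].
  pose proof (cderiv_taylor_bound (cpow_coef (s - 1)%C k) (coef_derive cpow_coef (s - 1)%C k)
    (coef_derive (coef_derive cpow_coef) (s - 1)%C k) (B / rho ^ k) (INR n)
      (INR n + 1) ltac:(lra)) as Htaylor.
  replace (INR n + 1 - INR n) with 1 in Htaylor by ring.
  rewrite pow1, Rmult_1_r, Cmult_1_r, <- S_INR in Htaylor. apply Htaylor.
  rewrite S_INR. intros x Hx. split; [|split].
  - apply cderiv_cpow_coef. lra.
  - apply cderiv_coef_derive. intros j. apply cderiv_cpow_coef. lra.
  - apply Rle_div_r; [easy|].
    eapply Rle_trans; [apply (coef_derive_bound _
      (fun s => (rho + Cmod s) * Rpower x (rho - Re (s + 1)%C))); [lra|]|].
    + intros s' j. apply (coef_derive_bound _ (fun s => Rpower x (rho - Re s))); [lra|].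
      intros. apply cpow_coef_bound; lra.
    + unfold B. replace (s - 1 + 1)%C with s by ring. rewrite re_plus, re_RtoC, <- Rmult_assoc.
      replace (rho - (Re s + 1)) with (rho - Re s - 1) by ring.
      apply Rmult_le_compat_l; [|apply Rpower_le_anti_l; lra].
      pose proof (Cmod_ge_0 s). pose proof (Cmod_ge_0 (s - 1)). apply Rmult_le_pos; lra.
Qed.

Lemma ex_series_scal_Rpower B e : e < -1 -> ex_series (fun n => B * Rpower (INR (S n)) e).
Proof.
  intros He. apply (ex_series_scal_l B (fun n => Rpower (INR (S n)) e)). now apply ex_series_Rpower.
Qed.

Lemma canalytic_xi s : canalytic_on (Re s) (fun t => xi (s - RtoC t)%C).
Proof.
  apply canalytic_plus; [apply canalytic_const|].
  apply (canalytic_cseries _ (zeta_increment_coef s)).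
  - intros rho Hr.
    exists (fun n => (rho + Cmod (s - 1)%C) * (rho + Cmod s) * Rpower (INR n) (rho - Re s - 1)).
    split; [apply ex_series_scal_Rpower; lra|].
    intros n k Hn. apply zeta_increment_coef_bound; [easy|lra].
  - intros n t _ _. apply is_cpseries_zeta_increment.
Qed.

(** * Dirichlet series *)

Definition dirichlet_term (c : nat -> R) (s : C) (n : nat) : C :=
  (RtoC (c n) * cpow (INR n) (- s))%C.

Definition dirichlet (c : nat -> R) (s : C) : C := cseries (dirichlet_term c s).

Lemma dirichlet_term_bound c theta K s n : (1 <= n)%nat -> Rabs (c n) <= K * Rpower (INR n) theta ->
  Cmod (dirichlet_term c s n) <= K * Rpower (INR n) (theta - Re s).
Proof.
  intros Hn Hc. unfold dirichlet_term. rewrite Cmod_mult, Cmod_R, cpow_Cmod, re_opp.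
  unfold Rminus. rewrite Rpower_plus, <- Rmult_assoc.
  apply Rmult_le_compat_r; [left; apply Rpower_pos|easy].
Qed.

Lemma clim_dirichlet c theta s : power_bounded c theta -> theta + 1 < Re s ->
  clim (csum (dirichlet_term c s)) (dirichlet c s).
Proof.
  intros (K & _ & Hc) Hs. apply (clim_cseries _ K (Re s - theta - 1)); [lra|].
  intros n Hn. replace (- (Re s - theta - 1) - 1) with (theta - Re s) by ring.
  apply dirichlet_term_bound; [easy|now apply Hc].
Qed.

Lemma cderiv_cpow_exponent x s t :
  cderiv (fun t => cpow x (- (s - RtoC t))%C) t (RtoC (ln x) * cpow x (- (s - RtoC t)))%C.
Proof.
  destruct s as [a b]. unfold cpow. split; simpl; (auto_derive; [easy|ring]).
Qed.

Lemma cderiv_dirichlet c theta s t : power_bounded c theta -> Rabs t < Re s - theta - 1 ->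
  cderiv (fun t => dirichlet c (s - RtoC t)%C) t
    (dirichlet (fun n => c n * ln (INR n)) (s - RtoC t)%C).
Proof.
  intros (K & _ & Hc) Ht.
  apply (cderiv_cseries (Re s - theta - 1) (fun n k => RtoC (c n) * cpow_coef s k (INR n))%C
    (fun n t => dirichlet_term c (s - RtoC t)%C n)); [| |easy|].
  - intros rho Hr. exists (fun n => K * Rpower (INR n) (theta + (rho - Re s))).
    split; [apply ex_series_scal_Rpower; lra|].
    intros n k Hn. rewrite Cmod_mult, Cmod_R, Rpower_plus, Rmult_assoc, <- (Rmult_assoc K).
    assert (0 <= rho ^ k) by (apply pow_le; lra).
    apply Rmult_le_compat; [apply Rabs_pos| |now apply Hc|].
    + apply Rmult_le_pos; [apply Cmod_ge_0|easy].
    + apply cpow_coef_bound; [now apply INR_ge1|lra].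
  - intros n u _ _. apply is_cpseries_scal.
    replace (- (s - RtoC u))%C with (RtoC u - s)%C by ring. apply is_cpseries_cpow_coef.
  - intros n _. unfold dirichlet_term. rewrite RtoC_mult, <- Cmult_assoc.
    apply cderiv_scal, cderiv_cpow_exponent.
Qed.

Definition abel_term (F : nat -> R) (s : C) (n : nat) : C :=
  (RtoC (F n) * (cpow (INR n) (- s) - cpow (INR (S n)) (- s)))%C.

Definition abel_series (F : nat -> R) (s : C) : C := cseries (abel_term F s).

Lemma canalytic_abel_series F theta s : power_bounded F theta -> 0 <= theta ->
  canalytic_on (Re s - theta) (fun t => abel_series F (s - RtoC t)%C).
Proof.
  intros (K & _ & HF) Hth.
  apply (canalytic_cseries _
    (fun n k => RtoC (F n) * (cpow_coef s k (INR n) - cpow_coef s k (INR (S n))))%C).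
  - intros rho Hr. exists (fun n => K * (rho + Cmod s) * Rpower (INR n) (theta + (rho - Re s - 1))).
    split; [apply ex_series_scal_Rpower; lra|].
    intros n k Hn. pose proof (INR_ge1 n Hn). assert (Hpow : 0 < rho ^ k) by (apply pow_lt; lra).
    assert (Hdiff : Cmod (cpow_coef s k (INR n) - cpow_coef s k (INR (S n))) * rho ^ k <=
      (rho + Cmod s) * Rpower (INR n) (rho - Re s - 1)).
    { apply Rle_div_r; [easy|]. rewrite Cmod_minus_sym, S_INR, <- Rmult_1_r.
      replace 1 with (INR n + 1 - INR n) at 3 by ring.
      apply (cderiv_bound (cpow_coef s k) (coef_derive cpow_coef s k)); [lra|].
      intros x Hx. split; [apply cderiv_cpow_coef; lra|]. apply Rle_div_r; [easy|].
      eapply Rle_trans; [apply (coef_derive_bound _ (fun s => Rpower x (rho - Re s))); [lra|]|].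
      - intros. apply cpow_coef_bound; lra.
      - rewrite re_plus, re_RtoC. replace (rho - (Re s + 1)) with (rho - Re s - 1) by ring.
        pose proof (Cmod_ge_0 s). apply Rmult_le_compat_l; [lra|]. apply Rpower_le_anti_l; lra. }
    rewrite Cmod_mult, Cmod_R, Rpower_plus, Rmult_assoc.
    replace (K * (rho + Cmod s) * (Rpower (INR n) theta * Rpower (INR n) (rho - Re s - 1)))
      with ((K * Rpower (INR n) theta) * ((rho + Cmod s) * Rpower (INR n) (rho - Re s - 1))) by ring.
    apply Rmult_le_compat; [apply Rabs_pos| |now apply HF|easy].
    apply Rmult_le_pos; [apply Cmod_ge_0|lra].
  - intros n t _ _. apply is_cpseries_scal.
    replace (- (s - RtoC t))%C with (RtoC t - s)%C by ring.
    apply is_cpseries_minus; apply is_cpseries_cpow_coef.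
Qed.

Lemma abel_series_eq F c theta s l : (forall n, F n = rsum c n) ->
  power_bounded F theta -> theta < Re s ->
  0 <= Re s -> clim (csum (dirichlet_term c s)) l -> abel_series F s = l.
Proof.
  intros HFc (K & HK & HF) Hs Hs0 Hl.
  set (w := fun n => cpow (INR n) (- s)%C).
  assert (Hsum : forall n, csum (fun n => RtoC (c n)) n = RtoC (F n))
      by (intros; now rewrite csum_RtoC, HFc).
  apply cseries_unique.
  apply (clim_ext (csum (fun n => csum (fun n => RtoC (c n)) n * (w n - w (S n)))%C)).
  - intros N _. apply csum_ext. intros n _. now rewrite Hsum.
  - apply clim_abel; [exact Hl|].
    apply (clim_squeeze_0 _ (fun N => K * Rpower (INR N) (- (Re s - theta)))).
    + apply is_lim_seq_scal_0, is_lim_seq_Rpower_neg. lra.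
    + intros N HN. rewrite Hsum. unfold w. rewrite Cmod_mult, Cmod_R, cpow_Cmod, re_opp.
      replace (- (Re s - theta)) with (theta + - Re s) by ring. rewrite Rpower_plus, <- Rmult_assoc.
      apply Rmult_le_compat; [apply Rabs_pos|left; apply Rpower_pos|now apply HF|].
      pose proof (INR_ge1 N HN). rewrite S_INR. apply Rpower_le_anti_l; lra.
Qed.

Lemma csum_multiples f d N : (1 <= d)%nat ->
  csum (fun n => if dividesb d n then f n else 0%C) N = csum (fun m => f (d * m)%nat) (N / d).
Proof.
  intros Hd. induction N as [|N IH].
  - rewrite Nat.Div0.div_0_l. reflexivity.
  - cbn [csum]. rewrite IH. destruct (dividesb d (S N)) eqn:Hdv.
    + apply dividesb_divide in Hdv. destruct Hdv as [[|q] Hq]; [lia|].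
      replace (S N / d)%nat with (S q) by (apply Nat.div_unique with 0%nat; lia).
      replace (N / d)%nat with q by (apply Nat.div_unique with (d - 1)%nat; lia).
      cbn [csum]. do 2 f_equal. lia.
    + rewrite Cplus_0_r. f_equal.
      pose proof (Nat.div_mod (S N) d ltac:(lia)).
      pose proof (Nat.mod_upper_bound (S N) d ltac:(lia)).
      unfold dividesb in Hdv. apply Nat.eqb_neq in Hdv.
      symmetry. apply Nat.div_unique with (S N mod d - 1)%nat; lia.
Qed.

Lemma Rpower_div_le N d p : 0 < p -> (1 <= d <= N)%nat ->
  Rpower (INR (N / d)) (- p) <= Rpower 2 p * Rpower (INR d) p * Rpower (INR N) (- p).
Proof.
  intros Hp Hd.
  assert (HM : (1 <= N / d)%nat) by (apply Nat.div_le_lower_bound; lia).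
  set (M := (N / d)%nat) in *.
  assert (HNM : (N <= 2 * (d * M))%nat).
  { pose proof (Nat.div_mod N d ltac:(lia)) as Hdiv. fold M in Hdiv.
    pose proof (Nat.mod_upper_bound N d ltac:(lia)). nia. }
  apply le_INR in HNM. rewrite !mult_INR in HNM. change (INR 2) with 2 in HNM.
  pose proof (INR_ge1 M HM). pose proof (INR_ge1 d ltac:(lia)). pose proof (INR_ge1 N ltac:(lia)).
  replace (Rpower (INR M) (- p)) with
    (Rpower 2 p * Rpower (INR d) p * Rpower (2 * (INR d * INR M)) (- p)).
  - apply Rmult_le_compat_l; [|apply Rpower_le_anti_l; lra].
    apply Rmult_le_pos; left; apply Rpower_pos.
  - rewrite <- !Rpower_mult_distr, !Rpower_Ropp by (try apply Rmult_lt_0_compat; lra).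
    pose proof (Rpower_pos 2 p). pose proof (Rpower_pos (INR d) p). pose proof (Rpower_pos (INR M) p).
    field. lra.
Qed.

Lemma clim_dirichlet_convolution f g A B p : 0 < p ->
  (forall n, (1 <= n)%nat -> Cmod (f n) <= A * Rpower (INR n) (- (2 * p) - 1)) ->
  (forall n, (1 <= n)%nat -> Cmod (g n) <= B * Rpower (INR n) (- p - 1)) ->
  clim (fun N => csum (fun d => f d * csum g (N / d)) N)%C (cseries f * cseries g)%C.
Proof.
  intros Hp Hf Hg.
  pose proof (dominating_constant_ge0 f A _ Hf) as HA.
  pose proof (dominating_constant_ge0 g B _ Hg) as HB.
  set (E := A * (B * / p * Rpower 2 p)).
  assert (HE : 0 <= E).
  { pose proof (Rpower_pos 2 p). pose proof (Rinv_0_lt_compat p Hp).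
    repeat apply Rmult_le_pos; lra. }
  assert (Hmain : clim (fun N => csum f N * cseries g)%C (cseries f * cseries g)%C).
  { rewrite (Cmult_comm (cseries f)).
    apply (clim_ext (fun N => cseries g * csum f N)%C); [intros; apply Cmult_comm|].
    apply clim_scal, (clim_cseries _ A (2 * p)); [lra|easy]. }
  assert (Herr : clim (fun N => csum (fun d => f d * (csum g (N / d) - cseries g)) N)%C 0%C).
  { apply (clim_squeeze_0 _ (fun N => E * (1 + / p) * Rpower (INR N) (- p))).
    - now apply is_lim_seq_scal_0, is_lim_seq_Rpower_neg.
    - intros N HN.
      eapply Rle_trans; [apply (csum_le _
        (fun d => E * Rpower (INR N) (- p) * Rpower (INR d) (- p - 1)))|].
      + intros d Hd. assert (HM : (1 <= N / d)%nat) by (apply Nat.div_le_lower_bound; lia).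
        rewrite Cmod_mult, Cmod_minus_sym.
        pose proof (cseries_tail g B p Hp Hg _ HM) as Htail.
        pose proof (Rpower_div_le N d p Hp Hd) as Hdiv.
        assert (HBp : 0 <= B * / p) by (apply Rmult_le_pos; [|left; apply Rinv_0_lt_compat]; lra).
        apply Rle_trans with ((A * Rpower (INR d) (- (2 * p) - 1)) *
          (B * / p * (Rpower 2 p * Rpower (INR d) p * Rpower (INR N) (- p)))).
        * apply Rmult_le_compat; [apply Cmod_ge_0|apply Cmod_ge_0|apply Hf; lia|].
          pose proof (Rmult_le_compat_l _ _ _ HBp Hdiv). lra.
        * replace (- p - 1) with (- (2 * p) - 1 + p) by ring. rewrite Rpower_plus.
          right. unfold E. ring.
      + rewrite rsum_scal. pose proof (rsum_Rpower_le p N Hp) as Hsum.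
        pose proof (Rpower_pos (INR N) (- p)).
        replace (E * (1 + / p) * Rpower (INR N) (- p))
          with (E * Rpower (INR N) (- p) * (1 + / p)) by ring.
        apply Rmult_le_compat_l; [apply Rmult_le_pos; lra|easy]. }
  replace (cseries f * cseries g)%C with (0 + cseries f * cseries g)%C by ring.
  eapply clim_ext; [|exact (clim_plus _ _ _ _ Herr Hmain)].
  intros N _. cbv beta. rewrite (Cmult_comm (csum f N)), <- csum_scal, <- csum_plus.
  apply csum_ext. intros d _. ring.
Qed.

(** * Zeros to the right of the critical line *)

Lemma power_bounded_const c : power_bounded (fun _ => c) 0.
Proof.
  exists (Rabs c + 1). split; [pose proof (Rabs_pos c); lra|]. intros n Hn.
  rewrite Rpower_O by (apply lt_0_INR; lia). lra.
Qed.

Lemma power_bounded_ln e : 0 < e -> power_bounded (fun n => ln (INR n)) e.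
Proof.
  intros He. exists (/ e). split; [now apply Rinv_0_lt_compat|]. intros n Hn.
  rewrite Rabs_pos_eq by now apply ln_ge0, INR_ge1. now apply ln_le_Rpower.
Qed.

Lemma power_bounded_vonMangoldt e : 0 < e -> power_bounded vonMangoldt e.
Proof.
  intros He. destruct (power_bounded_ln e He) as (K & HK & Hln).
  exists K. split; [easy|]. intros n Hn. eapply Rle_trans; [|now apply Hln].
  rewrite !Rabs_pos_eq by (apply vonMangoldt_ge0 || now apply ln_ge0, INR_ge1).
  now apply vonMangoldt_le_ln.
Qed.

Definition zeta (s : C) : C := dirichlet (fun _ => 1) s.

Lemma clim_zeta s : 1 < Re s -> clim (csum (fun n => cpow (INR n) (- s)%C)) (zeta s).
Proof.
  intros Hs. apply (clim_ext (csum (dirichlet_term (fun _ => 1) s))).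
  - intros N _. apply csum_ext. intros n _. apply Cmult_1_l.
  - apply (clim_dirichlet _ 0); [apply power_bounded_const|lra].
Qed.

Lemma xi_zeta s : 1 < Re s -> xi s = ((s - 1) * zeta s)%C.
Proof.
  intros Hs. apply (clim_unique (zeta_partial s)); [apply clim_zeta_partial; lra|].
  replace ((s - 1) * zeta s)%C with ((s - 1) * zeta s + 0)%C by ring.
  apply clim_plus; [now apply clim_scal, clim_zeta|].
  apply (clim_squeeze_0 _ (fun N => Rpower (INR N) (- (Re s - 1)))).
  - apply is_lim_seq_Rpower_neg. lra.
  - intros N HN. pose proof (INR_ge1 N HN). rewrite cpow_Cmod, re_minus, re_RtoC, S_INR.
    replace (1 - Re s) with (- (Re s - 1)) by ring. apply Rpower_le_anti_l; lra.
Qed.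

Lemma zeta_neq0 s : 2 < Re s -> zeta s <> 0%C.
Proof.
  intros Hs E.
  pose proof (cseries_tail (dirichlet_term (fun _ => 1) s) 1 (Re s - 1) ltac:(lra)) as Htail.
  specialize (Htail ltac:(intros n Hn; replace (- (Re s - 1) - 1) with (0 - Re s) by ring;
    apply dirichlet_term_bound; [easy|rewrite Rpower_O, Rabs_R1 by (apply lt_0_INR; lia);
      lra]) 1%nat ltac:(lia)).
  fold (dirichlet (fun _ => 1) s) in Htail. fold (zeta s) in Htail. rewrite E in Htail.
  cbn [csum] in Htail. unfold dirichlet_term in Htail. change (INR 1) with 1 in Htail.
  rewrite cpow_base_1, Rpower_base_1, Rmult_1_r, Rmult_1_l in Htail.
  replace (0 - (0 + 1 * 1))%C with (- (1))%C in Htail by ring.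
  rewrite Cmod_opp, Cmod_1 in Htail.
  assert (/ (Re s - 1) < / 1) by (apply Rinv_lt_contravar; lra). rewrite Rinv_1 in *. lra.
Qed.

Lemma csum_vonMangoldt_convolution s N :
  csum (fun d => dirichlet_term vonMangoldt s d * csum (fun n => cpow (INR n) (- s)%C) (N / d))%C N =
  csum (dirichlet_term (fun n => ln (INR n)) s) N.
Proof.
  transitivity (csum (fun n => csum (fun d => if dividesb d n
    then dirichlet_term vonMangoldt s d * cpow (INR (n / d)) (- s) else 0)%C N) N).
  - rewrite csum_swap. apply csum_ext. intros d Hd.
    rewrite (csum_multiples
      (fun n => dirichlet_term vonMangoldt s d * cpow (INR (n / d)) (- s))%C d) by lia.
    rewrite <- csum_scal. apply csum_ext. intros m _. do 3 f_equal.
    rewrite Nat.mul_comm. symmetry. apply Nat.div_mul. lia.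
  - apply csum_ext. intros n Hn. unfold dirichlet_term at 2.
    rewrite <- (sum_divisors_vonMangoldt N n Hn), <- csum_RtoC, Cmult_comm, <- csum_scal.
    apply csum_ext. intros d Hd.
    destruct (dividesb d n) eqn:Hdn; [|ring].
    apply dividesb_divide in Hdn. destruct Hdn as [m ->].
    assert (m <> 0%nat) by lia.
    rewrite Nat.div_mul, mult_INR, cpow_mult_base by (lia || apply lt_0_INR; lia).
    unfold dirichlet_term. ring.
Qed.

Lemma dirichlet_ln s : 1 < Re s ->
  dirichlet (fun n => ln (INR n)) s = (dirichlet vonMangoldt s * zeta s)%C.
Proof.
  intros Hs. set (p := (Re s - 1) / 3). assert (Hp : 0 < p) by (unfold p; lra).
  apply (clim_unique (csum (dirichlet_term (fun n => ln (INR n)) s))).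
  - apply (clim_dirichlet _ p); [now apply power_bounded_ln|unfold p; lra].
  - destruct (power_bounded_vonMangoldt p Hp) as (K & _ & HK).
    eapply clim_ext; [intros N _; apply csum_vonMangoldt_convolution|].
    rewrite <- (cseries_unique _ _ (clim_zeta s Hs)).
    apply (clim_dirichlet_convolution _ _ K 1 p Hp); intros n Hn.
    + replace (- (2 * p) - 1) with (p - Re s) by (unfold p; field).
      apply dirichlet_term_bound; [easy|now apply HK].
    + rewrite cpow_Cmod, re_opp, Rmult_1_l. apply Rle_Rpower; [now apply INR_ge1|unfold p; lra].
Qed.

Lemma abel_series_Epsi theta s : power_bounded Epsi theta -> theta <= 1 -> 1 < Re s ->
  abel_series Epsi s = (dirichlet vonMangoldt s - zeta s)%C.
Proof.
  intros HE Hth Hs.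
  apply (abel_series_eq Epsi (fun n => vonMangoldt n - 1) theta); [exact Epsi_rsum|easy|lra|lra|].
  set (e := (Re s - 1) / 2).
  eapply clim_ext; [|apply clim_minus;
    [apply (clim_dirichlet vonMangoldt e)|apply (clim_dirichlet (fun _ => 1) 0)]].
  - intros N _. cbv beta. rewrite <- csum_minus. apply csum_ext. intros n _.
    unfold dirichlet_term. rewrite RtoC_minus. ring.
  - apply power_bounded_vonMangoldt. unfold e. lra.
  - unfold e. lra.
  - apply power_bounded_const.
  - lra.
Qed.

(* [- (s - 1) xi' / xi], expressed through [xi] and [psi(n) - n] by means of
   [zeta' / zeta = - (abel_series Epsi + zeta)] and [xi = (s - 1) zeta]. *)
Definition xi_rate (s : C) : C := (xi s - 1 + (s - 1) * abel_series Epsi s)%C.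

Lemma canalytic_sub_RtoC r (z : C) : canalytic_on r (fun t => z - RtoC t)%C.
Proof. apply canalytic_minus; [apply canalytic_const|apply canalytic_RtoC, analytic_id]. Qed.

Lemma canalytic_xi_rate theta s : power_bounded Epsi theta -> 0 <= theta ->
  canalytic_on (Re s - theta) (fun t => xi_rate (s - RtoC t)%C).
Proof.
  intros HE Hth. apply canalytic_plus; [apply canalytic_minus|apply canalytic_mult].
  - apply (canalytic_le (Re s)); [lra|apply canalytic_xi].
  - apply canalytic_const.
  - apply canalytic_minus; [apply canalytic_sub_RtoC|apply canalytic_const].
  - now apply canalytic_abel_series.
Qed.

Lemma cderiv_xi_right s t : Rabs t < Re s - 1 ->
  cderiv (fun t => xi (s - RtoC t)%C) t
    ((s - RtoC t - 1) * (dirichlet vonMangoldt (s - RtoC t) * zeta (s - RtoC t)) - zeta (s - RtoC t))%C.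
Proof.
  intros Ht.
  assert (Hre : forall u, Rabs u < Re s - 1 -> 1 < Re (s - RtoC u)%C).
  { intros u Hu. apply Rabs_lt_between in Hu. rewrite re_minus, re_RtoC. lra. }
  apply (cderiv_ext_loc (fun t => (s - RtoC t - 1) * zeta (s - RtoC t))%C).
  - apply (locally_Rabs_lt (Re s - 1)); [easy|]. intros u Hu. now rewrite xi_zeta by now apply Hre.
  - rewrite <- dirichlet_ln by now apply Hre.
    replace ((s - RtoC t - 1) * dirichlet (fun n => ln (INR n)) (s - RtoC t) - zeta (s - RtoC t))%C
      with ((0 - RtoC 1 - 0) * zeta (s - RtoC t) +
        (s - RtoC t - 1) * dirichlet (fun n => ln (INR n)) (s - RtoC t))%C by ring.
    apply (cderiv_mult (fun t => s - RtoC t - 1)%C (fun t => zeta (s - RtoC t)%C)).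
    + apply cderiv_minus; [apply cderiv_minus|]; try apply cderiv_const.
      apply cderiv_RtoC, (is_derive_id (K := R_AbsRing)).
    + replace (dirichlet (fun n => ln (INR n)) (s - RtoC t)%C)
        with (dirichlet (fun n => 1 * ln (INR n)) (s - RtoC t)%C).
      * apply (cderiv_dirichlet _ 0); [apply power_bounded_const|lra].
      * apply cseries_ext. intros n _. unfold dirichlet_term. now rewrite Rmult_1_l.
Qed.

(* The differential equation is known near [t = 0], where the Dirichlet series converge; both
   sides are power series on the larger interval. *)
Lemma xi_ode theta s : power_bounded Epsi theta -> 0 <= theta <= 1 -> 1 < Re s ->
  exists dxi, forall t, Rabs t < Re s - theta ->
    cderiv (fun t => xi (s - RtoC t)%C) t (dxi t) /\
    ((s - RtoC t - 1) * dxi t = xi (s - RtoC t) * xi_rate (s - RtoC t))%C.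
Proof.
  intros HE Hth Hs. set (r := Re s - theta).
  assert (Hxi : canalytic_on r (fun t => xi (s - RtoC t)%C)).
  { apply (canalytic_le (Re s)); [unfold r; lra|apply canalytic_xi]. }
  destruct (canalytic_cderiv r _ Hxi) as (dxi & Hdxi & Hder).
  exists dxi. intros t Ht. split; [now apply Hder|].
  revert t Ht. apply (canalytic_identity r (Re s - 1)); [| |unfold r; lra|].
  - apply canalytic_mult; [|easy].
    apply canalytic_minus; [apply canalytic_sub_RtoC|apply canalytic_const].
  - apply canalytic_mult; [easy|]. apply canalytic_xi_rate; [easy|lra].
  - intros t Ht.
    assert (Hre : 1 < Re (s - RtoC t)%C)
      by (apply Rabs_lt_between in Ht; rewrite re_minus, re_RtoC; lra).
    rewrite (cderiv_unique _ _ _ _ (Hder t ltac:(unfold r; lra)) (cderiv_xi_right s t Ht)).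
    unfold xi_rate. rewrite (abel_series_Epsi theta), xi_zeta by (easy || lra). ring.
Qed.

Lemma xi_neq0 theta s : power_bounded Epsi theta -> 0 <= theta <= 1 -> theta < Re s -> Im s <> 0 ->
  xi s <> 0%C.
Proof.
  intros HE Hth Hs Him Hzero. set (s0 := (s + RtoC 3)%C).
  assert (Hre : Re s0 = Re s + 3) by apply re_plus.
  assert (Him0 : Im s0 = Im s) by (unfold s0; rewrite im_plus, im_RtoC; ring).
  destruct (xi_ode theta s0 HE Hth ltac:(lra)) as (dxi & Hdxi).
  destruct (canalytic_bounded _ _ 0 3 (canalytic_xi_rate theta s0 HE (proj1 Hth)) ltac:(lra) ltac:(lra))
    as [B HB].
  apply (zeta_neq0 s0); [lra|].
  assert (Hpole : forall t, Rabs (Im s) <= Cmod (s0 - RtoC t - 1)).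
  { intros t. replace (Im s) with (Im (s0 - RtoC t - 1)%C); [apply im_le_Cmod|].
    rewrite !im_minus, !im_RtoC, Him0. ring. }
  pose proof (Rabs_pos_lt _ Him) as Hg.
  assert (Hpole0 : (s0 - 1)%C <> 0%C).
  { apply Cmod_gt_0. eapply Rlt_le_trans; [exact Hg|].
    replace (s0 - 1)%C with (s0 - RtoC 0 - 1)%C by ring. apply Hpole. }
  assert (Hxi0 : xi (s0 - RtoC 0)%C = 0%C).
  { apply (cderiv_gronwall (fun t => xi (s0 - RtoC t)%C) dxi (B / Rabs (Im s)) 0 3); [lra| |].
    - intros t Ht. destruct (Hdxi t ltac:(rewrite Rabs_pos_eq; lra)) as [Hder Hode].
      split; [easy|]. unfold Rdiv. rewrite Rmult_assoc, (Rmult_comm (/ _)), <- Rmult_assoc.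
      apply Rle_div_r; [easy|]. apply Rle_trans with (Cmod (s0 - RtoC t - 1) * Cmod (dxi t)).
      + rewrite Rmult_comm. apply Rmult_le_compat_r; [apply Cmod_ge_0|apply Hpole].
      + rewrite <- Cmod_mult, Hode, Cmod_mult, Rmult_comm.
        apply Rmult_le_compat_r; [apply Cmod_ge_0|now apply HB].
    - replace (s0 - RtoC 3)%C with s by (unfold s0; ring). easy. }
  replace (s0 - RtoC 0)%C with s0 in Hxi0 by ring. rewrite xi_zeta in Hxi0 by lra.
  replace (zeta s0) with ((s0 - 1) * zeta s0 / (s0 - 1))%C by (field; easy).
  rewrite Hxi0. field. easy.
Qed.

(** * The Fourier series of a quadratic sawtooth *)

Definition sine_square (y : R) : R := (sin (PI * y) / PI) ^ 2.

Lemma sine_square_ge0 y : 0 <= sine_square y.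
Proof. apply pow2_ge_0. Qed.

Lemma PI_gt_1 : 1 < PI.
Proof. pose proof PI2_1. lra. Qed.

Lemma sine_square_le1 y : sine_square y <= 1.
Proof.
  unfold sine_square. pose proof PI_gt_1. pose proof (SIN_bound (PI * y)).
  rewrite <- (pow1 2). apply pow_maj_Rabs, Rabs_le.
  split; [apply Rle_div_r|apply Rle_div_l]; lra.
Qed.

Lemma Rabs_sin_le x : 0 <= x -> Rabs (sin x) <= x.
Proof.
  intros [Hx| <-]; [|rewrite sin_0, Rabs_R0; lra].
  pose proof PI_gt_1. pose proof (SIN_bound x). pose proof (sin_lt_x x Hx).
  apply Rabs_le. split; [|lra].
  destruct (Rle_dec x 1); [|lra]. pose proof (sin_ge_0 x ltac:(lra) ltac:(lra)). lra.
Qed.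

Lemma sine_square_le_sqr y : 0 <= y -> sine_square y <= y ^ 2.
Proof.
  intros Hy. pose proof PI_RGT_0. unfold sine_square. apply pow_maj_Rabs.
  unfold Rdiv. rewrite Rabs_mult, (Rabs_pos_eq (/ PI)) by (left; now apply Rinv_0_lt_compat).
  apply Rle_div_l; [easy|]. rewrite Rmult_comm. apply Rabs_sin_le. nra.
Qed.

Lemma sine_square_le_Rpower y e : 0 < y -> 0 <= e <= 2 -> sine_square y <= Rpower y e.
Proof.
  intros Hy He. destruct (Rle_dec y 1) as [h|h].
  - eapply Rle_trans; [apply sine_square_le_sqr; lra|].
    rewrite <- (Rpower_pow 2 y Hy). apply Rpower_le_anti_r; simpl; lra.
  - eapply Rle_trans; [apply sine_square_le1|].
    rewrite <- (Rpower_O y Hy). apply Rle_Rpower; lra.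
Qed.

Lemma sin_PI_INR n : sin (PI * INR n) = 0.
Proof. apply sin_eq_0_1. exists (Z.of_nat n). rewrite INR_IZR_INZ. ring. Qed.

Lemma sine_square_minus_INR y n : sine_square (y - INR n) = sine_square y.
Proof.
  unfold sine_square. rewrite Rmult_minus_distr_l, sin_minus, sin_PI_INR.
  assert (Hcos : cos (PI * INR n) ^ 2 = 1).
  { pose proof (sin2_cos2 (PI * INR n)) as H. rewrite sin_PI_INR in H. unfold Rsqr in H. lra. }
  rewrite Rmult_0_r, Rminus_0_r. unfold Rdiv. rewrite !Rpow_mult_distr, Hcos. ring.
Qed.

Definition fejer_term (x : R) (n : nat) : R := sine_square (INR n * x) / INR n ^ 2.

Definition fejer_sum (x : R) : R := Series (fun n => fejer_term x (S n)).

Lemma fejer_term_ge0 x n : 0 <= fejer_term x n.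
Proof.
  apply Rmult_le_pos; [apply sine_square_ge0|].
  destruct n as [|n]; [simpl; rewrite Rmult_0_l, Rinv_0; lra|].
  left. apply Rinv_0_lt_compat, pow_lt, INR_S_pos.
Qed.

Lemma fejer_term_minus_INR x j n : fejer_term (x - INR j) n = fejer_term x n.
Proof.
  unfold fejer_term. f_equal. rewrite Rmult_minus_distr_l, <- mult_INR. apply sine_square_minus_INR.
Qed.

Lemma fejer_term_le x n : (1 <= n)%nat -> Rabs (fejer_term x n) <= 1 * Rpower (INR n) (- (1) - 1).
Proof.
  intros Hn. assert (Hp : 0 < INR n) by (apply lt_0_INR; lia).
  rewrite Rabs_pos_eq by apply fejer_term_ge0. unfold fejer_term, Rdiv.
  replace (- (1) - 1) with (- INR 2) by (simpl; ring). rewrite Rpower_Ropp, Rpower_pow by easy.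
  apply Rmult_le_compat_r; [left; apply Rinv_0_lt_compat, pow_lt; easy|apply sine_square_le1].
Qed.

Lemma fejer_term_le_sqrt x n : 0 < x -> (1 <= n)%nat ->
  Rabs (fejer_term x n) <= Rpower x (1 / 2) * Rpower (INR n) (- (1 / 2) - 1).
Proof.
  intros Hx Hn. assert (Hp : 0 < INR n) by (apply lt_0_INR; lia).
  rewrite Rabs_pos_eq by apply fejer_term_ge0. unfold fejer_term, Rdiv at 1.
  replace (- (1 / 2) - 1) with (1 / 2 + - INR 2) by (simpl; field).
  rewrite Rpower_plus, Rpower_Ropp, Rpower_pow, <- Rmult_assoc by easy.
  apply Rmult_le_compat_r; [left; apply Rinv_0_lt_compat, pow_lt; easy|].
  rewrite Rpower_mult_distr, (Rmult_comm x) by easy.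
  apply sine_square_le_Rpower; [now apply Rmult_lt_0_compat|lra].
Qed.

Lemma is_lim_seq_fejer_sum x : is_lim_seq (rsum (fejer_term x)) (fejer_sum x).
Proof. apply (is_lim_seq_rsum_Series _ 1 1); [lra|]. intros. now apply fejer_term_le. Qed.

Lemma fejer_sum_small x : 0 < x -> Rabs (fejer_sum x) <= 3 * Rpower x (1 / 2).
Proof.
  intros Hx. replace (3 * Rpower x (1 / 2)) with (Rpower x (1 / 2) * (1 + / (1 / 2))) by field.
  apply Series_Rabs_bound; [lra|]. intros. now apply fejer_term_le_sqrt.
Qed.

Lemma dirichlet_kernel N x :
  sin (PI * x) * (1 + 2 * rsum (fun n => cos (2 * (PI * INR n * x))) N) =
    sin ((2 * INR N + 1) * PI * x).
Proof.
  induction N as [|N IH].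
  - simpl rsum. simpl INR. replace ((2 * 0 + 1) * PI * x) with (PI * x) by ring. ring.
  - cbn [rsum].
    replace (sin (PI * x) * (1 + 2 * (rsum (fun n => cos (2 * (PI * INR n * x))) N +
        cos (2 * (PI * INR (S N) * x)))))
      with (sin (PI * x) * (1 + 2 * rsum (fun n => cos (2 * (PI * INR n * x))) N) +
        2 * sin (PI * x) * cos (2 * (PI * INR (S N) * x))) by ring.
    rewrite IH. rewrite S_INR.
    replace ((2 * INR N + 1) * PI * x) with (2 * (PI * (INR N + 1) * x) - PI * x) by ring.
    replace ((2 * (INR N + 1) + 1) * PI * x) with (2 * (PI * (INR N + 1) * x) + PI * x) by ring.
    rewrite sin_minus, sin_plus. ring.
Qed.

Lemma is_derive_rsum (f df : nat -> R -> R) N x :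
  (forall n, (1 <= n <= N)%nat -> is_derive (f n) x (df n x)) ->
  is_derive (fun x => rsum (fun n => f n x) N) x (rsum (fun n => df n x) N).
Proof.
  induction N as [|N IH]; intros H; cbn [rsum].
  - exact (is_derive_const (K := R_AbsRing) (V := R_NormedModule) 0 x).
  - apply (is_derive_plus (fun x => rsum (fun n => f n x) N) (f (S N))).
    + apply IH. intros; apply H; lia.
    + apply H. lia.
Qed.

Definition parabola_err (N : nat) (x : R) : R := x / 2 - x ^ 2 / 2 - rsum (fejer_term x) N.

Definition sawtooth_err (N : nat) (x : R) : R :=
  1 / 2 - x - rsum (fun n => / (PI * INR n) * sin (2 * (PI * INR n * x))) N.

Lemma is_derive_parabola_err N x : is_derive (parabola_err N) x (sawtooth_err N x).
Proof.
  apply (is_derive_minus (fun x => x / 2 - x ^ 2 / 2) (fun x => rsum (fejer_term x) N)).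
  - auto_derive; [easy|]. field.
  - apply (is_derive_rsum (fun n x => fejer_term x n)
      (fun n x => / (PI * INR n) * sin (2 * (PI * INR n * x)))).
    intros n Hn. unfold fejer_term, sine_square.
    pose proof PI_RGT_0. assert (0 < INR n) by (apply lt_0_INR; lia).
    auto_derive; [easy|]. rewrite sin_2a, !(Rmult_assoc PI). field. lra.
Qed.

Lemma is_derive_sawtooth_err N x : is_derive (sawtooth_err N) x
  (- (1 + 2 * rsum (fun n => cos (2 * (PI * INR n * x))) N)).
Proof.
  replace (- (1 + 2 * rsum (fun n => cos (2 * (PI * INR n * x))) N))
    with (-1 - rsum (fun n => 2 * cos (2 * (PI * INR n * x))) N) by (rewrite rsum_scal; ring).
  apply (is_derive_minus (fun x => 1 / 2 - x)).
  - auto_derive; [easy|ring].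
  - apply (is_derive_rsum (fun n x => / (PI * INR n) * sin (2 * (PI * INR n * x)))
      (fun n x => 2 * cos (2 * (PI * INR n * x)))).
    intros n Hn. pose proof PI_RGT_0. assert (0 < INR n) by (apply lt_0_INR; lia).
    auto_derive; [easy|]. field. lra.
Qed.

(* The boundary term of an integration by parts: adding it to [sawtooth_err] replaces the
   derivative [- sin ((2 N + 1) pi x) / sin (pi x)] by one of size [1 / (2 N + 1)]. *)
Definition kernel_boundary (N : nat) (x : R) : R :=
  - cos ((2 * INR N + 1) * PI * x) / ((2 * INR N + 1) * PI * sin (PI * x)).

Lemma is_derive_sawtooth_err_boundary N x : 0 < sin (PI * x) ->
  is_derive (fun y => sawtooth_err N y + kernel_boundary N y) x
    (cos ((2 * INR N + 1) * PI * x) * cos (PI * x) / ((2 * INR N + 1) * sin (PI * x) ^ 2)).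
Proof.
  intros Hsin. pose proof PI_RGT_0. pose proof (pos_INR N).
  set (k := 2 * INR N + 1). assert (Hk : 0 < k) by (unfold k; lra).
  replace (cos (k * PI * x) * cos (PI * x) / (k * sin (PI * x) ^ 2)) with
    (- (1 + 2 * rsum (fun n => cos (2 * (PI * INR n * x))) N) +
      (sin (k * PI * x) / sin (PI * x) +
        cos (k * PI * x) * (PI * cos (PI * x)) / (k * PI * (sin (PI * x)) ^ 2))).
  - apply (is_derive_plus (sawtooth_err N) (kernel_boundary N)); [apply is_derive_sawtooth_err|].
    unfold kernel_boundary. fold k. auto_derive.
    + apply Rgt_not_eq, Rmult_lt_0_compat; [now apply Rmult_lt_0_compat|easy].
    + field. repeat split; lra.
  - unfold k at 1. rewrite <- dirichlet_kernel. field. repeat split; lra.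
Qed.

Lemma sawtooth_err_half N : sawtooth_err N (1 / 2) + kernel_boundary N (1 / 2) = 0.
Proof.
  unfold sawtooth_err, kernel_boundary.
  replace (cos ((2 * INR N + 1) * PI * (1 / 2))) with 0.
  - rewrite rsum_zero; [unfold Rdiv; ring|]. intros n Hn.
    replace (2 * (PI * INR n * (1 / 2))) with (PI * INR n) by field. rewrite sin_PI_INR. ring.
  - symmetry. apply cos_eq_0_1. exists (Z.of_nat N). rewrite INR_IZR_INZ. field.
Qed.

Lemma sin_PI_lower d x : 0 < d <= 1 / 2 -> d <= x <= 1 - d -> sin (PI * d) <= sin (PI * x).
Proof.
  intros Hd Hx. pose proof PI_RGT_0 as HPI.
  destruct (Rle_dec x (1 / 2)) as [h|h].
  - apply sin_incr_1; nra.
  - replace (sin (PI * x)) with (sin (PI * (1 - x))).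
    + apply sin_incr_1; nra.
    + replace (PI * (1 - x)) with (PI - PI * x) by ring. apply sin_PI_x.
Qed.

Lemma Rabs_cos_le1 x : Rabs (cos x) <= 1.
Proof. apply Rabs_le, COS_bound. Qed.

Lemma sawtooth_err_bound N d x : 0 < d <= 1 / 2 -> d <= x <= 1 - d ->
  Rabs (sawtooth_err N x) <= 2 / sin (PI * d) ^ 2 * / (2 * INR N + 1).
Proof.
  intros Hd Hx. pose proof PI_gt_1. pose proof (pos_INR N).
  set (m := sin (PI * d)). assert (Hm : 0 < m) by (apply sin_gt_0; nra).
  assert (Hm1 : m <= 1) by apply SIN_bound.
  set (k := 2 * INR N + 1). assert (Hk : 0 < k) by (unfold k; lra).
  assert (Hsin : forall y, d <= y <= 1 - d -> m <= sin (PI * y)) by (intros; now apply sin_PI_lower).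
  assert (Hm2 : 0 < m ^ 2) by now apply pow_lt.
  set (E := / m ^ 2 * / k).
  assert (HE : 0 < E) by (apply Rmult_lt_0_compat; now apply Rinv_0_lt_compat).
  assert (Hquot : forall u v, Rabs u <= 1 -> k * m ^ 2 <= v -> Rabs (u / v) <= E).
  { intros u v Hu Hv. assert (0 < k * m ^ 2) by now apply Rmult_lt_0_compat.
    unfold E. rewrite <- Rinv_mult, (Rmult_comm (m ^ 2)), <- (Rmult_1_l (/ _)).
    unfold Rdiv. rewrite Rabs_mult, (Rabs_pos_eq (/ v)) by (left; apply Rinv_0_lt_compat; lra).
    apply Rmult_le_compat; [apply Rabs_pos|left; apply Rinv_0_lt_compat; lra|easy|].
    now apply Rinv_le_contravar. }
  assert (Hsum : Rabs (sawtooth_err N x + kernel_boundary N x) <= E).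
  { rewrite <- (Rminus_0_r (_ + _)), <- (sawtooth_err_half N).
    eapply Rle_trans.
    - apply (bounded_variation (fun y => sawtooth_err N y + kernel_boundary N y)
        (fun y => cos (k * PI * y) * cos (PI * y) / (k * sin (PI * y) ^ 2)) E (1 / 2) x).
      intros y Hy. assert (Hyd : d <= y <= 1 - d).
      { assert (Rabs (x - 1 / 2) <= 1 / 2 - d) by (apply Rabs_le; lra).
        assert (Hy' : Rabs (y - 1 / 2) <= 1 / 2 - d) by lra. apply Rabs_le_between in Hy'. lra. }
      specialize (Hsin y Hyd). split.
      + apply is_derive_sawtooth_err_boundary. lra.
      + apply Hquot.
        * rewrite Rabs_mult, <- (Rmult_1_l 1).
          apply Rmult_le_compat; auto using Rabs_pos, Rabs_cos_le1.
        * apply Rmult_le_compat_l; [lra|]. apply pow_incr. lra.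
    - assert (Rabs (x - 1 / 2) <= 1) by (apply Rabs_le; lra).
      pose proof (Rabs_pos (x - 1 / 2)). nra. }
  assert (Hboundary : Rabs (kernel_boundary N x) <= E).
  { apply Hquot; [rewrite Rabs_Ropp; apply Rabs_cos_le1|]. fold k. specialize (Hsin x Hx).
    rewrite (Rmult_assoc k). apply Rmult_le_compat_l; [lra|]. nra. }
  replace (sawtooth_err N x)
    with ((sawtooth_err N x + kernel_boundary N x) + - kernel_boundary N x) by ring.
  eapply Rle_trans; [apply Rabs_triang|]. rewrite Rabs_Ropp.
  replace (2 / m ^ 2 * / k) with (E + E) by (unfold E, Rdiv; ring). lra.
Qed.

Lemma fejer_sum_sub_parabola_const x : 0 < x < 1 ->
  x / 2 - x ^ 2 / 2 - fejer_sum x = (1 / 2) / 2 - (1 / 2) ^ 2 / 2 - fejer_sum (1 / 2).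
Proof.
  intros Hx. set (d := Rmin x (1 - x)).
  assert (Hdx : d <= x <= 1 - d)
    by (pose proof (Rmin_l x (1 - x)); pose proof (Rmin_r x (1 - x)); unfold d; lra).
  assert (Hd : 0 < d <= 1 / 2) by (split; [apply Rmin_glb_lt|]; lra).
  set (K := 2 / sin (PI * d) ^ 2).
  assert (HK : 0 <= K).
  { apply Rdiv_le_0_compat; [lra|]. apply pow_lt, sin_gt_0; pose proof PI_RGT_0; nra. }
  assert (Hlim : forall y, is_lim_seq (fun N => parabola_err N y) (y / 2 - y ^ 2 / 2 - fejer_sum y)).
  { intros y. apply is_lim_seq_minus'; [apply is_lim_seq_const|apply is_lim_seq_fejer_sum]. }
  assert (H0 : is_lim_seq (fun N => parabola_err N x - parabola_err N (1 / 2)) 0).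
  { apply is_lim_seq_abs_0.
    apply (is_lim_seq_le_le_loc (fun _ => 0) _ (fun N => K * / INR N));
      [|apply is_lim_seq_const|apply is_lim_seq_inv_INR].
    exists 1%nat. intros N HN. split; [apply Rabs_pos|]. pose proof (INR_ge1 N HN).
    assert (Hx2 : Rabs (x - 1 / 2) <= 1 / 2 - d) by (apply Rabs_le; lra).
    apply Rle_trans with (K * / (2 * INR N + 1) * Rabs (x - 1 / 2)).
    - apply (bounded_variation (parabola_err N) (sawtooth_err N)).
      intros y Hy. split; [apply is_derive_parabola_err|].
      apply sawtooth_err_bound; [easy|]. apply (Rle_trans _ _ _ Hy), Rabs_le_between in Hx2. lra.
    - rewrite Rmult_assoc. apply Rmult_le_compat_l; [easy|].
      assert (/ (2 * INR N + 1) <= / INR N) by (apply Rinv_le_contravar; lra).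
      pose proof (Rabs_pos (x - 1 / 2)).
      assert (0 < / (2 * INR N + 1)) by (apply Rinv_0_lt_compat; lra). nra. }
  pose proof (eq_trans (eq_sym (is_lim_seq_unique _ _
    (is_lim_seq_minus' _ _ _ _ (Hlim x) (Hlim (1 / 2)))))
    (is_lim_seq_unique _ _ H0)) as Heq.
  injection Heq. lra.
Qed.

Lemma fejer_sum_unit x : 0 <= x <= 1 -> fejer_sum x = x / 2 - x ^ 2 / 2.
Proof.
  intros Hx.
  assert (Hend : forall j, fejer_sum (INR j) = 0).
  { intros j. apply is_series_unique, (is_series_rsum (fejer_term (INR j))).
    apply (is_lim_seq_ext (fun _ => 0)); [|apply is_lim_seq_const].
    intros N. symmetry. apply rsum_zero. intros n _. unfold fejer_term, sine_square.
    rewrite <- mult_INR, sin_PI_INR. unfold Rdiv. ring. }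
  destruct (Req_dec x 0) as [->|Hx0]; [transitivity 0; [exact (Hend 0%nat)|field]|].
  destruct (Req_dec x 1) as [->|Hx1]; [transitivity 0; [exact (Hend 1%nat)|field]|].
  enough (Herr : Rabs (x / 2 - x ^ 2 / 2 - fejer_sum x) <= 0).
  { apply Rabs_le_between in Herr. lra. }
  apply (le_0_of_Rpower_bound _ 4 (1 / 2) (1 / 2)); [lra|lra|].
  intros a Ha. rewrite fejer_sum_sub_parabola_const, <- (fejer_sum_sub_parabola_const a) by lra.
  pose proof (fejer_sum_small a (proj1 Ha)) as Hsmall.
  pose proof (Rpower_le_anti_r a (1 / 2) 1 ltac:(lra) ltac:(lra)) as Ha1.
  rewrite Rpower_1 in Ha1 by lra. apply Rabs_le_between in Hsmall. apply Rabs_le. nra.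
Qed.

Lemma fejer_sum_sawtooth x j : INR j <= x <= INR j + 1 ->
  fejer_sum x = x / 2 - (x ^ 2 / 2 - INR j * x + INR j * (INR j + 1) / 2).
Proof.
  intros Hx. replace (fejer_sum x) with (fejer_sum (x - INR j)).
  - rewrite fejer_sum_unit by lra. field.
  - apply Series_ext. intros n. apply fejer_term_minus_INR.
Qed.

(** * Symmetry of the zeros *)

Lemma ex_primitive_pos (f : R -> R) : (forall y, 0 < y -> continuous f y) ->
  exists F : R -> R, forall y, 0 < y -> is_derive F y (f y).
Proof.
  intros Hf. exists (fun y => RInt f 1 y). intros y Hy.
  apply (is_derive_RInt f (fun y => RInt f 1 y) 1); [|now apply Hf].
  apply (filter_imp (fun x => 0 < x)); [|exact (open_gt 0 y Hy)].
  intros x Hx. apply (RInt_correct f), (ex_RInt_continuous f). intros z Hz. apply Hf.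
  eapply Rlt_le_trans; [|exact (proj1 Hz)]. apply Rmin_glb_lt; lra.
Qed.

Lemma ex_tail_primitive (f : R -> C) (e : R) : 0 < e ->
  (forall y, 0 < y -> continuous (fun y => Re (f y)) y /\ continuous (fun y => Im (f y)) y) ->
  (forall y, 0 < y -> Cmod (f y) <= Rpower y (- e - 1)) ->
  exists F : R -> C, forall y, 0 < y -> cderiv F y (- f y)%C /\ Cmod (F y) <= / e * Rpower y (- e).
Proof.
  intros He Hc Hb.
  destruct (ex_primitive_pos (fun y => Re (f y)) (fun y Hy => proj1 (Hc y Hy))) as [G1 HG1].
  destruct (ex_primitive_pos (fun y => Im (f y)) (fun y Hy => proj2 (Hc y Hy))) as [G2 HG2].
  set (G := fun y => (G1 y, G2 y) : C).
  assert (HG : forall y, 0 < y -> cderiv G y (f y)).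
  { intros y Hy. split; [exact (HG1 y Hy)|exact (HG2 y Hy)]. }
  assert (Hcauchy : forall a b, 0 < a <= b -> Cmod (G b - G a) <= / e * Rpower a (- e)).
  { intros a b Hab. set (q := fun y => - / e * Rpower y (- e)).
    apply Rle_trans with (q b - q a).
    - apply (cderiv_compare G f q (fun y => Rpower y (- e - 1))); [lra|].
      intros t Ht. split; [apply HG; lra|split; [|apply Hb; lra]].
      replace (Rpower t (- e - 1)) with (- / e * (- e * Rpower t (- e - 1))) by (field; lra).
      apply (is_derive_scal (fun y => Rpower y (- e))), is_derive_Rpower. lra.
    - unfold q. pose proof (Rmult_lt_0_compat _ _ (Rinv_0_lt_compat e He) (Rpower_pos b (- e))). lra. }
  destruct (clim_of_cauchy_rate (fun n => G (INR (S n)))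
    (fun n => / e * Rpower (INR (S n)) (- e))) as [l Hl].
  { now apply is_lim_seq_scal_0, is_lim_seq_Rpower_neg_S. }
  { intros n m Hnm. apply Hcauchy. split; [apply INR_S_pos|apply le_INR; lia]. }
  exists (fun y => l - G y)%C. intros y Hy. split.
  - replace (- f y)%C with (0 - f y)%C by ring. apply cderiv_minus; [apply cderiv_const|now apply HG].
  - apply (clim_Cmod_le (fun n => G (INR (S n)) - G y)%C).
    + apply clim_minus; [exact Hl|apply clim_const].
    + destruct (nfloor_ex y ltac:(lra)) as [N [_ HN]]. exists N. intros n Hn.
      apply Hcauchy. apply le_INR in Hn. rewrite S_INR. lra.
Qed.

Lemma INR_mult_pos n x : 0 < x -> (1 <= n)%nat -> 0 < INR n * x.
Proof. intros Hx Hn. apply Rmult_lt_0_compat; [apply lt_0_INR; lia|easy]. Qed.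

Definition sine_kernel (w : C) (y : R) : C := (RtoC (sine_square y) * cpow y (- w - 2))%C.

Lemma sine_kernel_bound w y d : 0 < y -> 0 <= d <= 2 -> Cmod (sine_kernel w y) <= Rpower y (- Re w - d).
Proof.
  intros Hy Hd. unfold sine_kernel.
  rewrite Cmod_mult, cpow_Cmod, Cmod_R, Rabs_pos_eq, re_minus, re_opp, re_RtoC by apply sine_square_ge0.
  replace (- Re w - d) with ((2 - d) + (- Re w - 2)) by ring. rewrite Rpower_plus.
  apply Rmult_le_compat_r; [left; apply Rpower_pos|]. apply sine_square_le_Rpower; lra.
Qed.

Lemma sine_kernel_continuous w y : 0 < y ->
  continuous (fun y => Re (sine_kernel w y)) y /\ continuous (fun y => Im (sine_kernel w y)) y.
Proof.
  intros Hy. destruct w as [a b]. split.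
  - apply (ex_derive_continuous (fun y => Re (sine_kernel (a, b) y))).
    unfold sine_kernel, sine_square, cpow; simpl. auto_derive. repeat split; easy.
  - apply (ex_derive_continuous (fun y => Im (sine_kernel (a, b) y))).
    unfold sine_kernel, sine_square, cpow; simpl. auto_derive. repeat split; easy.
Qed.

Lemma cpow_mult_sine_kernel w y : (cpow y w * sine_kernel w y = sine_kernel 0 y)%C.
Proof.
  unfold sine_kernel. replace (- 0 - 2)%C with (w + (- w - 2))%C by ring. rewrite cpow_plus. ring.
Qed.

(* [Phi y] is the integral of [sine_kernel w] over [[y, +oo)]. *)
Definition is_sine_tail (w : C) (Phi : R -> C) : Prop :=
  forall y, 0 < y -> cderiv Phi y (- sine_kernel w y)%C /\ Cmod (Phi y) <= Rpower y (- (1 + Re w)).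

Lemma ex_sine_tail w : 0 <= Re w -> exists Phi, is_sine_tail w Phi.
Proof.
  intros Hw.
  destruct (ex_tail_primitive (sine_kernel w) (1 + Re w)) as [Phi HPhi]; [lra| | |].
  - intros y Hy. now apply sine_kernel_continuous.
  - intros y Hy. replace (- (1 + Re w) - 1) with (- Re w - 2) by ring. apply sine_kernel_bound; lra.
  - exists Phi. intros y Hy. destruct (HPhi y Hy) as [Hder Hbound]. split; [easy|].
    eapply Rle_trans; [exact Hbound|]. pose proof (Rpower_pos y (- (1 + Re w))).
    pose proof (Rinv_le_contravar 1 (1 + Re w) ltac:(lra) ltac:(lra)). rewrite Rinv_1 in *. nra.
Qed.

Lemma sine_tail_increment_bound w Phi x h d : is_sine_tail w Phi -> 0 < x -> 0 <= h -> 0 <= Re w ->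
  0 <= d <= 2 -> Cmod (Phi (x + h)%R - Phi x) <= Rpower x (- Re w - d) * h.
Proof.
  intros HPhi Hx Hh Hw Hd.
  replace (Rpower x (- Re w - d) * h) with (Rpower x (- Re w - d) * (x + h - x)) by ring.
  apply (cderiv_bound Phi (fun y => - sine_kernel w y)%C); [lra|].
  intros t Ht. split; [apply HPhi; lra|]. rewrite Cmod_opp.
  eapply Rle_trans; [apply (sine_kernel_bound w t d); lra|]. apply Rpower_le_anti_l; lra.
Qed.

Section MellinTransform.

Variables (w : C) (Phi : R -> C).
Hypothesis Hw : 0 < Re w < 1.
Hypothesis HPhi : is_sine_tail w Phi.

Lemma strip_neq0 : w <> 0%C /\ (w + 1)%C <> 0%C /\ (1 - w)%C <> 0%C.
Proof.
  repeat split; apply Re_neq0; rewrite ?re_plus, ?re_minus, ?re_RtoC; lra.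
Qed.

Lemma RtoC_2_neq0 : (1 + 1)%C <> 0%C.
Proof. rewrite <- RtoC_2. intros E. apply RtoC_inj in E. lra. Qed.

Definition mellin_tail_term (x : R) (n : nat) : C := (cpow (INR n) (w - 1)%C * Phi (INR n * x)%R)%C.

Definition mellin_tail_partial (N : nat) (x : R) : C :=
  (/ (2 * w) * cpow x (- w) - csum (mellin_tail_term x) N)%C.

(* With [U y] the integral of the fractional part over [[0, y]], this is the integral of
   [U(y) y^(-w-2)] over [[x, +oo)], expanded with the Fourier series of [U]. *)
Definition mellin_tail (x : R) : C := (/ (2 * w) * cpow x (- w) - cseries (mellin_tail_term x))%C.

Lemma mellin_tail_term_bound x n : 0 < x -> (1 <= n)%nat ->
  Cmod (mellin_tail_term x n) <= Rpower x (- (1 + Re w)) * Rpower (INR n) (- (1) - 1).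
Proof.
  intros Hx Hn. unfold mellin_tail_term. rewrite Cmod_mult, cpow_Cmod, re_minus, re_RtoC.
  destruct (HPhi (INR n * x)) as [_ Hbound]; [now apply INR_mult_pos|].
  rewrite <- Rpower_mult_distr in Hbound by (easy || (apply lt_0_INR; lia)).
  replace (- (1) - 1) with ((Re w - 1) + - (1 + Re w)) by ring. rewrite Rpower_plus.
  pose proof (Rmult_le_compat_l _ _ _ (Rlt_le _ _ (Rpower_pos (INR n) (Re w - 1))) Hbound). lra.
Qed.

Lemma clim_mellin_tail_partial x : 0 < x -> clim (fun N => mellin_tail_partial N x) (mellin_tail x).
Proof.
  intros Hx. apply clim_minus; [apply clim_const|].
  apply (clim_cseries _ (Rpower x (- (1 + Re w))) 1); [lra|]. intros. now apply mellin_tail_term_bound.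
Qed.

Lemma mellin_tail_bound x : 1 <= x ->
  Cmod (mellin_tail x) <= (Cmod (/ (2 * w)) + 2) * Rpower x (- Re w).
Proof.
  intros Hx. rewrite Rmult_plus_distr_r.
  apply Cmod_minus_le; [right; now rewrite Cmod_mult, cpow_Cmod, re_opp|].
  eapply Rle_trans; [apply (cseries_bound _ (Rpower x (- (1 + Re w))) 1); [lra|]|].
  - intros n Hn. apply mellin_tail_term_bound; [lra|easy].
  - pose proof (Rle_Rpower x (- (1 + Re w)) (- Re w) Hx ltac:(lra)). rewrite Rinv_1. lra.
Qed.

Lemma cderiv_mellin_tail_term x n : 0 < x -> (1 <= n)%nat ->
  cderiv (fun x => mellin_tail_term x n) x (- (cpow x (- w - 2) * RtoC (fejer_term x n)))%C.
Proof.
  intros Hx Hn. assert (Hp : 0 < INR n) by (apply lt_0_INR; lia).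
  replace (- (cpow x (- w - 2)%C * RtoC (fejer_term x n)))%C
    with (cpow (INR n) (w - 1)%C * (RtoC (INR n) * - sine_kernel w (INR n * x)%R))%C.
  - apply (cderiv_scal _ (fun x => Phi (INR n * x)%R)), (cderiv_comp Phi (fun x => INR n * x)).
    + now apply HPhi, Rmult_lt_0_compat.
    + auto_derive; [easy|ring].
  - unfold sine_kernel, fejer_term. rewrite cpow_mult_base by easy.
    assert (Hpow : (cpow (INR n) (w - 1) * RtoC (INR n) * cpow (INR n) (- w - 2) =
      RtoC (/ INR n ^ 2))%C).
    { rewrite <- (cpow_1 (INR n)), <- !cpow_plus by easy.
      replace (w - 1 + 1 + (- w - 2))%C with (RtoC (- INR 2)).
      - now rewrite cpow_RtoC, Rpower_Ropp, Rpower_pow.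
      - change (INR 2) with 2. rewrite RtoC_opp, RtoC_2. ring. }
    unfold Rdiv. rewrite RtoC_mult, <- Hpow. ring.
Qed.

Lemma cderiv_mellin_tail_partial N x : 0 < x ->
  cderiv (mellin_tail_partial N) x (cpow x (- w - 2) * RtoC (rsum (fejer_term x) N - x / 2))%C.
Proof.
  intros Hx. destruct strip_neq0 as (Hw_neq0 & _ & _).
  replace (cpow x (- w - 2)%C * RtoC (rsum (fejer_term x) N - x / 2))%C with
    (/ (2 * w) * (- w * cpow x (- w - 1)) -
      csum (fun n => - (cpow x (- w - 2) * RtoC (fejer_term x n))) N)%C.
  - apply (cderiv_minus (fun x => / (2 * w) * cpow x (- w))%C (fun x => csum (mellin_tail_term x) N)).
    + apply (cderiv_scal _ (fun x => cpow x (- w)%C)). now apply cderiv_cpow.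
    + apply (cderiv_csum (fun n x => mellin_tail_term x n)
        (fun n x => - (cpow x (- w - 2) * RtoC (fejer_term x n)))%C).
      intros n Hn. apply cderiv_mellin_tail_term; [easy|lia].
  - rewrite (csum_ext _ (fun n => - cpow x (- w - 2) * RtoC (fejer_term x n))%C) by (intros; ring).
    rewrite csum_scal, csum_RtoC, RtoC_minus, RtoC_div by lra.
    replace (- w - 1)%C with ((- w - 2) + 1)%C by (rewrite RtoC_2; ring).
    rewrite cpow_succ, RtoC_2 by easy. field. repeat split; (easy || apply RtoC_2_neq0).
Qed.

(* Primitive of [U(x) x^(-w-2)] on [[j, j + 1]], where [U(x) = j / 2 + (x - j)^2 / 2]. *)
Definition sawtooth_primitive (j x : R) : C :=
  (/ (2 * (1 - w)) * cpow x (1 - w) + RtoC j / w * cpow x (- w)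
   - RtoC (j * (j + 1) / 2) / (w + 1) * cpow x (- w - 1))%C.

Lemma cderiv_sawtooth_primitive j x : 0 < x ->
  cderiv (sawtooth_primitive j) x (cpow x (- w - 2) * RtoC (x ^ 2 / 2 - j * x + j * (j + 1) / 2))%C.
Proof.
  intros Hx. destruct strip_neq0 as (Hw_neq0 & Hw1_neq0 & H1w_neq0).
  replace (cpow x (- w - 2)%C * RtoC (x ^ 2 / 2 - j * x + j * (j + 1) / 2))%C with
    (/ (2 * (1 - w)) * ((1 - w) * cpow x (1 - w - 1)%C) + RtoC j / w * (- w * cpow x (- w - 1)%C)
     - RtoC (j * (j + 1) / 2) / (w + 1) * ((- w - 1) * cpow x (- w - 1 - 1)%C))%C.
  - unfold sawtooth_primitive. apply cderiv_minus; [apply cderiv_plus|];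
      apply (cderiv_scal _ (fun x => cpow x _)); now apply cderiv_cpow.
  - replace (1 - w - 1)%C with ((- w - 2) + 1 + 1)%C by (rewrite RtoC_2; ring).
    replace (- w - 1 - 1)%C with (- w - 2)%C by (rewrite RtoC_2; ring).
    replace (- w - 1)%C with ((- w - 2) + 1)%C at 1 by (rewrite RtoC_2; ring).
    rewrite !cpow_succ, RtoC_plus, RtoC_minus, RtoC_mult by easy.
    replace (RtoC (x ^ 2 / 2)) with (RtoC x * RtoC x / 2)%C
      by (rewrite <- RtoC_mult, <- RtoC_div; [f_equal; field|lra]).
    rewrite RtoC_2. field. repeat split; (easy || apply RtoC_2_neq0).
Qed.

Lemma fejer_rsum_tail x N : (1 <= N)%nat -> Rabs (rsum (fejer_term x) N - fejer_sum x) <= / INR N.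
Proof.
  intros HN. rewrite Rabs_minus_sym.
  pose proof (Series_rsum_tail (fejer_term x) 1 1 Rlt_0_1 (fun n => fejer_term_le x n) N HN) as Htail.
  rewrite Rinv_1, !Rmult_1_l, Rpower_Ropp, Rpower_1 in Htail by (apply lt_0_INR; lia). exact Htail.
Qed.

Lemma mellin_tail_increment j a b : 0 < a <= b -> INR j <= a -> b <= INR j + 1 ->
  (mellin_tail b - mellin_tail a = sawtooth_primitive (INR j) a - sawtooth_primitive (INR j) b)%C.
Proof.
  intros Hab Ha Hb.
  apply (clim_unique (fun N => mellin_tail_partial N b - mellin_tail_partial N a)%C).
  { apply clim_minus; apply clim_mellin_tail_partial; lra. }
  set (D := Rpower a (- Re w - 2)).
  apply (clim_squeeze _ _ (fun N => D * (b - a) * / INR N)); [apply is_lim_seq_inv_INR|].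
  intros N HN. set (f := fun x => (mellin_tail_partial N x + sawtooth_primitive (INR j) x)%C).
  match goal with |- Cmod ?e <= _ => replace e with (f b - f a)%C by (unfold f; ring) end.
  replace (D * (b - a) * / INR N) with (D * / INR N * (b - a)) by ring.
  apply (cderiv_bound f (fun x => cpow x (- w - 2) * RtoC (rsum (fejer_term x) N - x / 2) +
    cpow x (- w - 2) * RtoC (x ^ 2 / 2 - INR j * x + INR j * (INR j + 1) / 2))%C); [lra|].
  intros t Ht. split.
  - apply cderiv_plus; [apply cderiv_mellin_tail_partial|apply cderiv_sawtooth_primitive]; lra.
  - rewrite <- Cmult_plus_distr_l, <- RtoC_plus, Cmod_mult, cpow_Cmod, Cmod_R, re_minus,
      re_opp, re_RtoC.
    apply Rmult_le_compat; [left; apply Rpower_pos|apply Rabs_pos|apply Rpower_le_anti_l; lra|].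
    eapply Rle_trans; [|exact (fejer_rsum_tail t N HN)]. right. f_equal.
    rewrite (fejer_sum_sawtooth t j) by lra. ring.
Qed.

Lemma sawtooth_primitive_jump M :
  (sawtooth_primitive (INR (S M)) (INR (S M)) - sawtooth_primitive (INR M) (INR (S M)) =
   cpow (INR (S M)) (- w) / (w * (w + 1)))%C.
Proof.
  destruct strip_neq0 as (Hw_neq0 & Hw1_neq0 & H1w_neq0).
  unfold sawtooth_primitive. pose proof (INR_S_pos M). set (X := INR (S M)) in *.
  replace (INR M) with (X - 1) by (unfold X; rewrite S_INR; ring).
  replace (- w)%C with ((- w - 1) + 1)%C at 1 3 5 by ring.
  rewrite !RtoC_div, !RtoC_mult, !RtoC_plus, !RtoC_minus, cpow_succ, RtoC_2 by lra.
  field. repeat split; (easy || apply RtoC_2_neq0).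
Qed.

Definition sawtooth_primitive_sum (M : nat) : C :=
  (sawtooth_primitive (INR M) (INR (S M)) - csum (fun n => cpow (INR n) (- w)) M / (w * (w + 1)))%C.

Lemma mellin_tail_at_integers M a : 0 < a <= 1 ->
  (mellin_tail (INR (S M)) - mellin_tail a = sawtooth_primitive 0 a - sawtooth_primitive_sum M)%C.
Proof.
  intros Ha. destruct strip_neq0 as (Hw_neq0 & Hw1_neq0 & _).
  unfold sawtooth_primitive_sum. induction M as [|M IH].
  - rewrite (mellin_tail_increment 0) by (simpl; lra).
    cbn [csum]. simpl INR. field. split; easy.
  - pose proof (mellin_tail_increment (S M) (INR (S M)) (INR (S (S M)))) as Hstep.
    pose proof (S_INR (S M)). pose proof (INR_S_pos M).
    specialize (Hstep ltac:(lra) ltac:(lra) ltac:(lra)).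
    replace (mellin_tail (INR (S (S M))) - mellin_tail a)%C with
      ((mellin_tail (INR (S (S M))) - mellin_tail (INR (S M))) +
        (mellin_tail (INR (S M)) - mellin_tail a))%C by ring.
    rewrite Hstep, IH. cbn [csum].
    replace (sawtooth_primitive (INR (S M)) (INR (S M))) with
      (cpow (INR (S M)) (- w) / (w * (w + 1)) + sawtooth_primitive (INR M) (INR (S M)))%C
      by (rewrite <- sawtooth_primitive_jump; ring).
    field. split; easy.
Qed.

Lemma zeta_partial_sawtooth M :
  (zeta_partial w M = (1 - w) * w * (w + 1) *
     (sawtooth_primitive_sum M + (/ w - / (2 * (w + 1))) * cpow (INR (S M)) (- w)))%C.
Proof.
  destruct strip_neq0 as (Hw_neq0 & Hw1_neq0 & H1w_neq0).
  unfold sawtooth_primitive_sum, zeta_partial, sawtooth_primitive.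
  pose proof (INR_S_pos M). set (X := INR (S M)) in *.
  replace (INR M) with (X - 1) by (unfold X; rewrite S_INR; ring).
  assert (Hcpow : cpow X (- w)%C = (cpow X (- w - 1) * RtoC X)%C).
  { rewrite <- cpow_succ by easy. f_equal. ring. }
  assert (Hcpow1 : cpow X (1 - w)%C = (cpow X (- w - 1) * RtoC X * RtoC X)%C).
  { rewrite <- !cpow_succ by easy. f_equal. ring. }
  rewrite Hcpow, Hcpow1, !RtoC_div, !RtoC_mult, !RtoC_plus, !RtoC_minus, RtoC_2 by lra.
  field. repeat split; (easy || apply RtoC_2_neq0).
Qed.

(* The Mellin transform of [U] at [- w - 1] is [xi w] up to elementary factors; the second
   term is the part of the integral over [[0, a]]. *)
Lemma xi_mellin_tail a : 0 < a <= 1 ->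
  (xi w = (1 - w) * w * (w + 1) * (mellin_tail a + / (2 * (1 - w)) * cpow a (1 - w)))%C.
Proof.
  intros Ha.
  assert (Hfirst : sawtooth_primitive 0 a = (/ (2 * (1 - w)) * cpow a (1 - w))%C).
  { unfold sawtooth_primitive. replace (0 * (0 + 1) / 2) with 0 by field. unfold Cdiv. ring. }
  assert (Htail : clim (fun M => mellin_tail (INR (S M))) 0%C).
  { apply (clim_squeeze_0 _ (fun M => (Cmod (/ (2 * w)) + 2) * Rpower (INR (S M)) (- Re w))).
    - apply is_lim_seq_scal_0, is_lim_seq_Rpower_neg_S. lra.
    - intros M _. apply mellin_tail_bound, INR_S_ge1. }
  assert (Hcpow : clim (fun M => cpow (INR (S M)) (- w)%C) 0%C).
  { apply (clim_squeeze_0 _ (fun M => Rpower (INR (S M)) (- Re w))).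
    - apply is_lim_seq_Rpower_neg_S. lra.
    - intros M _. rewrite cpow_Cmod, re_opp. lra. }
  apply (clim_unique (zeta_partial w)); [apply clim_zeta_partial; lra|].
  apply (clim_ext (fun M => (1 - w) * w * (w + 1) * ((sawtooth_primitive 0 a + mellin_tail a)
     - mellin_tail (INR (S M)) + (/ w - / (2 * (w + 1))) * cpow (INR (S M)) (- w)))%C).
  - intros M _. rewrite zeta_partial_sawtooth. do 2 f_equal.
    transitivity (sawtooth_primitive 0 a - (mellin_tail (INR (S M)) - mellin_tail a))%C; [ring|].
    rewrite (mellin_tail_at_integers M a Ha). ring.
  - rewrite <- Hfirst.
    replace (mellin_tail a + sawtooth_primitive 0 a)%C with
      ((sawtooth_primitive 0 a + mellin_tail a) - 0 + (/ w - / (2 * (w + 1))) * 0)%C by ring.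
    apply clim_scal, clim_plus; [apply clim_minus; [apply clim_const|easy]|now apply clim_scal].
Qed.

End MellinTransform.

Section NearZero.

Variables (w : C) (Phi Phi0 : R -> C) (c : R).
Hypothesis Hw : 0 < Re w < 1.
Hypothesis HPhi : is_sine_tail w Phi.
Hypothesis HPhi0 : is_sine_tail 0 Phi0.
Hypothesis Hc : forall N, (1 <= N)%nat ->
  Cmod (csum (fun n => cpow (INR n) (w - 1)) N - cpow (INR N) w / w) <= c * Rpower (INR N) (Re w - 1).

Lemma sine_tail_0_bound y : 0 < y -> Cmod (Phi0 y) <= / y.
Proof.
  intros Hy. destruct (HPhi0 y Hy) as [_ Hbound].
  replace (- (1 + Re 0)) with (- (1)) in Hbound by (rewrite re_RtoC; ring).
  now rewrite Rpower_Ropp, Rpower_1 in Hbound.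
Qed.

Lemma csum_cpow_bound N : (1 <= N)%nat ->
  Cmod (csum (fun n => cpow (INR n) (w - 1)) N) <= (c + / Cmod w) * Rpower (INR N) (Re w).
Proof.
  intros HN. pose proof (INR_ge1 N HN). destruct (strip_neq0 w Hw) as (Hw_neq0 & _ & _).
  replace (csum (fun n => cpow (INR n) (w - 1)) N) with
    ((csum (fun n => cpow (INR n) (w - 1)) N - cpow (INR N) w / w) + cpow (INR N) w / w)%C by ring.
  rewrite Rmult_plus_distr_r.
  apply Cmod_plus_le; [|right; rewrite Cmod_div, cpow_Cmod by easy; apply Rmult_comm].
  eapply Rle_trans; [now apply Hc|]. apply Rmult_le_compat_l; [|apply Rle_Rpower; lra].
  specialize (Hc 1%nat ltac:(lia)). change (INR 1) with 1 in Hc. rewrite Rpower_base_1 in Hc.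
  pose proof (Cmod_ge_0 (csum (fun n => cpow (INR n) (w - 1)) 1 - cpow 1 w / w)). lra.
Qed.

Lemma clim_mellin_tail_abel a : 0 < a ->
  clim (csum (fun n => csum (fun n => cpow (INR n) (w - 1)) n *
    (Phi (INR n * a)%R - Phi (INR (S n) * a)%R))%C) (cseries (mellin_tail_term w Phi a)).
Proof.
  intros Ha. apply (clim_abel _ (fun n => Phi (INR n * a)%R)).
  - apply (clim_cseries _ (Rpower a (- (1 + Re w))) 1); [lra|].
    intros n Hn. now apply mellin_tail_term_bound.
  - apply (clim_squeeze_0 _ (fun N => (c + / Cmod w) * Rpower a (- (1 + Re w)) * / INR N));
      [apply is_lim_seq_inv_INR|].
    intros N HN. pose proof (INR_ge1 N HN).
    assert (Htail : Cmod (Phi (INR (S N) * a)) <=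
      Rpower (INR N) (- (1 + Re w)) * Rpower a (- (1 + Re w))).
    { destruct (HPhi (INR (S N) * a)) as [_ Hbound]; [now apply INR_mult_pos; [|lia]|].
      eapply Rle_trans; [exact Hbound|]. rewrite Rpower_mult_distr by lra.
      apply Rpower_le_anti_l; [rewrite S_INR; nra|lra]. }
    eapply Rle_trans; [apply Cmod_mult_le; [now apply csum_cpow_bound|exact Htail]|].
    replace (/ INR N) with (Rpower (INR N) (Re w) * Rpower (INR N) (- (1 + Re w))); [right; ring|].
    rewrite <- Rpower_plus. replace (Re w + - (1 + Re w)) with (- (1)) by ring.
    rewrite Rpower_Ropp, Rpower_1 by lra. easy.
Qed.

Lemma clim_sine_tail_telescope a : 0 < a ->
  clim (csum (fun n => cpow a (- w) / w * (Phi0 (INR n * a)%R - Phi0 (INR (S n) * a)%R))%C)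
    (cpow a (- w) / w * Phi0 a)%C.
Proof.
  intros Ha.
  apply (clim_ext (fun N => cpow a (- w) / w * (Phi0 a - Phi0 (INR (S N) * a)%R))%C).
  - intros N _. rewrite csum_scal, (csum_telescope (fun n => Phi0 (INR n * a)%R)).
    do 3 f_equal. change (INR 1) with 1. now rewrite Rmult_1_l.
  - replace (cpow a (- w) / w * Phi0 a)%C with (cpow a (- w) / w * (Phi0 a - 0))%C by ring.
    apply clim_scal. apply (clim_minus (fun _ => Phi0 a)); [apply clim_const|].
    apply (clim_squeeze_0 _ (fun N => / a * / INR N)); [apply is_lim_seq_inv_INR|].
    intros N HN. pose proof (INR_ge1 N HN).
    eapply Rle_trans; [apply sine_tail_0_bound, INR_mult_pos; [easy|lia]|].
    rewrite <- Rinv_mult. apply Rinv_le_contravar; [nra|]. rewrite S_INR. nra.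
Qed.

Lemma sine_tail_increment_compare a n d : 0 < a -> (1 <= n)%nat -> 0 <= d <= 2 ->
  Cmod (cpow (INR n) w * (Phi (INR n * a)%R - Phi (INR (S n) * a)%R)
    - cpow a (- w) * (Phi0 (INR n * a)%R - Phi0 (INR (S n) * a)%R))
  <= Cmod w * Rpower a (1 - Re w - d) * Rpower (INR n) (- d - 1).
Proof.
  intros Ha Hn Hd. assert (Hp : 0 < INR n) by (apply lt_0_INR; lia).
  set (x := INR n * a). assert (Hx : 0 < x) by now apply Rmult_lt_0_compat.
  replace (INR (S n) * a) with (x + a) by (unfold x; rewrite S_INR; ring).
  set (f := fun y => (cpow x w * Phi y - Phi0 y)%C).
  replace (cpow (INR n) w * (Phi x - Phi (x + a)%R) - cpow a (- w)%C * (Phi0 x - Phi0 (x + a)%R))%C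
    with (- cpow a (- w)%C * (f (x + a)%R - f x))%C.
  2:{ unfold f. replace (cpow x w) with (cpow (INR n) w * cpow a w)%C
        by (unfold x; now rewrite cpow_mult_base).
      rewrite cpow_opp. field. apply cpow_neq0. }
  rewrite Cmod_mult, Cmod_opp, cpow_Cmod, re_opp.
  assert (Hf : Cmod (f (x + a)%R - f x) <=
    Cmod w * Rpower x (Re w - 1) * a * Rpower x (- Re w - d) * (x + a - x)).
  { apply (cderiv_bound f (fun y => (cpow y w - cpow x w) * sine_kernel w y)%C); [lra|].
    intros t Ht. split.
    - replace ((cpow t w - cpow x w) * sine_kernel w t)%C
        with (cpow x w * - sine_kernel w t - - sine_kernel 0 t)%C
        by (rewrite <- (cpow_mult_sine_kernel w); ring).
      apply cderiv_minus; [apply cderiv_scal, HPhi; lra|apply HPhi0; lra].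
    - apply Cmod_mult_le.
      + eapply Rle_trans; [apply cpow_diff_bound; lra|].
        apply Rmult_le_compat_l; [|lra].
        apply Rmult_le_pos; [apply Cmod_ge_0|left; apply Rpower_pos].
      + eapply Rle_trans; [apply (sine_kernel_bound w t d); lra|]. apply Rpower_le_anti_l; lra. }
  eapply Rle_trans; [apply Rmult_le_compat_l; [left; apply Rpower_pos|exact Hf]|]. right.
  replace (Rpower a (1 - Re w - d)) with (Rpower a (- Re w) * a * a * Rpower a (- d - 1)).
  - replace (- d - 1) with ((Re w - 1) + (- Re w - d)) by ring.
    unfold x. rewrite !(Rpower_plus (Re w - 1)), <- !Rpower_mult_distr by easy. ring.
  - rewrite <- (Rpower_1 a Ha) at 2 3. rewrite <- !Rpower_plus. f_equal. ring.
Qed.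

Lemma mellin_tail_abel_compare a n d : 0 < a -> (1 <= n)%nat -> 0 <= d <= 2 ->
  Cmod (csum (fun n => cpow (INR n) (w - 1)) n * (Phi (INR n * a)%R - Phi (INR (S n) * a)%R)
    - cpow a (- w) / w * (Phi0 (INR n * a)%R - Phi0 (INR (S n) * a)%R))
  <= (c + 1) * Rpower a (1 - Re w - d) * Rpower (INR n) (- d - 1).
Proof.
  intros Ha Hn Hd. destruct (strip_neq0 w Hw) as (Hw_neq0 & _ & _).
  assert (Hcw : 0 < Cmod w) by now apply Cmod_gt_0.
  assert (Hp : 0 < INR n) by (apply lt_0_INR; lia).
  set (psum := csum (fun n => cpow (INR n) (w - 1)%C) n).
  set (dPhi := (Phi (INR n * a)%R - Phi (INR (S n) * a)%R)%C).
  set (dPhi0 := (Phi0 (INR n * a)%R - Phi0 (INR (S n) * a)%R)%C).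
  set (E := Rpower a (1 - Re w - d)).
  replace (psum * dPhi - cpow a (- w) / w * dPhi0)%C with
    ((psum - cpow (INR n) w / w) * dPhi + / w * (cpow (INR n) w * dPhi - cpow a (- w) * dPhi0))%C
    by (field; easy).
  rewrite !Rmult_plus_distr_r. apply Cmod_plus_le.
  - assert (HdPhi : Cmod dPhi <= Rpower (INR n * a) (- Re w - d) * a).
    { unfold dPhi. rewrite Cmod_minus_sym.
      replace (INR (S n) * a) with (INR n * a + a) by (rewrite S_INR; ring).
      apply (sine_tail_increment_bound w); [easy|now apply Rmult_lt_0_compat|lra..]. }
    eapply Rle_trans; [apply Cmod_mult_le; [now apply Hc|exact HdPhi]|].
    right. unfold E. replace (1 - Re w - d) with ((- Re w - d) + 1) by ring.
    replace (- d - 1) with ((Re w - 1) + (- Re w - d)) by ring.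
    rewrite <- Rpower_mult_distr, !Rpower_plus, Rpower_1 by easy. ring.
  - apply Rle_trans with (/ Cmod w * (Cmod w * E * Rpower (INR n) (- d - 1))); [|right; field; lra].
    apply Cmod_mult_le; [right; now apply Cmod_inv|]. now apply sine_tail_increment_compare.
Qed.

Lemma mellin_tail_near_zero a d : 0 < a -> 0 < d <= 2 ->
  Cmod (mellin_tail w Phi a - cpow a (- w) / w * (1 / 2 - Phi0 a))
    <= (c + 1) * (1 + / d) * Rpower a (1 - Re w - d).
Proof.
  intros Ha Hd. destruct (strip_neq0 w Hw) as (Hw_neq0 & _ & _).
  replace (mellin_tail w Phi a - cpow a (- w) / w * (1 / 2 - Phi0 a))%C with
    (- (cseries (mellin_tail_term w Phi a) - cpow a (- w) / w * Phi0 a))%C.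
  2:{ unfold mellin_tail. rewrite RtoC_2. field. repeat split; (easy || apply RtoC_2_neq0). }
  rewrite Cmod_opp.
  pose proof (clim_minus _ _ _ _ (clim_mellin_tail_abel a Ha) (clim_sine_tail_telescope a Ha)) as Hlim.
  apply (clim_ext _ _ _ (fun N _ => eq_sym (csum_minus _ _ N))) in Hlim.
  rewrite <- (cseries_unique _ _ Hlim).
  replace ((c + 1) * (1 + / d) * Rpower a (1 - Re w - d)) with
    ((c + 1) * Rpower a (1 - Re w - d) * (1 + / d)) by ring.
  apply cseries_bound; [lra|]. intros n Hn. apply mellin_tail_abel_compare; [easy|easy|lra].
Qed.

End NearZero.

Lemma csum_cpow_rate w N : 0 < Re w < 1 -> xi (1 - w)%C = 0%C -> (1 <= N)%nat ->
  Cmod (csum (fun n => cpow (INR n) (w - 1)) N - cpow (INR N) w / w)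
    <= (Cmod (1 - w) / (1 - Re w) + 1) * Rpower (INR N) (Re w - 1).
Proof.
  intros Hw Hxi HN. pose proof (INR_ge1 N HN). destruct (strip_neq0 w Hw) as (Hw_neq0 & _ & _).
  assert (Hcw : 0 < Cmod w) by now apply Cmod_gt_0.
  pose proof (zeta_partial_tail (1 - w)%C N) as Htail.
  rewrite Hxi, re_minus, re_RtoC in Htail. specialize (Htail ltac:(lra) HN).
  replace (0 - zeta_partial (1 - w) N)%C
    with (w * csum (fun n => cpow (INR n) (w - 1)) N - cpow (INR (S N)) w)%C in Htail.
  2:{ unfold zeta_partial. replace (- (1 - w))%C with (w - 1)%C by ring.
      replace (1 - (1 - w))%C with w by ring. ring. }
  replace (1 - (1 - w))%C with w in Htail by ring.
  pose proof (cpow_diff_bound w (INR N) (INR (S N)) ltac:(rewrite S_INR; lra) ltac:(lra)) as Hdiff.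
  replace (INR (S N) - INR N) with 1 in Hdiff by (rewrite S_INR; ring).
  replace (csum (fun n => cpow (INR n) (w - 1)) N - cpow (INR N) w / w)%C with
    (((w * csum (fun n => cpow (INR n) (w - 1)) N - cpow (INR (S N)) w)
      + (cpow (INR (S N)) w - cpow (INR N) w)) / w)%C by (field; easy).
  rewrite Cmod_div by easy. apply Rle_div_l; [easy|].
  replace (- (1 - Re w)) with (Re w - 1) in Htail by ring.
  replace ((Cmod (1 - w) / (1 - Re w) + 1) * Rpower (INR N) (Re w - 1) * Cmod w) with
    (Cmod w * Cmod (1 - w) * (/ (1 - Re w) * Rpower (INR N) (Re w - 1))
     + Cmod w * Rpower (INR N) (Re w - 1) * 1) by (field; lra).
  now apply Cmod_plus_le.
Qed.

(* Boundedness of [mellin_tail] near [0] forces the total mass of the Fejer kernel to be [1 / 2],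
   so that no value of an improper integral has to be computed. *)
Lemma half_sub_sine_tail_bound (Phi0 : R -> C) (M e : R) : is_sine_tail 0 Phi0 -> 0 < e ->
  (forall a, 0 < a <= 1 -> Cmod (1 / 2 - Phi0 a) <= M * Rpower a e) ->
  forall a, 0 < a <= 1 -> Cmod (1 / 2 - Phi0 a) <= a.
Proof.
  intros HPhi0 He Hsmall a Ha.
  enough (Cmod (1 / 2 - Phi0 a) - a <= 0) by lra.
  apply (le_0_of_Rpower_bound _ M e a); [easy|easy|]. intros b Hb.
  assert (Hincr : Cmod (Phi0 a - Phi0 b) <= a - b).
  { pose proof (sine_tail_increment_bound 0 Phi0 b (a - b) 0 HPhi0 ltac:(lra) ltac:(lra)
      ltac:(rewrite re_RtoC; lra) ltac:(lra)) as Hb0.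
    rewrite re_RtoC in Hb0. replace (- 0 - 0) with 0 in Hb0 by ring.
    rewrite Rpower_O in Hb0 by easy. replace (b + (a - b)) with a in Hb0 by ring. lra. }
  replace (1 / 2 - Phi0 a)%C with ((1 / 2 - Phi0 b) - (Phi0 a - Phi0 b))%C by ring.
  pose proof (Cmod_minus_le _ _ _ _ (Hsmall b ltac:(lra)) Hincr). lra.
Qed.

Lemma Rpower_le1 a e : 0 < a <= 1 -> 0 <= e -> Rpower a e <= 1.
Proof. intros Ha He. rewrite <- (Rpower_O a) by easy. now apply Rpower_le_anti_r. Qed.

Lemma xi_zero_asymptotics w : 0 < Re w < 1 -> xi (1 - w)%C = 0%C ->
  exists (Phi0 : R -> C) (K : R), is_sine_tail 0 Phi0 /\ 0 <= K /\ forall a, 0 < a <= 1 ->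
    Cmod (xi w / ((1 - w) * w * (w + 1)) - cpow a (- w) / w * (1 / 2 - Phi0 a))
      <= K * Rpower a ((1 - Re w) / 2).
Proof.
  intros Hw Hxi. destruct (strip_neq0 w Hw) as (Hw_neq0 & Hw1_neq0 & H1w_neq0).
  destruct (ex_sine_tail w ltac:(lra)) as [Phi HPhi].
  destruct (ex_sine_tail 0%C ltac:(rewrite re_RtoC; lra)) as [Phi0 HPhi0].
  set (d := (1 - Re w) / 2). assert (Hd : 0 < d <= 2) by (unfold d; lra).
  set (c := Cmod (1 - w) / (1 - Re w) + 1).
  assert (Hc : 0 <= c).
  { assert (0 <= Cmod (1 - w) / (1 - Re w)) by (apply Rdiv_le_0_compat; [apply Cmod_ge_0|lra]).
    unfold c. lra. }
  exists Phi0, ((c + 1) * (1 + / d) + Cmod (/ (2 * (1 - w)))). split; [easy|]. split.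
  { pose proof (Rinv_0_lt_compat d (proj1 Hd)). pose proof (Cmod_ge_0 (/ (2 * (1 - w)))).
    assert (0 <= (c + 1) * (1 + / d)) by (apply Rmult_le_pos; lra). lra. }
  intros a Ha.
  replace (xi w / ((1 - w) * w * (w + 1)) - cpow a (- w) / w * (1 / 2 - Phi0 a))%C
    with ((mellin_tail w Phi a - cpow a (- w) / w * (1 / 2 - Phi0 a)) +
      / (2 * (1 - w)) * cpow a (1 - w))%C.
  2:{ rewrite (xi_mellin_tail w Phi Hw HPhi a Ha). field. now repeat split. }
  rewrite Rmult_plus_distr_r. apply Cmod_plus_le.
  - replace d with (1 - Re w - d) at 2 by (unfold d; field).
    apply mellin_tail_near_zero; [easy|easy|easy| |lra|easy]. intros. now apply csum_cpow_rate.
  - rewrite Cmod_mult, cpow_Cmod, re_minus, re_RtoC. apply Rmult_le_compat_l; [apply Cmod_ge_0|].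
    apply Rpower_le_anti_r; [easy|unfold d; lra].
Qed.

(* The functional equation enters only through this symmetry of the zeros. *)
Lemma xi_zero_reflect w : 0 < Re w < 1 -> xi (1 - w)%C = 0%C -> xi w = 0%C.
Proof.
  intros Hw Hxi. destruct (strip_neq0 w Hw) as (Hw_neq0 & Hw1_neq0 & H1w_neq0).
  destruct (xi_zero_asymptotics w Hw Hxi) as (Phi0 & K & HPhi0 & HK & Hlead).
  set (A := (xi w / ((1 - w) * w * (w + 1)))%C) in *. set (d := (1 - Re w) / 2) in *.
  assert (Hcw : 0 < Cmod w) by now apply Cmod_gt_0.
  set (v := fun a => (cpow a (- w) / w * (1 / 2 - Phi0 a))%C).
  assert (Hv : forall a, 0 < a -> Cmod (1 / 2 - Phi0 a) = Cmod w * Cmod (v a) * Rpower a (Re w)).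
  { intros a Ha. unfold v. rewrite Cmod_mult, Cmod_div, cpow_Cmod, re_opp, Rpower_Ropp by easy.
    pose proof (Rpower_pos a (Re w)). field. lra. }
  assert (Hhalf : forall a, 0 < a <= 1 -> Cmod (1 / 2 - Phi0 a) <= a).
  { apply (half_sub_sine_tail_bound Phi0 (Cmod w * (Cmod A + K)) (Re w)); [easy|lra|].
    intros a Ha. rewrite Hv by easy.
    apply Rmult_le_compat_r; [left; apply Rpower_pos|]. apply Rmult_le_compat_l; [lra|].
    replace (v a) with (A - (A - v a))%C by ring.
    apply Cmod_minus_le; [lra|]. eapply Rle_trans; [now apply Hlead|].
    pose proof (Rpower_le1 a d Ha ltac:(unfold d; lra)). nra. }
  assert (HA : Cmod A <= 0).
  { apply (le_0_of_Rpower_bound _ (K + / Cmod w) d 1); [unfold d; lra|lra|]. intros a Ha.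
    replace A with ((A - v a) + v a)%C by ring.
    rewrite Rmult_plus_distr_r. apply Cmod_plus_le; [now apply Hlead|].
    apply Rle_trans with (/ Cmod w * Rpower a (1 - Re w)).
    - specialize (Hhalf a Ha). rewrite Hv in Hhalf by easy.
      unfold Rminus. rewrite Rpower_plus, Rpower_1, Rpower_Ropp by easy.
      pose proof (Rpower_pos a (Re w)).
      apply Rmult_le_reg_l with (Cmod w); [easy|]. apply Rmult_le_reg_r with (Rpower a (Re w)); [easy|].
      eapply Rle_trans; [exact Hhalf|]. right. field. lra.
    - apply Rmult_le_compat_l; [left; now apply Rinv_0_lt_compat|].
      apply Rpower_le_anti_r; [easy|unfold d; lra]. }
  assert (HA0 : A = 0%C) by (apply Cmod_eq_0, Rle_antisym; [easy|apply Cmod_ge_0]).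
  replace (xi w) with (A * ((1 - w) * w * (w + 1)))%C by (unfold A; field; now repeat split).
  rewrite HA0. ring.
Qed.

(** * Zeros of the eta series *)

Definition eta_term (s : C) (n : nat) : C := (RtoC ((-1) ^ (pred n)) * cpow (INR n) (- s)%C)%C.

Lemma is_series_clim (f : nat -> C) (l : C) :
  is_series (K := C_AbsRing) (V := C_NormedModule) (fun n => f (S n)) l -> clim (csum f) l.
Proof.
  intros H P HP. destruct (H P HP) as [N HN]. exists (S N). intros [|n] Hn; [lia|].
  replace (csum f (S n)) with (sum_n (G := C_AbelianMonoid) (fun n => f (S n)) n).
  - apply HN. lia.
  - clear. induction n as [|n IH].
    + rewrite sum_O. cbn [csum]. now rewrite Cplus_0_l.
    + now rewrite sum_Sn, IH.
Qed.

Lemma cpow_double n z : (1 <= n)%nat -> cpow (INR (2 * n)) z = (cpow 2 z * cpow (INR n) z)%C.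
Proof.
  intros Hn. rewrite mult_INR, cpow_mult_base by (lra || apply lt_0_INR; lia). easy.
Qed.

Lemma csum_eta_term_even s N :
  csum (eta_term s) (2 * N) =
  (csum (fun n => cpow (INR n) (- s)) (2 * N) -
    cpow 2 (1 - s) * csum (fun n => cpow (INR n) (- s)) N)%C.
Proof.
  induction N as [|N IH]; [cbn; ring|].
  assert (Hdouble : cpow (INR (S (S (2 * N)))) (- s)%C = (cpow 2 (- s)%C * cpow (INR (S N)) (- s)%C)%C).
  { rewrite <- cpow_double by lia. do 2 f_equal. lia. }
  replace (2 * S N)%nat with (S (S (2 * N))) by lia.
  cbn [csum]. rewrite IH. unfold eta_term. cbn [pred].
  rewrite pow_1_even, pow_1_odd, Hdouble. change (-1) with (- (1)). rewrite RtoC_opp.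
  replace (1 - s)%C with (- s + 1)%C by ring. rewrite cpow_succ, RtoC_2 by lra. ring.
Qed.

Lemma clim_csum_eta_even s : 0 < Re s ->
  clim (fun N => (s - 1) * csum (eta_term s) (2 * N))%C ((1 - cpow 2 (1 - s)) * xi s)%C.
Proof.
  intros Hs. set (q := cpow 2 (1 - s)%C).
  apply (clim_ext (fun N => zeta_partial s (2 * N) + - q * zeta_partial s N
    + (cpow (INR (S (S (2 * N)))) (1 - s) - cpow (INR (S (2 * N))) (1 - s)))%C).
  - intros N _. rewrite csum_eta_term_even. unfold zeta_partial. fold q.
    replace (cpow (INR (S (S (2 * N)))) (1 - s)%C) with (q * cpow (INR (S N)) (1 - s)%C)%C; [ring|].
    unfold q. rewrite <- cpow_double by lia. do 2 f_equal. lia.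
  - replace ((1 - q) * xi s)%C with (xi s + - q * xi s + 0)%C by ring.
    assert (Heven : forall u l, clim u l -> clim (fun n => u (2 * n)%nat) l)
      by (intros u l; apply (clim_subseq u l (fun n => 2 * n)%nat); intros; lia).
    pose proof (clim_zeta_partial s Hs) as Hlim.
    apply clim_plus; [apply clim_plus; [now apply Heven|now apply clim_scal]|].
    apply (Heven (fun M => cpow (INR (S (S M))) (1 - s) - cpow (INR (S M)) (1 - s))%C).
    apply (clim_squeeze_0 _ (fun M => Cmod (1 - s)%C * Rpower (INR (S M)) (- Re s))).
    + now apply is_lim_seq_scal_0, is_lim_seq_Rpower_neg_S.
    + intros M _. pose proof (INR_S_pos M). rewrite (S_INR (S M)).
      eapply Rle_trans; [apply cpow_diff_bound; [lra|rewrite re_minus, re_RtoC; lra]|].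
      rewrite re_minus, re_RtoC. replace (1 - Re s - 1) with (- Re s) by ring. lra.
Qed.

Lemma one_minus_cpow2_neq0 (w : C) : 0 < Re w -> (1 - cpow 2 w)%C <> 0%C.
Proof.
  intros Hw H.
  assert (Hq : cpow 2 w = 1%C)
    by (replace (cpow 2 w) with (1 - (1 - cpow 2 w))%C by ring; rewrite H; ring).
  pose proof (cpow_Cmod 2 w) as Hm. rewrite Hq, Cmod_1 in Hm.
  pose proof (Rpower_lt 2 0 (Re w) ltac:(lra) Hw) as Hlt. rewrite Rpower_O in Hlt by lra. lra.
Qed.

Lemma xi_eta_zero s : 0 < Re s < 1 -> clim (csum (eta_term s)) 0%C -> xi s = 0%C.
Proof.
  intros Hs Heta. set (q := cpow 2 (1 - s)%C).
  assert (Hq : (1 - q)%C <> 0%C) by (apply one_minus_cpow2_neq0; rewrite re_minus, re_RtoC; lra).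
  assert (E : ((1 - q) * xi s = (s - 1) * 0)%C).
  { apply (clim_unique (fun N => (s - 1) * csum (eta_term s) (2 * N))%C);
      [apply clim_csum_eta_even; lra|].
    apply clim_scal, (clim_subseq (csum (eta_term s)) _ (fun n => 2 * n)%nat); [intros; lia|easy]. }
  replace (xi s) with ((1 - q) * xi s / (1 - q))%C by (field; easy).
  rewrite E. field. easy.
Qed.

Lemma alternating_rsum_lower (u : nat -> R) N : (forall n, (1 <= n)%nat -> u (S n) <= u n) ->
  u 1%nat - u 2%nat <= rsum (fun n => (-1) ^ (pred n) * u n) (2 * S N).
Proof.
  intros Hu. induction N as [|N IH].
  - simpl. lra.
  - replace (2 * S (S N))%nat with (S (S (2 * S N))) by lia.
    cbn [rsum pred]. rewrite pow_1_even, pow_1_odd.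
    pose proof (Hu (S (2 * S N)) ltac:(lia)). lra.
Qed.

Lemma eta_real_neq0 s : 0 < Re s -> Im s = 0 -> ~ clim (csum (eta_term s)) 0%C.
Proof.
  intros Hs Him Heta. set (x := Re s) in *.
  assert (Es : (- s)%C = RtoC (- x))
    by (destruct s; unfold RtoC, Copp; simpl in *; now rewrite Him, Ropp_0).
  assert (Hsum : forall N, csum (eta_term s) N =
    RtoC (rsum (fun n => (-1) ^ (pred n) * Rpower (INR n) (- x)) N)).
  { intros N. rewrite <- csum_RtoC. apply csum_ext. intros n _.
    unfold eta_term. now rewrite Es, cpow_RtoC, RtoC_mult. }
  assert (Hanti : Rpower 2 (- x) < 1).
  { rewrite <- (Rpower_O 2) by lra. apply Rpower_lt; lra. }
  assert (Hle : Rbar_le (1 - Rpower 2 (- x)) (Re 0%C)).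
  { apply (is_lim_seq_le (fun _ => 1 - Rpower 2 (- x)) (fun n => Re (csum (eta_term s) (2 * S n))));
      [|apply is_lim_seq_const|].
    - intros n. rewrite Hsum, re_RtoC, <- (Rpower_base_1 (- x)).
      apply (alternating_rsum_lower (fun n => Rpower (INR n) (- x))).
      intros m Hm. pose proof (INR_ge1 m Hm). rewrite S_INR. apply Rpower_le_anti_l; lra.
    - apply (clim_Re_Im (fun n => csum (eta_term s) (2 * S n)) 0%C).
      apply (clim_subseq (csum (eta_term s)) _ (fun n => 2 * S n)%nat); [intros; lia|easy]. }
  rewrite re_RtoC in Hle. simpl in Hle. lra.
Qed.

Lemma nontrivial_zeta_zero_eta s : nontrivial_zeta_zero s -> clim (csum (eta_term s)) 0%C.
Proof.
  intros [Hs (_ & _ & eta & Heta & Hz)].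
  assert (Hq : (1 - cpow 2 (1 - s)%C)%C <> 0%C).
  { apply one_minus_cpow2_neq0. rewrite re_minus, re_RtoC. lra. }
  replace eta with (RtoC 0) in Heta; [now apply is_series_clim|].
  replace eta with (eta / (1 - cpow 2 (1 - s)%C) * (1 - cpow 2 (1 - s)%C))%C by (field; easy).
  rewrite <- Hz. ring.
Qed.

Lemma nontrivial_zeta_zero_xi s : nontrivial_zeta_zero s -> Im s <> 0 /\ xi s = 0%C.
Proof.
  intros Hs. pose proof (nontrivial_zeta_zero_eta s Hs) as Heta. split.
  - intros Him. apply (eta_real_neq0 s); [apply Hs|easy|easy].
  - apply xi_eta_zero; [apply Hs|easy].
Qed.

Lemma xi_zero_le_half s : (forall theta, 1 / 2 < theta -> power_bounded Epsi theta) ->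
  Re s < 1 -> Im s <> 0 -> xi s = 0%C -> Re s <= 1 / 2.
Proof.
  intros HE Hs1 Him Hxi. apply Rnot_lt_le. intros Hs.
  apply (xi_neq0 ((1 / 2 + Re s) / 2) s); try easy; [apply HE|..]; lra.
Qed.

Theorem theorem5p1 :
  (exists C : R, 0 < C /\ exists X0 : R, forall X : R, X0 <= X ->
     Rbar_le (Etilde X)
       (Rbar_plus (Rbar_mult (Finite (5 / 6)) (Etilde (Rpower X (3 / 4))))
                  (Finite (C * sqrt X * ln X)))) ->
  forall s : C, nontrivial_zeta_zero s -> Re s = 1 / 2.
Proof.
  intros (K & HK & X0 & Hrec) s Hs.
  assert (HE : forall theta, 1 / 2 < theta -> power_bounded Epsi theta)
    by (intros theta; now apply (Epsi_power_bounded K X0)).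
  destruct (nontrivial_zeta_zero_xi s Hs) as [Him Hxi]. destruct Hs as [Hstrip _].
  assert (Hre : Re (1 - s) = 1 - Re s) by (rewrite re_minus, re_RtoC; easy).
  apply Rle_antisym; [now apply xi_zero_le_half|].
  enough (Re (1 - s) <= 1 / 2) by lra.
  apply xi_zero_le_half; [easy|lra| |].
  - rewrite im_minus, im_RtoC. lra.
  - apply xi_zero_reflect; [lra|]. now replace (1 - (1 - s))%C with s by ring.
Qed.
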